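(* Let $\omega>0$ and $\sigma\in[\frac54,\frac32]$. Then the semigroup $S_\omega(t)=e^{t\mathbb{A}_\omega}$ on $\mathcal{H}_\omega$ is analytic.
   Context: Let $\mathbf{H}$ be a complex Hilbert space with inner product $\langle\cdot,\cdot\rangle$ and norm $\|\cdot\|$, and let $A:\mathfrak{D}(A)\subseteq\mathbf{H}\to\mathbf{H}$ be an unbounded, self-adjoint, positive definite (strictly positive) operator with compact resolvent. For $r\in\mathbb{R}$ let $\mathbf{H}^r=\mathfrak{D}(A^{r/2})$ with $\langle u,v\rangle_r=\langle A^{r/2}u,A^{r/2}v\rangle$ and $\|u\|_r=\|A^{r/2}u\|$, except that for $\omega>0$ the space $\mathbf{H}^1$ also carries the equivalent norm $\|z\|_{\mathbf{H}^1}=(\|z\|^2+\omega\|z\|_1^2)^{1/2}$; for $r>0$, $\mathbf{H}^{-r}$ is the completion of $\mathbf{H}$ in $\|\cdot\|_{-r}$ (the dual of $\mathbf{H}^r$), and $A^s$ is extended to act $\mathbf{H}^r\to\mathbf{H}^{r-2s}$. For $\omega>0$ the operator $I+\omega A:\mathbf{H}^1\to\mathbf{H}^{-1}$ is defined by $\langle(I+\omega A)z_1,z_2\rangle_{\mathbf{H}^{-1}\times\mathbf{H}^1}=\langle z_1,z_2\rangle+\omega\langle A^{1/2}z_1,A^{1/2}z_2\rangle$ and is invertible. The system considered is, for $\sigma\in[0,\frac32]$ and $\omega>0$, $$u_{tt}+\omega Au_{tt}+A^2u-A^\sigma\theta=0,\qquad \theta_t+A\theta+A^\sigma u_t=0.$$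 The phase space is $\mathcal{H}_\omega=\mathbf{H}^2\times\mathbf{H}^1\times\mathbf{H}$ with norm $\|(u,v,\theta)\|_{\mathcal{H}_\omega}^2=\|u\|_2^2+\|v\|_{\mathbf{H}^1}^2+\|\theta\|^2$. The operator $\mathbb{A}_\omega$ on $\mathcal{H}_\omega$ is $$\mathbb{A}_\omega(u,v,\theta)=\big(v,\;(I+\omega A)^{-1}(-A^2u+A^\sigma\theta),\;-A\theta-A^\sigma v\big),$$ where $-A^2u+A^\sigma\theta=A^2(-u+A^{\sigma-2}\theta)$ and $-A\theta-A^\sigma v=A(-\theta-A^{\sigma-1}v)$, with domain $$\mathfrak{D}(\mathbb{A}_\omega)=\{(u,v,\theta)\in\mathcal{H}_\omega:\ v\in\mathbf{H}^2,\ -u+A^{\sigma-2}\theta\in\mathbf{H}^3,\ -\theta-A^{\sigma-1}v\in\mathbf{H}^2\}.$$ For $0\le\sigma\le\frac32$ it is known that $\mathbb{A}_\omega$ generates a $C_0$-semigroup of contractions $S_\omega(t)=e^{t\mathbb{A}_\omega}$ on $\mathcal{H}_\omega$. *)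

(* Defs.v *)
From HB Require Import structures.
From mathcomp Require Import all_boot all_order all_algebra complex.
From mathcomp Require Import all_classical all_reals all_analysis.

Set Implicit Arguments.
Unset Strict Implicit.
Unset Printing Implicit Defensive.

Import Order.TTheory GRing.Theory Num.Theory numFieldNormedType.Exports.

Local Open Scope classical_set_scope.
Local Open Scope ring_scope.
Local Open Scope complex_scope.

(* A complex Hilbert space is a Banach space [H] over [R[i]] together with a
   positive definite hermitian form [ip] (linear in its first argument)
   inducing its norm. *)
Definition hilbert_norm (R : realType) (H : completeNormedModType R[i])
    (ip : {dot H for Num.conj}) : Prop :=
  forall x : H, `|x| ^+ 2 = ip x x.

(* The norm of [H] takes its values in [R[i]]; they are real. *)
Definition rnorm (R : realType) (H : completeNormedModType R[i]) (x : H) : R :=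
  complex.Re `|x|.

(* The values of [opfun] outside [opdom] are irrelevant. *)
Record operator (R : realType) (H : completeNormedModType R[i]) := Operator {
  opdom : set H ;
  opfun :> H -> H
}.

Section Operators.
Variables (R : realType) (H : completeNormedModType R[i]).
Variable ip : {dot H for Num.conj}.
Implicit Type A : operator H.

Definition linear_operator A : Prop :=
  opdom A 0 /\
  forall (a : R[i]) (x y : H), opdom A x -> opdom A y ->
    opdom A (a *: x + y) /\ A (a *: x + y) = a *: A x + A y.

Definition unbounded_operator A : Prop :=
  ~ exists M : R, forall x, opdom A x -> rnorm (A x) <= M * rnorm x.

(* A is densely defined and equal to its adjoint, domains included. *)
Definition self_adjoint A : Prop :=
  dense (opdom A) /\
  forall y z : H,
    (forall x, opdom A x -> ip (A x) y = ip x z) <-> (opdom A y /\ A y = z).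

Definition positive_definite A : Prop :=
  forall x, opdom A x -> x != 0 -> 0 < ip (A x) x.

Definition is_resolvent A (z : R[i]) (K : H -> H) : Prop :=
  [/\ forall y, opdom A (K y) /\ z *: K y - A (K y) = y,
      forall x, opdom A x -> K (z *: x - A x) = x
    & exists M : R, forall y, rnorm (K y) <= M * rnorm y].

Definition compact_operator (K : H -> H) : Prop :=
  precompact (K @` [set x : H | `|x| <= 1]).

Definition compact_resolvent A : Prop :=
  exists (z : R[i]) (K : H -> H), is_resolvent A z K /\ compact_operator K.

Definition eigenbasis A (b : (nat -> H) * (nat -> R)) : Prop :=
  [/\ forall j k, ip (b.1 j) (b.1 k) = (j == k)%:R,
      forall x : H, (forall k, ip x (b.1 k) = 0) -> x = 0
    & forall k, opdom A (b.1 k) /\ A (b.1 k) = (b.2 k)%:C *: b.1 k].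

(* By the spectral theorem an eigenbasis exists as soon as A is unbounded,
   self-adjoint and has compact resolvent; the powers of A below do not depend
   on the one that is chosen. *)
Definition spectral_basis A : (nat -> H) * (nat -> R) := get (eigenbasis A).

Definition power_terms A (s : R) (x : H) : nat -> H := fun k =>
  let b := spectral_basis A in
  ((b.2 k `^ s)%:C * ip x (b.1 k)) *: b.1 k.

(* A^s x = \sum_k lambda_k^s <x, e_k> e_k, where D(A^s) is the set of the x
   for which the series converges in H; for s <= 0 it is the whole of H. *)
Definition dom_power A (s : R) : set H :=
  [set x | cvgn (series (power_terms A s x))].

Definition power A (s : R) (x : H) : H := limn (series (power_terms A s x)).

(* H^r for r >= 0 *)
Definition Hs A (r : R) : set H := dom_power A (r / 2).

Definition Hs_norm A (r : R) (x : H) : R := rnorm (power A (r / 2) x).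

(* For q > 0, H^{-q} is represented as the space of conjugate-linear
   functionals on H^q, h in H being identified with phi |-> <h, phi>. If x is
   in H^r and r - 2s = - q < 0, then [dual_power A s r x] is A^s x in H^{-q}:
   it maps phi in H^q to <A^s x, phi> = <A^{r/2} x, A^{s - r/2} phi>, where
   s - r/2 = q/2. *)
Definition dual_power A (s r : R) (x phi : H) : R[i] :=
  ip (power A (r / 2) x) (power A (s - r / 2) phi).

(* (I + omega A) z as an element of H^{-1}, for z in H^1 *)
Definition I_plus_omega_A A (omega : R) (z phi : H) : R[i] :=
  ip z phi + omega%:C * ip (power A 2^-1 z) (power A 2^-1 phi).

Definition eq_Hm1 A (f g : H -> R[i]) : Prop :=
  forall phi, Hs A 1 phi -> f phi = g phi.

Definition phase_space A : set (H * H * H) :=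
  [set U | let: (u, v, theta) := U in Hs A 2 u /\ Hs A 1 v].

Definition phase_norm A (omega : R) (U : H * H * H) : R :=
  let: (u, v, theta) := U in
  Num.sqrt (Hs_norm A 2 u ^+ 2
            + (rnorm v ^+ 2 + omega * Hs_norm A 1 v ^+ 2)
            + rnorm theta ^+ 2).

Definition dom_Aomega A (sigma : R) : set (H * H * H) :=
  [set U | let: (u, v, theta) := U in
    [/\ phase_space A U,
        Hs A 2 v,
        Hs A 3 (- u + power A (sigma - 2) theta)
      & Hs A 2 (- theta - power A (sigma - 1) v)]].

(* The graph of the operator: the second component w of the image of
   (u, v, theta), (I + omega A)^{-1} A^2 (- u + A^{sigma - 2} theta), is the
   w in H^1 such that (I + omega A) w = A^2 (- u + A^{sigma - 2} theta) in
   H^{-1}. *)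
Definition graph_Aomega A (omega sigma : R) (U W : H * H * H) : Prop :=
  dom_Aomega A sigma U /\
  let: (u, v, theta) := U in
  let: (w1, w2, w3) := W in
  [/\ w1 = v,
      Hs A 1 w2,
      eq_Hm1 A (I_plus_omega_A A omega w2)
               (dual_power A 2 3 (- u + power A (sigma - 2) theta))
    & w3 = A (- theta - power A (sigma - 1) v)].

End Operators.

(* Semigroups on the normed space (X, N), where X is a subspace of E and N a
   norm on X. Operators on X are functions on E, only used on X. *)
Section Semigroups.
Variables (R : realType) (E : lmodType R[i]) (X : set E) (N : E -> R).

Definition bounded_operator (T : E -> E) : Prop :=
  [/\ forall x, X x -> X (T x),
      forall (a : R[i]) x y, X x -> X y -> T (a *: x + y) = a *: T x + T y
    & exists M : R, forall x, X x -> N (T x) <= M * N x].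

Definition C0_semigroup (S : R -> E -> E) : Prop :=
  [/\ forall t, 0 <= t -> bounded_operator (S t),
      forall x, X x -> S 0 x = x,
      forall s t x, 0 <= s -> 0 <= t -> X x -> S (s + t) x = S s (S t x)
    & forall x, X x -> N (S t x - x) @[t --> 0^'+] --> (0 : R)].

(* G is the graph of the infinitesimal generator of S, domain included. *)
Definition generated_by (S : R -> E -> E) (G : E -> E -> Prop) : Prop :=
  forall x y, G x y <->
    [/\ X x, X y &
        N ((h^-1)%:C *: (S h x - x) - y) @[h --> 0^'+] --> (0 : R)].

(* {z <> 0 : |arg z| < delta} *)
Definition sector (delta : R) : set R[i] :=
  [set z | exists r alpha : R,
    [/\ 0 < r, `|alpha| < delta & z = (r * cos alpha) +i* (r * sin alpha)]].

(* Complex differentiability in the operator norm at each point of D *)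
Definition norm_holomorphic (D : set R[i]) (T : R[i] -> E -> E) : Prop :=
  forall z, D z -> exists2 L : E -> E, bounded_operator L &
    forall eps : R, 0 < eps ->
      \forall h \near (0 : R[i]^o)^',
        forall x, X x ->
          N ((h : R[i])^-1 *: (T (z + h) x - T z x) - L x) <= eps * N x.

(* The semigroup S extends to an analytic semigroup T on a sector. *)
Definition analytic_semigroup (S : R -> E -> E) : Prop :=
  exists (delta : R) (T : R[i] -> E -> E),
    0 < delta <= pi / 2 /\
    [/\ forall z, sector delta z -> bounded_operator (T z),
        forall t x, 0 <= t -> X x -> T t%:C x = S t x,
        forall z1 z2 x, sector delta z1 -> sector delta z2 -> X x ->
          T (z1 + z2) x = T z1 (T z2 x),
        norm_holomorphic (sector delta) T
      & forall delta' x, 0 < delta' < delta -> X x ->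
          N (T z x - x) @[z --> within (sector delta') (nbhs (0 : R[i]^o))]
            --> (0 : R)].

End Semigroups.

(* Main.v *)
(** The eigenbasis of [A] splits the system into three-dimensional modes. In the
    coordinates [(lambda u, sqrt (1 + omega lambda) v, theta)], in which the phase
    norm is the l^2 norm, the mode of eigenvalue [lambda] evolves under
    [lambda * M], with [M] the real matrix
    [[0, t r^2, 0], [- t r^2, 0, r], [0, - r, - 1]],
    [r = lambda^(sigma - 1) / sqrt (1 + omega lambda)] and
    [t = lambda^(2 - 2 sigma) * sqrt (1 + omega lambda)]. The bounds
    [sigma <= 3/2] and [5/4 <= sigma] are what keeps [r] and [t] bounded
    uniformly in [lambda >= lambda_0].

    For [x = (p, q, h)] put [D x = (t r p)^2 + (r q)^2 + h^2]. The norm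
    [V x = p^2 + q^2 + h^2 + 2 eps^3 t p q + 2 eps^2 r q h] is equivalent to the
    euclidean one, and the form [B (x, y) = V (M x, y)] satisfies
    [- B (x, x) >= c D x] and [|B (x, y)| <= C sqrt (D x * D y)], uniformly in
    bounded [t] and [r]. Hence [V] decreases along [y' = (1 + i k) M y] for small
    [|k|]; moreover [V (M y) = B (y, M y)] is controlled by [D y] and [D (M y)], so
    that [K V (y) + s^2 V (M y)] is nonincreasing as well. This bounds
    [exp (z M)] and [z M exp (z M)] on a sector independently of the mode, and the
    modal exponentials assemble into an analytic semigroup.

    That semigroup is the given [S]: by a gliding hump [S] is bounded near 0, and
    the two agree to first order on each mode, hence on their span. *)
Require Import Defs.
From HB Require Import structures.
From mathcomp Require Import all_boot all_order all_algebra complex.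
From mathcomp Require Import all_classical all_reals all_analysis.
From mathcomp Require Import ring lra.
Set Implicit Arguments.
Unset Strict Implicit.
Unset Printing Implicit Defensive.
Import Order.TTheory GRing.Theory Num.Theory numFieldNormedType.Exports.
Local Open Scope classical_set_scope.
Local Open Scope ring_scope.
Local Open Scope complex_scope.

(** Damping acts directly on [h] alone; it reaches [q] through the coupling [r], and [p] through
    [t r^2 = 1 / sqrt (1 + omega lambda)]. The last route fades on high modes: [M] has determinant
    [- (t r^2)^2], so its flow has no decay rate uniform in the mode. What survives is that [M]
    degenerates together with its damping: the factors [t r] and [r] that weight [p] and [q] in [D]
    can be split off from the entries of [M]. This is why [B] is bounded through [D] and not merely
    through the euclidean norm, and why smoothing is uniform although decay is not.

    The bounds on [exp (z M)], [z M exp (z M)] and [z^2 M^2 exp (z M)] are invariant under dilation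
    of [z], so the factor [lambda], unbounded along the modes, costs nothing. The third bound
    controls the remainder of difference quotients uniformly in the mode, which is what holomorphy
    in operator norm requires.

    The powers of [A] rest on an eigenbasis picked by choice and carry information only if one
    exists; that the generator of [S] is the prescribed graph supplies it. *)

Section RealNorm.
Variable R : realType.
Variable V : normedZmodType R[i].
Implicit Types x y : V.

(** Norms over [R[i]] are complex numbers; taking real parts lets order arguments, [lra] included,
    run over [R]. On [H] this is convertible to [rnorm], and the same definition serves [R[i]]
    itself. *)
Definition rn x : R := complex.Re `|x|.

Lemma rnE x : `|x| = (rn x)%:C.
Proof. by rewrite RRe_real ?normr_real. Qed.

Lemma rn_ge0 x : 0 <= rn x.
Proof. by rewrite -ler0c -rnE. Qed.

Lemma rn0 : rn 0 = 0.
Proof. by rewrite /rn normr0. Qed.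

Lemma rn0_eq0 x : rn x = 0 -> x = 0.
Proof. by move=> x0; apply: normr0_eq0; rewrite rnE x0. Qed.

Lemma rnN x : rn (- x) = rn x.
Proof. by rewrite /rn normrN. Qed.

Lemma rnBC x y : rn (x - y) = rn (y - x).
Proof. by rewrite /rn distrC. Qed.

Lemma rnD x y : rn (x + y) <= rn x + rn y.
Proof. by rewrite -lecR rmorphD /= -!rnE ler_normD. Qed.

Lemma rnB x y : rn (x - y) <= rn x + rn y.
Proof. by rewrite -(rnN y) rnD. Qed.

Lemma rn_sum (I : Type) (r : seq I) (P : pred I) (F : I -> V) :
  rn (\sum_(i <- r | P i) F i) <= \sum_(i <- r | P i) rn (F i).
Proof.
elim/big_ind2: _ => [|x1 x2 y1 y2 h1 h2|//]; first by rewrite rn0.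
by rewrite (le_trans (rnD _ _))// lerD.
Qed.

End RealNorm.

Section ComplexModulus.
Variable R : realType.
Implicit Types (z w : R[i]) (x y : R).

Lemma rnM z w : rn (z * w) = rn z * rn w.
Proof. by apply: complexI; rewrite rmorphM /= -!rnE normrM. Qed.

Lemma rn1 : rn (1 : R[i]) = 1.
Proof. by rewrite /rn normr1. Qed.

Lemma rnX z n : rn (z ^+ n) = rn z ^+ n.
Proof. by elim: n => [|n IH]; rewrite ?rn1// !exprS rnM IH. Qed.

Lemma rnV z : rn z^-1 = (rn z)^-1.
Proof. by apply: complexI; rewrite -rnE normfV rnE fmorphV. Qed.

Lemma rn_real x : rn x%:C = `|x|.
Proof.
by rewrite /rn normc_def /= expr0n addr0 sqrtr_sqr.
Qed.

Lemma rn_sqr z : rn z ^+ 2 = complex.Re z ^+ 2 + complex.Im z ^+ 2.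
Proof. by rewrite /rn normc_def/= sqr_sqrtr// addr_ge0 ?sqr_ge0. Qed.

Lemma Re_le_rn z : `|complex.Re z| <= rn z.
Proof.
rewrite -(ler_pXn2r (n := 2)) ?nnegrE ?rn_ge0//.
by rewrite rn_sqr real_normK ?num_real// lerDl sqr_ge0.
Qed.

Lemma Im_le_rn z : `|complex.Im z| <= rn z.
Proof.
rewrite -(ler_pXn2r (n := 2)) ?nnegrE ?rn_ge0//.
by rewrite rn_sqr real_normK ?num_real// lerDr sqr_ge0.
Qed.

Lemma rn_le_ReIm z : rn z <= `|complex.Re z| + `|complex.Im z|.
Proof.
rewrite -(ler_pXn2r (n := 2)) ?nnegrE ?rn_ge0 ?addr_ge0//.
rewrite rn_sqr sqrrD !real_normK ?num_real// addrAC lerDl.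
by rewrite mulrn_wge0// mulr_ge0.
Qed.

Lemma conj_real x : Num.conj x%:C = x%:C :> R[i].
Proof. by apply: conj_Creal; rewrite complex_real. Qed.

Lemma mulCC z : z * Num.conj z = (rn z ^+ 2)%:C.
Proof. by rewrite -normCK rnE rmorphXn. Qed.

End ComplexModulus.

Section RealNormModule.
Variable R : realType.
Variable V : normedModType R[i].

Lemma rnZ (c : R[i]) (x : V) : rn (c *: x) = rn c * rn x.
Proof. by apply: complexI; rewrite rmorphM /= -!rnE normrZ. Qed.

Lemma cvg_rnP (u : nat -> V) (l : V) :
  u @ \oo --> l <-> (fun n => rn (l - u n)) @ \oo --> (0 : R).
Proof.
split.
  move=> /cvgrPdist_lt h; apply/cvgrPdist_lt => e e0.
  have e0' : 0 < e%:C :> R[i] by rewrite ltcR.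
  have := h _ e0'; apply: filterS => n; rewrite rnE ltcR sub0r normrN.
  by rewrite ger0_norm ?rn_ge0.
move=> /cvgrPdist_lt h; apply/cvgrPdist_lt => e e0.
have er : e = (complex.Re e)%:C by rewrite RRe_real// gtr0_real.
rewrite er in e0 *.
have e0' : 0 < complex.Re e by move: e0; rewrite ltcR.
have := h _ e0'; apply: filterS => n; rewrite rnE ltcR sub0r normrN.
by rewrite ger0_norm ?rn_ge0.
Qed.

End RealNormModule.

Lemma rn_cauchy_cvg (R : realType) (V : completeNormedModType R[i])
    (u : nat -> V) :
  (forall e : R, 0 < e -> exists n0, forall m n, (n0 <= m)%N -> (n0 <= n)%N ->
     rn (u m - u n) < e) -> cvgn u.
Proof.
move=> h; apply/cauchy_cvgP/cauchy_ballP => e e0.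
have er : e = (complex.Re e)%:C by rewrite RRe_real// gtr0_real.
rewrite er in e0 *.
have e0' : 0 < complex.Re e by move: e0; rewrite ltcR.
have [n0 hn] := h _ e0'.
exists (u @` [set n | (n0 <= n)%N], u @` [set n | (n0 <= n)%N]) => /=.
  by split; exists n0 => // n /= hn0; exists n.
move=> [_ _] /= [[m hm <-] [n hn' <-]].
by rewrite -ball_normE /ball_ /= rnE ltcR hn.
Qed.

(** * Orthonormal bases and diagonal operators *)

Section OrthonormalBasis.
Variables (R : realType) (H : completeNormedModType R[i]).
Variable ip : {dot H for Num.conj}.
Hypothesis ip_norm : hilbert_norm ip.
Variable e : nat -> H.
Hypothesis e_orthonormal : forall j k, ip (e j) (e k) = (j == k)%:R.
Hypothesis e_total : forall x : H, (forall k, ip x (e k) = 0) -> x = 0.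
Implicit Types (x y : H) (c : nat -> R[i]).

Lemma ipC x y : ip x y = Num.conj (ip y x).
Proof. by rewrite (hermC ip) expr0 mul1r. Qed.

Lemma ip_rn x : ip x x = (rn x ^+ 2)%:C.
Proof. by rewrite -ip_norm rnE rmorphXn. Qed.

Lemma ipZr (a : R[i]) x y : ip x (a *: y) = Num.conj a * ip x y.
Proof. exact: linearZr_LR. Qed.

Lemma ip_sumr (I : Type) (r : seq I) (P : pred I) x (F : I -> H) :
  ip x (\sum_(i <- r | P i) F i) = \sum_(i <- r | P i) ip x (F i).
Proof. exact: linear_sumr. Qed.

Lemma ipBr x y z : ip x (y - z) = ip x y - ip x z.
Proof. exact: linearBr. Qed.

Lemma ipBl x y z : ip (x - y) z = ip x z - ip y z.
Proof. exact: linearBl. Qed.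

Definition fcoef x k := ip x (e k).

Lemma fcoefD x y k : fcoef (x + y) k = fcoef x k + fcoef y k.
Proof. exact: linearDl. Qed.

Lemma fcoefN x k : fcoef (- x) k = - fcoef x k.
Proof. exact: linearNl. Qed.

Lemma fcoefB x y k : fcoef (x - y) k = fcoef x k - fcoef y k.
Proof. exact: linearBl. Qed.

Lemma fcoefZ (a : R[i]) x k : fcoef (a *: x) k = a * fcoef x k.
Proof. exact: linearZl_LR. Qed.

Lemma fcoef0 k : fcoef 0 k = 0.
Proof. exact: linear0l. Qed.

Lemma fcoef_sum (I : Type) (r : seq I) (P : pred I) (F : I -> H) k :
  fcoef (\sum_(i <- r | P i) F i) k = \sum_(i <- r | P i) fcoef (F i) k.
Proof. exact: linear_sumlz. Qed.

Lemma fcoef_basis j k : fcoef (e j) k = (j == k)%:R.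
Proof. exact: e_orthonormal. Qed.

Lemma fcoef_ext x y : (forall k, fcoef x k = fcoef y k) -> x = y.
Proof.
move=> h; apply/eqP; rewrite -subr_eq0; apply/eqP/e_total => k.
by have := fcoefB x y k; rewrite h subrr.
Qed.

Lemma fcoef_span c m n k :
  fcoef (\sum_(m <= j < n) c j *: e j) k = if (m <= k < n)%N then c k else 0.
Proof.
rewrite fcoef_sum (eq_bigr (fun j => if j == k then c k else 0)); last first.
  by move=> j _; rewrite fcoefZ fcoef_basis; case: eqP => [->|_];
     rewrite ?mulr1 ?mulr0.
rewrite -big_mkcond /=.
case: ifPn => hk; last first.
  rewrite big_nat_cond big_pred0// => j; apply/negP => /andP[hj /eqP jk].
  by rewrite -jk hj in hk.
rewrite big_nat_cond (eq_bigl (fun j => j == k)); last first.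
  by move=> j /=; case: eqP => [->|_]; rewrite ?andbF// hk.
rewrite (big_rem k) ?mem_index_iota//= eqxx big1_seq ?addr0// => j /andP[/eqP->].
by rewrite mem_rem_uniq ?iota_uniq// inE eqxx.
Qed.

Lemma pythagoras c m n : rn (\sum_(m <= j < n) c j *: e j) ^+ 2 =
  \sum_(m <= j < n) rn (c j) ^+ 2.
Proof.
apply: complexI; rewrite -ip_rn.
set s := \sum_(_ <= _ < _) _.
rewrite {2}/s ip_sumr rmorph_sum /= big_nat [RHS]big_nat.
apply: eq_bigr => j hj.
by rewrite ipZr -/(fcoef s j) /s fcoef_span hj mulrC mulCC.
Qed.

Lemma bessel x n : rn (x - \sum_(0 <= j < n) fcoef x j *: e j) ^+ 2 =
  rn x ^+ 2 - \sum_(0 <= j < n) rn (fcoef x j) ^+ 2.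
Proof.
rewrite -(pythagoras (fcoef x)); apply: complexI; rewrite rmorphB/= -!ip_rn.
set s := \sum_(_ <= _ < _) _.
have xs : ip x s = ip s s.
  rewrite {1 3}/s !ip_sumr /= big_nat [RHS]big_nat; apply: eq_bigr => j hj.
  by rewrite !ipZr -/(fcoef s j) /s fcoef_span hj.
have sx : ip s x = ip s s by rewrite ipC xs -ipC.
by rewrite ipBl !ipBr /= xs sx; ring.
Qed.

Lemma bessel_le x n : \sum_(0 <= j < n) rn (fcoef x j) ^+ 2 <= rn x ^+ 2.
Proof. by rewrite -subr_ge0 -bessel sqr_ge0. Qed.

Lemma rn_fcoef_le x k : rn (fcoef x k) <= rn x.
Proof.
rewrite -(ler_pXn2r (n := 2)) ?nnegrE ?rn_ge0//.
apply: le_trans (bessel_le x k.+1).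
by rewrite big_nat_recr//= lerDr sumr_ge0// => i _; rewrite sqr_ge0.
Qed.

Definition expand c := limn (series (fun k => c k *: e k)).

(** Riesz-Fischer: by Pythagoras the squared norm of a block of the series is a block of a bounded
    nondecreasing real series, so the Cauchy property carries over. *)
Lemma series_expand_cvg c B :
  (forall n, \sum_(0 <= k < n) rn (c k) ^+ 2 <= B) ->
  cvgn (series (fun k => c k *: e k)).
Proof.
move=> hB; apply: rn_cauchy_cvg => eps eps0.
pose a := series (fun k => rn (c k) ^+ 2 : R).
have a_cvg : cvgn a.
  apply: nondecreasing_is_cvgn.
    by apply: nondecreasing_series => k _ _; rewrite sqr_ge0.
  by exists B => _ [n _ <-]; exact: hB.
have /cauchy_cvgP/cauchy_ballP/(_ (eps ^+ 2)) := a_cvg.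
rewrite exprn_gt0// => /(_ isT) [[A1 A2] /= [[n1 _ h1] [n2 _ h2]] hA].
exists (maxn n1 n2).
suff key m n : (maxn n1 n2 <= m)%N -> (m <= n)%N ->
    rn (series (fun k => c k *: e k) n - series (fun k => c k *: e k) m) < eps.
  move=> m n hm hn; case/orP: (leq_total m n) => mn.
    by rewrite rnBC; exact: key.
  exact: key.
move=> hm mn; rewrite sub_series_geq// -(ltr_pXn2r (n := 2)) ?nnegrE ?rn_ge0 ?ltW//.
rewrite pythagoras -(@sub_series_geq _ (fun k => rn (c k) ^+ 2))//.
apply: le_lt_trans (ler_norm _) _.
move: hm; rewrite geq_max => /andP[hm1 hm2].
by apply: (hA (a n, a m)); split => /=; [apply: h1; exact: leq_trans mn|exact: h2].
Qed.

Lemma fcoef_expand c k : cvgn (series (fun k => c k *: e k)) ->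
  fcoef (expand c) k = c k.
Proof.
move=> /cvg_rnP hc; apply/eqP; rewrite -subr_eq0; apply/eqP/rn0_eq0.
apply/eqP; rewrite eq_le rn_ge0 andbT.
rewrite -(cvg_lim _ hc)//; apply: limr_ge; first exact: cvgP hc.
exists k.+1 => // n /= kn.
apply: le_trans (rn_fcoef_le _ k).
by rewrite fcoefB /series /= fcoef_span /= kn.
Qed.

(** Bessel makes the Fourier series converge; its sum has the coefficients of [x], and totality
    identifies the two. *)
Lemma expand_cvg x : series (fun k => fcoef x k *: e k) @ \oo --> x.
Proof.
have hc : cvgn (series (fun k => fcoef x k *: e k)).
  exact: series_expand_cvg (bessel_le x).
rewrite -[X in _ --> X](_ : expand (fcoef x) = x)//.
by apply: fcoef_ext => k; rewrite fcoef_expand.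
Qed.

Lemma parseval x :
  (fun n => \sum_(0 <= k < n) rn (fcoef x k) ^+ 2) @ \oo --> rn x ^+ 2.
Proof.
have /cvg_rnP h := @expand_cvg x.
rewrite [X in X @ _ --> _](_ : _ =
  (fun n => rn x ^+ 2 - rn (x - series (fun k => fcoef x k *: e k) n) ^+ 2)).
  rewrite -[X in _ --> X]subr0; apply: cvgB; first exact: cvg_cst.
  by rewrite -[X in _ --> X](mulr0 0); under eq_fun do rewrite expr2; apply: cvgM.
by apply/funext => n; rewrite /series /= bessel opprB addrC subrK.
Qed.

Lemma rn_le_of_fcoef x B : 0 <= B ->
  (forall n, \sum_(0 <= k < n) rn (fcoef x k) ^+ 2 <= B ^+ 2) -> rn x <= B.
Proof.
move=> B0 h; rewrite -(ler_pXn2r (n := 2)) ?nnegrE ?rn_ge0//.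
rewrite -(cvg_lim _ (@parseval x))//; apply: limr_le; first exact: cvgP (@parseval x).
by near=> n; exact: h.
Unshelve. all: by end_near. Qed.

Definition diag m x := expand (fun k => m k * fcoef x k).

Section Multiplier.
Variables (m : nat -> R[i]) (B : R).
Hypothesis mB : forall k, rn (m k) <= B.

Lemma multiplier_bound_ge0 : 0 <= B.
Proof. exact: le_trans (rn_ge0 _) (mB 0). Qed.

Lemma multiplier_sum_le x n :
  \sum_(0 <= k < n) rn (m k * fcoef x k) ^+ 2 <= (B * rn x) ^+ 2.
Proof.
apply: le_trans (_ : B ^+ 2 * \sum_(0 <= k < n) rn (fcoef x k) ^+ 2 <= _).
  rewrite mulr_sumr; apply: ler_sum => k _.
  by rewrite rnM exprMn ler_wpM2r ?sqr_ge0// lerXn2r ?nnegrE ?rn_ge0//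
    multiplier_bound_ge0.
by rewrite exprMn ler_wpM2l ?sqr_ge0 ?bessel_le.
Qed.

Lemma diag_series_cvg x :
  cvgn (series (fun k => (m k * fcoef x k) *: e k)).
Proof. exact: series_expand_cvg (multiplier_sum_le x). Qed.

Lemma fcoef_diag x k : fcoef (diag m x) k = m k * fcoef x k.
Proof. by rewrite fcoef_expand//; exact: diag_series_cvg. Qed.

Lemma rn_diag x : rn (diag m x) <= B * rn x.
Proof.
apply: rn_le_of_fcoef; first by rewrite mulr_ge0 ?rn_ge0 ?multiplier_bound_ge0.
move=> n; apply: le_trans (multiplier_sum_le x n).
by apply: ler_sum => k _; rewrite fcoef_diag.
Qed.

Lemma diag_linear (a : R[i]) x y :
  diag m (a *: x + y) = a *: diag m x + diag m y.
Proof.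
by apply: fcoef_ext => k; rewrite fcoefD fcoefZ !fcoef_diag fcoefD fcoefZ; ring.
Qed.

End Multiplier.

(** The point is the order of quantifiers: [n] depends on [x] and [eps] but not on the multiplier.
    Multipliers that are uniformly bounded and small on each mode separately are thus small at
    [x]. *)
Lemma diag_tail x (eps : R) : 0 < eps -> exists n, forall m B,
  (forall k, rn (m k) <= B) ->
  rn (diag m x) <= (\sum_(0 <= k < n) rn (m k)) * rn x + B * eps.
Proof.
move=> eps0; have /cvg_rnP/cvgrPdist_lt/(_ _ eps0)[n _ hn] := @expand_cvg x.
exists n => m B mB; set s := series (fun k => fcoef x k *: e k) n.
have xs : rn (x - s) <= eps.
  have := hn n (leqnn n); rewrite sub0r normrN ger0_norm ?rn_ge0//.
  by move=> /ltW.
have -> : diag m x = diag m s + diag m (x - s).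
  by have := diag_linear mB 1 s (x - s); rewrite !scale1r addrC subrK.
apply: le_trans (rnD _ _) _; apply: lerD; last first.
  apply: le_trans (rn_diag mB _) _.
  by rewrite ler_wpM2l// (multiplier_bound_ge0 mB).
have -> : diag m s = \sum_(0 <= k < n) (m k * fcoef x k) *: e k.
  apply: fcoef_ext => k; rewrite (fcoef_diag mB) /s /series /= !fcoef_span /=.
  by case: ifP => //; rewrite mulr0.
apply: le_trans (rn_sum _ _ _) _; rewrite mulr_suml; apply: ler_sum => k _.
have e1 : rn (e k) = 1.
  apply/eqP; rewrite -(@eqrXn2 _ 2) ?rn_ge0// expr1n; apply/eqP.
  by apply: complexI; rewrite -ip_rn e_orthonormal eqxx.
by rewrite rnZ e1 mulr1 rnM ler_wpM2l ?rn_ge0 ?rn_fcoef_le.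
Qed.

End OrthonormalBasis.

(** * The exponential of a complex matrix *)

Section GeometricLimit.
Variable R : realType.

Lemma le0_of_pow2 (x K : R) : (forall n, x <= K * 2 ^- n) -> x <= 0.
Proof.
move=> h; rewrite leNgt; apply/negP => x0.
set n := Num.bound (K / x).
have K0 : 0 <= K.
  by have := h 0%N; rewrite expr0 invr1 mulr1; exact: le_trans (ltW x0).
have hK : K / x < n%:R by apply: archi_boundP; apply: divr_ge0 => //; exact: ltW.
have := h n; apply/negP; rewrite -ltNge.
have p0 : 0 < (2 : R) ^+ n by rewrite exprn_gt0.
rewrite ltr_pdivrMr// mulrC -ltr_pdivrMr//.
apply: lt_le_trans hK _.
by rewrite -natrX ler_nat ltnW// ltn_expl.
Qed.

(** Nested intervals: [err n] drops by exactly [K * 2 ^- n], so [u - err] increases and [u + err]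
    decreases, and the supremum of the lower ends lies in every interval. The explicit rate is what
    later estimates use. *)
Lemma geometric_limit (u : nat -> R) K :
  (forall n, `|u n.+1 - u n| <= K * 2 ^- n) ->
  exists l, forall n, `|l - u n| <= 2 * K * 2 ^- n.
Proof.
move=> h; pose err n := 2 * K * 2 ^- n : R.
have errS n : err n.+1 = err n - K * 2 ^- n.
  have p0 : (2 : R) ^+ n != 0 by rewrite expf_neq0.
  by rewrite /err exprS; field.
have K0 : 0 <= K by have := le_trans (normr_ge0 _) (h 0%N); rewrite expr0 invr1 mulr1.
have err0 n : 0 <= err n by rewrite /err !mulr_ge0// invr_ge0 exprn_ge0.
have up : nondecreasing_seq (fun n => u n - err n).
  apply/nondecreasing_seqP => n; rewrite errS.
  by have := h n; rewrite ler_norml => /andP[? ?]; lra.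
have dn : nonincreasing_seq (fun n => u n + err n).
  apply/nonincreasing_seqP => n; rewrite errS.
  by have := h n; rewrite ler_norml => /andP[? ?]; lra.
have le m n : u m - err m <= u n + err n.
  apply: le_trans (up _ _ (leq_maxl m n)) _.
  apply: le_trans _ (dn _ _ (leq_maxr m n)).
  by have := err0 (maxn m n) => ?; lra.
pose E := range (fun n => u n - err n).
have supE : has_sup E.
  split; first by exists (u 0%N - err 0%N), 0%N.
  by exists (u 0%N + err 0%N) => _ [n _ <-].
exists (sup E) => n; rewrite ler_norml; apply/andP; split.
  have : u n - err n <= sup E by apply: ub_le_sup; [case: supE|exists n].
  by rewrite /err => ?; lra.
have : sup E <= u n + err n.
  by apply: ge_sup; [case: supE|move=> _ [m _ <-]].
by rewrite /err => ?; lra.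
Qed.

Lemma geometric_limit_complex (u : nat -> R[i]) K :
  (forall n, rn (u n.+1 - u n) <= K * 2 ^- n) ->
  exists l, forall n, rn (l - u n) <= 4 * K * 2 ^- n.
Proof.
move=> h.
have [x hx] : exists x, forall n, `|x - complex.Re (u n)| <= 2 * K * 2 ^- n.
  apply: geometric_limit => n; apply: le_trans (h n).
  by apply: le_trans _ (Re_le_rn _); rewrite raddfB.
have [y hy] : exists y, forall n, `|y - complex.Im (u n)| <= 2 * K * 2 ^- n.
  apply: geometric_limit => n; apply: le_trans (h n).
  by apply: le_trans _ (Im_le_rn _); rewrite raddfB.
exists (x +i* y) => n; apply: le_trans (rn_le_ReIm _) _.
rewrite !raddfB /=; by have := hx n; have := hy n => ? ?; lra.
Qed.

End GeometricLimit.

Section MatrixExponential.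
Variables (R : realType) (d : nat).
Local Notation C := R[i].
Local Notation mat := 'M[C]_d.+1.
Implicit Types (A B M : mat) (a b : R) (z w : C).

(* Column sums are used because the identity then has bound 1, which the powers
   in the Euler products require. *)
Definition bounded_mx A a := forall j, \sum_i rn (A i j) <= a.

Lemma bounded_mx_ge0 A a : bounded_mx A a -> 0 <= a.
Proof.
by move=> /(_ ord0); apply: le_trans; apply: sumr_ge0 => i _; exact: rn_ge0.
Qed.

Lemma bounded_mx_entry A a i j : bounded_mx A a -> rn (A i j) <= a.
Proof.
move=> /(_ j); apply: le_trans; rewrite (bigD1 i)//= lerDl.
by apply: sumr_ge0 => k _; exact: rn_ge0.
Qed.

Lemma bounded_mxW A a b : a <= b -> bounded_mx A a -> bounded_mx A b.
Proof. by move=> ab h j; exact: le_trans (h j) ab. Qed.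

Lemma bounded_mxD A B a b :
  bounded_mx A a -> bounded_mx B b -> bounded_mx (A + B) (a + b).
Proof.
move=> hA hB j; apply: le_trans (lerD (hA j) (hB j)).
by rewrite -big_split /=; apply: ler_sum => i _; rewrite mxE rnD.
Qed.

Lemma bounded_mxM A B a b :
  bounded_mx A a -> bounded_mx B b -> bounded_mx (A * B) (a * b).
Proof.
move=> hA hB j.
apply: le_trans (_ : \sum_i \sum_k rn (A i k) * rn (B k j) <= _).
  apply: ler_sum => i _; rewrite mxE; apply: le_trans (rn_sum _ _ _) _.
  by apply: ler_sum => k _; rewrite rnM.
rewrite exchange_big /=.
apply: le_trans (_ : \sum_k a * rn (B k j) <= _).
  by apply: ler_sum => k _; rewrite -mulr_suml ler_wpM2r ?rn_ge0.
by rewrite -mulr_sumr ler_wpM2l// (bounded_mx_ge0 hA).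
Qed.

Lemma bounded_mx1 : bounded_mx 1 1.
Proof.
move=> j; rewrite (bigD1 j)//= big1 => [|i ij].
  by rewrite mxE eqxx rn1 addr0.
by rewrite mxE (negbTE ij) rn0.
Qed.

Lemma bounded_mxZ A a z : bounded_mx A a -> bounded_mx (z *: A) (rn z * a).
Proof.
move=> hA j; apply: le_trans (_ : rn z * \sum_i rn (A i j) <= _).
  by rewrite mulr_sumr; apply: ler_sum => i _; rewrite mxE rnM.
by rewrite ler_wpM2l ?rn_ge0.
Qed.

Lemma bounded_mxX A a n : bounded_mx A a -> bounded_mx (A ^+ n) (a ^+ n).
Proof.
move=> hA; elim: n => [|n IH]; first exact: bounded_mx1.
by rewrite !exprS; exact: bounded_mxM.
Qed.

Lemma bounded_mx_exists A : exists a, bounded_mx A a.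
Proof.
exists (\sum_j \sum_i rn (A i j)) => j.
rewrite [leRHS](bigD1 j)//= lerDl; apply: sumr_ge0 => k _.
by apply: sumr_ge0 => i _; exact: rn_ge0.
Qed.

(** Exchanging the factors one at a time gives [n] terms, each with one factor [A - B] and [n - 1]
    others; [1 <= c] rounds the exponent up to [n]. *)
Lemma bounded_mx_telescope A B c e n : 1 <= c -> bounded_mx A c ->
  bounded_mx B c -> bounded_mx (A - B) e ->
  bounded_mx (A ^+ n - B ^+ n) (n%:R * e * c ^+ n).
Proof.
move=> c1 hA hB hAB; have e0 := bounded_mx_ge0 hAB.
elim: n => [|n IH].
  rewrite !expr0 subrr mul0r mul0r => j.
  by rewrite big1// => i _; rewrite mxE rn0.
have -> : A ^+ n.+1 - B ^+ n.+1 = A * (A ^+ n - B ^+ n) + (A - B) * B ^+ n.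
  by rewrite !exprS mulrBr mulrBl addrA subrK.
have := bounded_mxD (bounded_mxM hA IH) (bounded_mxM hAB (bounded_mxX n hB)).
apply: bounded_mxW.
have cn : 0 <= c ^+ n by rewrite exprn_ge0// (le_trans ler01).
rewrite -natr1 !mulrDl mul1r exprS lerD//; last by rewrite ler_wpM2l// ler_peMl.
by rewrite [leLHS]mulrCA.
Qed.

(* The exponents are dyadic so that consecutive products can be compared factor
   by factor. *)
Definition euler A n := (1 + ((2 ^- n : R)%:C) *: A) ^+ (2 ^ n).

Lemma pow2_gt0 n : 0 < (2 : R) ^- n.
Proof. by rewrite invr_gt0 exprn_gt0. Qed.

Lemma expR_pow2 a n : expR (2 ^- n * a) ^+ (2 ^ n) = expR a.
Proof.
rewrite -expRM_natl; congr expR.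
by rewrite natrX mulrA divff ?mul1r// expf_neq0.
Qed.

Lemma rn_pow2 n : rn ((2 ^- n : R)%:C) = 2 ^- n.
Proof. by rewrite rn_real gtr0_norm ?pow2_gt0. Qed.

Lemma bounded_euler_factor A a n : bounded_mx A a ->
  bounded_mx (1 + ((2 ^- n : R)%:C) *: A) (expR (2 ^- n * a)).
Proof.
move=> hA; have := bounded_mxD bounded_mx1 (bounded_mxZ (2 ^- n : R)%:C hA).
by apply: bounded_mxW; rewrite rn_pow2 expR_ge1Dx.
Qed.

Lemma expR_pow2_ge1 A a n : bounded_mx A a -> 1 <= expR (2 ^- n * a).
Proof.
move=> /bounded_mx_ge0 a0.
by rewrite -expR0 ler_expR mulr_ge0// ltW// pow2_gt0.
Qed.

Lemma bounded_euler A a n : bounded_mx A a -> bounded_mx (euler A n) (expR a).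
Proof.
by move=> hA; rewrite -(expR_pow2 a n); exact/bounded_mxX/bounded_euler_factor.
Qed.

(** With [X = Y + Y], the factors [(1 + Y) ^+ 2] and [1 + X] differ by [Y * Y], of order [4 ^- n];
    telescoping over [2 ^ n] factors leaves order [2 ^- n]. *)
Lemma euler_step A a n : bounded_mx A a ->
  bounded_mx (euler A n.+1 - euler A n) (a ^+ 2 * expR a * 2 ^- n).
Proof.
move=> hA; rewrite /euler expnS exprM.
set X := ((2 ^- n : R)%:C) *: A; set Y := ((2 ^- n.+1 : R)%:C) *: A.
have XY : X = Y + Y.
  rewrite /X /Y -scalerDl -rmorphD /=; congr (_%:C *: _).
  have p0 : (2 : R) ^+ n != 0 by rewrite expf_neq0.
  by rewrite exprS; field.
have hY : bounded_mx Y (2 ^- n.+1 * a) by rewrite -rn_pow2; exact: bounded_mxZ.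
have dE : (1 + Y) ^+ 2 - (1 + X) = Y * Y.
  by rewrite XY expr2 mulrDl mul1r mulrDr mulr1 !addrA [X in X - _]addrC addrK.
have h1 : bounded_mx ((1 + Y) ^+ 2) (expR (2 ^- n * a)).
  have := bounded_mxX 2 (bounded_euler_factor n.+1 hA).
  apply: bounded_mxW; rewrite -expRM_natl.
  rewrite [X in expR X](_ : _ = 2 ^- n * a)//.
  have p0 : (2 : R) ^+ n != 0 by rewrite expf_neq0.
  by rewrite exprS; field.
have h2 : bounded_mx ((1 + Y) ^+ 2 - (1 + X)) ((2 ^- n.+1 * a) * (2 ^- n.+1 * a)).
  by rewrite dE; exact: bounded_mxM.
have := bounded_mx_telescope (2 ^ n) (expR_pow2_ge1 n hA) h1
  (bounded_euler_factor n hA) h2.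
apply: bounded_mxW; rewrite expR_pow2 natrX.
have p0 : (2 : R) ^+ n != 0 by rewrite expf_neq0.
rewrite (_ : 2 ^+ n * _ * _ = (a ^+ 2 * expR a * 2 ^- n) / 4).
  rewrite ler_piMr ?invf_le1 ?ler1n//.
  by rewrite mulr_ge0 ?(ltW (pow2_gt0 _))// mulr_ge0 ?expR_ge0 ?sqr_ge0.
by rewrite exprS; field.
Qed.

Lemma euler_limit A : {E : mat | exists K, forall n,
  bounded_mx (E - euler A n) (K * 2 ^- n)}.
Proof.
apply: cid; have [a hA] := bounded_mx_exists A.
have entry i j : exists l, forall n,
    rn (l - euler A n i j) <= 4 * (a ^+ 2 * expR a) * 2 ^- n.
  apply: geometric_limit_complex => n.
  by have := bounded_mx_entry i j (euler_step n hA); rewrite !mxE.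
exists (\matrix_(i, j) projT1 (cid (entry i j))).
exists (\sum_(i < d.+1) 4 * (a ^+ 2 * expR a)) => n j.
rewrite mulr_suml; apply: ler_sum => i _; rewrite !mxE.
exact: (projT2 (cid (entry i j)) n).
Qed.

Definition mexp A : mat := projT1 (euler_limit A).

Lemma mexp_euler A : exists K, forall n,
  bounded_mx (mexp A - euler A n) (K * 2 ^- n).
Proof. exact: projT2 (euler_limit A). Qed.

Lemma mx_eq_of_pow2 A B K :
  (forall n, bounded_mx (A - B) (K * 2 ^- n)) -> A = B.
Proof.
move=> h; apply/matrixP => i j; apply/eqP; rewrite -subr_eq0; apply/eqP.
apply: rn0_eq0; apply/eqP; rewrite eq_le rn_ge0 andbT.
apply: (@le0_of_pow2 _ _ K) => n.
by have := bounded_mx_entry i j (h n); rewrite !mxE.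
Qed.

(** Bounds that hold for every Euler product pass to the limit through a Lipschitz map [f] with
    constant [k]. *)
Lemma mexp_bound A (f : mat -> mat) (k b : R) :
  (forall B B' c, bounded_mx (B - B') c -> bounded_mx (f B - f B') (k * c)) ->
  (forall n, bounded_mx (f (euler A n)) b) -> bounded_mx (f (mexp A)) b.
Proof.
move=> hf hb j; have [K hK] := mexp_euler A.
rewrite -subr_le0; apply: (@le0_of_pow2 _ _ (k * K)) => n.
have := bounded_mxD (hf _ _ _ (hK n)) (hb n); rewrite subrK => /(_ j).
by rewrite -mulrA => ?; lra.
Qed.

Lemma bounded_mexp A a : bounded_mx A a -> bounded_mx (mexp A) (expR a).
Proof.
move=> hA; apply: (@mexp_bound A id 1) => [B B' c|n]; first by rewrite mul1r.
exact: bounded_euler.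
Qed.

Lemma mexp0 : mexp 0 = 1.
Proof.
have [K hK] := mexp_euler 0; apply: (@mx_eq_of_pow2 _ _ K) => n.
by have := hK n; rewrite /euler scaler0 addr0 expr1n.
Qed.

Lemma mexp_comm A B : GRing.comm A B -> GRing.comm (mexp A) B.
Proof.
move=> AB; have [K hK] := mexp_euler A; have [b hB] := bounded_mx_exists B.
apply: (@mx_eq_of_pow2 _ _ (K * b + b * K)) => n.
have EB : GRing.comm (euler A n) B.
  apply/commr_sym/commrX/commrD; first exact: commr1.
  by rewrite /GRing.comm -scalerAr -scalerAl AB.
have := bounded_mxD (bounded_mxM (hK n) hB) (bounded_mxM hB
  (bounded_mxZ (-1) (hK n))).
rewrite rnN rn1 mul1r scaleN1r opprB mulrBl mulrBr -EB addrA subrK.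
by apply: bounded_mxW; rewrite mulrDl mulrAC mulrA.
Qed.

(** At stage [n] the factors [1 + (X + Y)] and [(1 + X) * (1 + Y)] differ by [X * Y], of order
    [4 ^- n], which beats the [2 ^ n] factors. Commutation merges the two powers into the power of a
    product. *)
Lemma mexpD A B : GRing.comm A B -> mexp (A + B) = mexp A * mexp B.
Proof.
move=> AB; have [K hK] := mexp_euler A; have [L hL] := mexp_euler B.
have [J hJ] := mexp_euler (A + B).
have [a hA] := bounded_mx_exists A; have [b hB] := bounded_mx_exists B.
pose c : R := a * b * expR (a + b).
apply: (@mx_eq_of_pow2 _ _ (J + c + (K * expR b + expR a * L))) => n.
set X := ((2 ^- n : R)%:C) *: A; set Y := ((2 ^- n : R)%:C) *: B.
have hX : bounded_mx X (2 ^- n * a) by rewrite -rn_pow2; exact: bounded_mxZ.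
have hY : bounded_mx Y (2 ^- n * b) by rewrite -rn_pow2; exact: bounded_mxZ.
have XY : GRing.comm X Y.
  by rewrite /GRing.comm /X /Y -!scalerAr -!scalerAl AB !scalerA mulrC.
have hE : bounded_mx (euler (A + B) n - euler A n * euler B n) (c * 2 ^- n).
  rewrite /euler -exprMn_comm; last first.
    by apply/commrD; [exact: commr1|apply/commr_sym/commrD; [exact: commr1|]].
  rewrite scalerDr -/X -/Y.
  have dE : (1 + (X + Y)) - (1 + X) * (1 + Y) = (- 1 : C) *: (X * Y).
    rewrite mulrDl mul1r mulrDr mulr1.
    by move: (X * Y) => Z; apply/matrixP => i j; rewrite !mxE; ring.
  have hd : bounded_mx ((1 + (X + Y)) - (1 + X) * (1 + Y))
      (2 ^- n * a * (2 ^- n * b)).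
    have := bounded_mxZ (-1) (bounded_mxM hX hY).
    by rewrite rnN rn1 mul1r -dE.
  have h1 := bounded_euler_factor n (bounded_mxD hA hB).
  rewrite scalerDr -/X -/Y in h1.
  have h2 := bounded_mxM (bounded_euler_factor n hA) (bounded_euler_factor n hB).
  rewrite -expRD -mulrDr -/X -/Y in h2.
  have := bounded_mx_telescope (2 ^ n) (expR_pow2_ge1 n (bounded_mxD hA hB)) h1 h2 hd.
  apply: bounded_mxW; rewrite expR_pow2 natrX.
  have p0 : (2 : R) ^+ n != 0 by rewrite expf_neq0.
  by rewrite (_ : 2 ^+ n * _ * _ = c * 2 ^- n)// /c; field.
have := bounded_mxD (bounded_mxD (hJ n) hE) (bounded_mxZ (-1) (bounded_mxD
  (bounded_mxM (hK n) (bounded_euler n hB)) (bounded_mxM (bounded_mexp hA) (hL n)))).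
rewrite rnN rn1 mul1r mulrBl mulrBr.
rewrite (_ : _ + _ = mexp (A + B) - mexp A * mexp B); last first.
  move: (mexp (A + B)) (mexp A * mexp B) (mexp A * euler B n) => P Q S.
  move: (euler (A + B) n) (euler A n * euler B n) => T U.
  by apply/matrixP => i j; rewrite !mxE; ring.
by apply: bounded_mxW; rewrite !mulrDl [K * _ * _]mulrAC !mulrA.
Qed.

(** Proved for powers of [1 + X] by induction on the exponent [m], with remainder quadratic in
    [m * x]; at [m = 2 ^ n] the linear term [X *+ m] is exactly [A]. *)
Lemma mexp_taylor A a : bounded_mx A a ->
  bounded_mx (mexp A - 1 - A) (a ^+ 2 * expR a).
Proof.
move=> hA; apply: (@mexp_bound A (fun B => B - 1 - A) 1) => [B B' c|n].
  by rewrite mul1r opprB addrA subrK opprB addrA subrK.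
set X := ((2 ^- n : R)%:C) *: A.
have hX : bounded_mx X (2 ^- n * a) by rewrite -rn_pow2; exact: bounded_mxZ.
have a0 := bounded_mx_ge0 hX.
have key m : bounded_mx ((1 + X) ^+ m - 1 - X *+ m)
    ((m%:R * (2 ^- n * a)) ^+ 2 * expR (2 ^- n * a) ^+ m).
  elim: m => [|m IH].
    rewrite expr0 subrr mulr0n subrr => j; rewrite big1 => [|i _].
      by rewrite mul0r expr0n mul0r.
    by rewrite mxE rn0.
  have -> : (1 + X) ^+ m.+1 - 1 - X *+ m.+1 =
      (1 + X) * ((1 + X) ^+ m - 1 - X *+ m) + (X * X) *+ m.
    rewrite exprS !mulrBr mulr1 mulrSr -mulrnAr !mulrDl !mul1r.
    move: ((1 + X) ^+ m) (X * (1 + X) ^+ m) (X * (X *+ m)) (X *+ m) => P Q S T.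
    by apply/matrixP => i j; rewrite !mxE; ring.
  have hm : bounded_mx ((X * X) *+ m) (m%:R * (2 ^- n * a * (2 ^- n * a))).
    have := bounded_mxZ m%:R (bounded_mxM hX hX).
    rewrite scaler_nat.
    by rewrite (_ : (m%:R : C) = (m%:R : R)%:C) ?rn_real ?rmorph_nat// normr_nat.
  have := bounded_mxD (bounded_mxM (bounded_euler_factor n hA) IH) hm.
  apply: bounded_mxW; rewrite exprS.
  set E := expR _; set x := 2 ^- n * a.
  have E1 : 1 <= E ^+ m.+1 by rewrite exprn_ege1// (expR_pow2_ge1 _ hA).
  rewrite -natr1; rewrite -exprS.
  rewrite [E * _]mulrCA -exprS -subr_ge0.
  rewrite (_ : _ - _ = x ^+ 2 * (m%:R * (E ^+ m.+1 - 1) + (m%:R + 1) * E ^+ m.+1)); last by ring.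
  rewrite mulr_ge0 ?sqr_ge0// addr_ge0// mulr_ge0 ?subr_ge0//.
  exact: le_trans ler01 E1.
have := key (2 ^ n)%N.
rewrite -[X *+ _]scaler_nat /X scalerA.
have p0 : (2 : R) ^+ n != 0 by rewrite expf_neq0.
rewrite (_ : (2 ^ n)%:R * (2 ^- n)%:C = 1); last first.
  by rewrite natrX -(rmorph_nat (real_complex R)) -rmorphXn -rmorphM divff.
by rewrite scale1r expR_pow2 natrX mulrA divff// mul1r.
Qed.

Lemma comm_scale z w A : GRing.comm (z *: A) (w *: A).
Proof. by rewrite /GRing.comm -!scalerAr -!scalerAl !scalerA mulrC. Qed.

Lemma mexp_scaleD z w A :
  mexp ((z + w) *: A) = mexp (z *: A) * mexp (w *: A).
Proof. by rewrite scalerDl mexpD//; exact: comm_scale. Qed.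

Lemma mexp_increment A a c z h : bounded_mx A a -> rn h <= c ->
  bounded_mx (mexp ((z + h) *: A) - mexp (z *: A) - h *: (A * mexp (z *: A)))
    (expR (rn z * a) * (a ^+ 2 * expR (c * a)) * rn h ^+ 2).
Proof.
move=> hA hc; have a0 := bounded_mx_ge0 hA.
rewrite mexp_scaleD.
have -> : h *: (A * mexp (z *: A)) = mexp (z *: A) * (h *: A).
  have /mexp_comm cA : GRing.comm (z *: A) A.
    by have := comm_scale z 1 A; rewrite scale1r.
  by rewrite -cA -scalerAr.
rewrite -{2}[mexp (z *: A)]mulr1 -!mulrBr.
have hz : bounded_mx (mexp (z *: A)) (expR (rn z * a)).
  exact/bounded_mexp/bounded_mxZ.
have := bounded_mxM hz (mexp_taylor (bounded_mxZ h hA)).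
apply: bounded_mxW; rewrite -mulrA ler_wpM2l ?expR_ge0// exprMn.
rewrite [leRHS](_ : _ = rn h ^+ 2 * a ^+ 2 * expR (c * a)); last by ring.
apply: ler_wpM2l; first by apply: mulr_ge0; exact: sqr_ge0.
by rewrite ler_expR ler_wpM2r.
Qed.

End MatrixExponential.

(** * Energy estimates for a single mode *)

Section EnergyForms.
Variable R : realType.
Implicit Types (p q h P Q : R).

(** The symmetric bilinear form polarizing the modified norm [V]; [x] and [y] are the weights of its
    cross terms. *)
Definition lyapunov (x y p q h p' q' h' : R) : R :=
  p * p' + q * q' + h * h' + x * (p * q' + q * p') + y * (q * h' + h * q').

(* [lyapunov x y] of the mode matrix applied to [(p, q, h)] against
   [(p', q', h')], in the variables [P = t r p], [Q = r q]; here
   [x = eps^3 t], [y = eps^2 r], [T = t^2] and [rho = r^2]. *)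
Definition mode_form (eps T rho P Q h P' Q' h' : R) : R :=
  Q * P' + eps ^+ 3 * T * Q * Q' + eps ^+ 3 * (h - P) * P' + (h - P) * Q'
  + eps ^+ 2 * rho * (h - P) * h' - eps ^+ 2 * (Q + h) * Q' - (Q + h) * h'.

(** Every factor [t r] or [r] needed to turn [p], [q], [p'], [q'] into damped variables is present
    in the matrix or in the weights; only [t ^+ 2] and [r ^+ 2] remain as coefficients. *)
Lemma mode_formE eps t r p q h p' q' h' :
  lyapunov (eps ^+ 3 * t) (eps ^+ 2 * r)
    (t * r ^+ 2 * q) (r * h - t * r ^+ 2 * p) (- (r * q) - h) p' q' h' =
  mode_form eps (t ^+ 2) (r ^+ 2) (t * r * p) (r * q) h (t * r * p') (r * q') h'.
Proof. by rewrite /lyapunov /mode_form; ring. Qed.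

Definition sq3 p q h : R := p ^+ 2 + q ^+ 2 + h ^+ 2.

Lemma sq3_ge0 p q h : 0 <= sq3 p q h.
Proof. by rewrite /sq3 !addr_ge0 ?sqr_ge0. Qed.

Lemma lyapunov_lower x y p q h : `|x| <= (8^-1 : R) -> `|y| <= (8^-1 : R) ->
  sq3 p q h / 2 <= lyapunov x y p q h p q h.
Proof.
rewrite !ler_norml => /andP[x1 x2] /andP[y1 y2]; rewrite /sq3 /lyapunov.
have h1 : 0 <= (8^-1 + x) * (p + q) ^+ 2 by rewrite mulr_ge0 ?sqr_ge0//; lra.
have h2 : 0 <= (8^-1 - x) * (p - q) ^+ 2 by rewrite mulr_ge0 ?sqr_ge0//; lra.
have h3 : 0 <= (8^-1 + y) * (h + q) ^+ 2 by rewrite mulr_ge0 ?sqr_ge0//; lra.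
have h4 : 0 <= (8^-1 - y) * (h - q) ^+ 2 by rewrite mulr_ge0 ?sqr_ge0//; lra.
have := (sqr_ge0 p, sqr_ge0 q, sqr_ge0 h) => -[[s1 s2] s3].
suff : 0 <= p ^+ 2 / 4 + q ^+ 2 / 4 + h ^+ 2 / 4
   + (((8^-1 + x) * (p + q) ^+ 2 + (8^-1 - x) * (p - q) ^+ 2)
   + ((8^-1 + y) * (h + q) ^+ 2 + (8^-1 - y) * (h - q) ^+ 2)) / 2.
  lra.
lra.
Qed.

Lemma mul_le_weighted (c mu x y : R) : 0 < mu -> `|c| <= 2 ->
  c * x * y <= mu * x ^+ 2 + y ^+ 2 / mu.
Proof.
move=> mu0; rewrite ler_norml => /andP[c1 c2].
have m1 : 0 < mu^-1 by rewrite invr_gt0.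
have h1 : 0 <= mu^-1 * (2 + c) * (mu * x - y) ^+ 2.
  by rewrite mulr_ge0 ?sqr_ge0// mulr_ge0 ?(ltW m1)//; lra.
have h2 : 0 <= mu^-1 * (2 - c) * (mu * x + y) ^+ 2.
  by rewrite mulr_ge0 ?sqr_ge0// mulr_ge0 ?(ltW m1)//; lra.
rewrite -subr_ge0 (_ : _ - _ = (mu^-1 * (2 + c) * (mu * x - y) ^+ 2 +
  mu^-1 * (2 - c) * (mu * x + y) ^+ 2) / 4); first by rewrite divr_ge0 ?addr_ge0.
by field; rewrite gt_eqF.
Qed.

Section SmallParameter.
Variables (eps T rho : R).
Hypotheses (eps_gt0 : 0 < eps) (eps_small : eps <= (16^-1 : R))
  (T_ge0 : 0 <= T) (rho_ge0 : 0 <= rho) (T_small : eps * T <= (16^-1 : R))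
  (rho_small : eps * rho <= (16^-1 : R)) (rho2_small : eps * rho ^+ 2 <= (16^-1 : R)).

Let eps2 : 0 < eps ^+ 2 <= eps / 16.
Proof. by rewrite exprn_gt0//= expr2 ler_pM2l. Qed.

Let eps3 : 0 < eps ^+ 3 <= eps ^+ 2 / 16.
Proof. by rewrite exprn_gt0//= exprSr ler_pM2l ?exprn_gt0. Qed.

Let e2rho : 0 <= eps ^+ 2 * rho <= eps / 16.
Proof.
by rewrite mulr_ge0 ?sqr_ge0//= expr2 -mulrA ler_pM2l.
Qed.

Let e3T : 0 <= eps ^+ 3 * T <= eps ^+ 2 / 16.
Proof.
apply/andP; split; first by rewrite mulr_ge0// exprn_ge0// ltW.
by rewrite [eps ^+ 3]exprSr -mulrA ler_pM2l ?exprn_gt0.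
Qed.

(** Cauchy-Schwarz in Young form. All nine coefficients are at most 2 in modulus and each variable
    occurs in three products, whence the 3. The weight [mu] stays free because the smoothing
    estimate needs it to depend on time. *)
Lemma mode_form_le (mu P Q h P' Q' h' : R) : 0 < mu ->
  mode_form eps T rho P Q h P' Q' h' <=
  3 * (mu * sq3 P Q h + sq3 P' Q' h' / mu).
Proof.
move=> mu0.
have [/andP[a1 a2] /andP[b1 b2] /andP[c1 c2] /andP[d1 d2]] :=
  And4 eps2 eps3 e2rho e3T.
have [e0 e16] := (eps_gt0, eps_small).
have w (c x y : R) : -2 <= c -> c <= 2 -> c * x * y <= mu * x ^+ 2 + y ^+ 2 / mu.
  by move=> k1 k2; apply: mul_le_weighted => //; rewrite ler_norml k1 k2.
have k1 : (- eps ^+ 3) * P * P' <= mu * P ^+ 2 + P' ^+ 2 / mu by apply: w; lra.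
have k2 : (-1) * P * Q' <= mu * P ^+ 2 + Q' ^+ 2 / mu by apply: w; lra.
have k3 : (- (eps ^+ 2 * rho)) * P * h' <= mu * P ^+ 2 + h' ^+ 2 / mu by apply: w; lra.
have k4 : 1 * Q * P' <= mu * Q ^+ 2 + P' ^+ 2 / mu by apply: w; lra.
have k5 : (eps ^+ 3 * T - eps ^+ 2) * Q * Q' <= mu * Q ^+ 2 + Q' ^+ 2 / mu by apply: w; lra.
have k6 : (-1) * Q * h' <= mu * Q ^+ 2 + h' ^+ 2 / mu by apply: w; lra.
have k7 : (eps ^+ 3) * h * P' <= mu * h ^+ 2 + P' ^+ 2 / mu by apply: w; lra.
have k8 : (1 - eps ^+ 2) * h * Q' <= mu * h ^+ 2 + Q' ^+ 2 / mu by apply: w; lra.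
have k9 : (eps ^+ 2 * rho - 1) * h * h' <= mu * h ^+ 2 + h' ^+ 2 / mu by apply: w; lra.
rewrite /sq3 (_ : mode_form _ _ _ _ _ _ _ _ _ =
  - eps ^+ 3 * P * P' + -1 * P * Q' + - (eps ^+ 2 * rho) * P * h'
  + 1 * Q * P' + (eps ^+ 3 * T - eps ^+ 2) * Q * Q' + -1 * Q * h'
  + eps ^+ 3 * h * P' + (1 - eps ^+ 2) * h * Q' + (eps ^+ 2 * rho - 1) * h * h').
  lra.
by rewrite /mode_form; ring.
Qed.

(** The skew couplings cancel on the diagonal, and [V] without cross terms would leave only
    [- h ^+ 2]. The cross term in [q h] produces [- eps ^+ 2 * Q ^+ 2] and the one in [p q] produces
    [- eps ^+ 3 * P ^+ 2], at the price of mixed terms of higher order in [eps]. *)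
Lemma mode_form_coercive P Q h :
  mode_form eps T rho P Q h P Q h <= - (eps ^+ 3 / 2 * sq3 P Q h).
Proof.
have [/andP[a1 a2] /andP[b1 b2] /andP[c1 c2] /andP[d1 d2]] :=
  And4 eps2 eps3 e2rho e3T.
have [e0 e16] := (eps_gt0, eps_small).
set g := eps ^+ 2 * rho - eps ^+ 3.
(* Completing the square in [P] charges [g ^+ 2 / (2 * eps ^+ 3)] to [h ^+ 2]. As [g ^+ 2] is of
   order [eps ^+ 4], the exponent 3 on the damping of [P] leaves a factor [eps] to spare; this is
   where [eps * rho ^+ 2] must be small. *)
have g2 : g ^+ 2 <= eps ^+ 3 / 8.
  apply: le_trans (_ : (eps ^+ 2 * rho) ^+ 2 + (eps ^+ 3) ^+ 2 <= _).
    have : 0 <= eps ^+ 2 * rho * eps ^+ 3 by rewrite mulr_ge0// ltW.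
    by rewrite /g sqrrB => ?; lra.
  have -> : (eps ^+ 2 * rho) ^+ 2 = eps ^+ 3 * (eps * rho ^+ 2) by ring.
  have : eps ^+ 3 * (eps * rho ^+ 2) <= eps ^+ 3 * 16^-1 by rewrite ler_pM2l.
  have : eps ^+ 3 * eps ^+ 3 <= eps ^+ 3 * 16^-1 by rewrite ler_pM2l//; lra.
  by rewrite expr2 => ? ?; lra.
have s1 : 0 <= (eps ^+ 3 * P + g * h) ^+ 2 / (2 * eps ^+ 3).
  by rewrite mulr_ge0 ?sqr_ge0// invr_ge0 mulr_ge0// ltW.
have s1E : (eps ^+ 3 * P + g * h) ^+ 2 / (2 * eps ^+ 3) =
    eps ^+ 3 / 2 * P ^+ 2 + g * P * h + g ^+ 2 / (2 * eps ^+ 3) * h ^+ 2.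
  by field; rewrite gt_eqF.
have g3 : g ^+ 2 / (2 * eps ^+ 3) * h ^+ 2 <= (16^-1 : R) * h ^+ 2.
  rewrite ler_wpM2r ?sqr_ge0// ler_pdivrMr ?mulr_gt0//; lra.
(* Absorbs the mixed term in [Q * h], using a quarter of the damping of [Q]. *)
have s2 : 0 <= eps ^+ 2 * (Q / 2 + h) ^+ 2 by rewrite mulr_ge0 ?sqr_ge0// ltW.
have e2h : eps ^+ 2 * h ^+ 2 <= (16^-1 : R) * h ^+ 2 by rewrite ler_wpM2r ?sqr_ge0//; lra.
have eQ : eps ^+ 3 * T * Q ^+ 2 <= eps ^+ 2 / 16 * Q ^+ 2.
  by rewrite ler_wpM2r ?sqr_ge0.
have eh : eps ^+ 2 * rho * h ^+ 2 <= (16^-1 : R) * h ^+ 2.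
  by rewrite ler_wpM2r ?sqr_ge0//; lra.
have e3Q : eps ^+ 3 * Q ^+ 2 <= eps ^+ 2 / 16 * Q ^+ 2 by rewrite ler_wpM2r ?sqr_ge0.
have e3h : eps ^+ 3 * h ^+ 2 <= (16^-1 : R) * h ^+ 2 by rewrite ler_wpM2r ?sqr_ge0//; lra.
have e2Q : 0 <= eps ^+ 2 * Q ^+ 2 by rewrite mulr_ge0 ?sqr_ge0.
have h0 := sqr_ge0 h.
have -> : mode_form eps T rho P Q h P Q h =
  - (eps ^+ 3 * P ^+ 2) - eps ^+ 2 * Q ^+ 2 + eps ^+ 3 * T * Q ^+ 2 - h ^+ 2
  + eps ^+ 2 * rho * h ^+ 2 - g * P * h - eps ^+ 2 * Q * h.
  by rewrite /mode_form /g; ring.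
rewrite /sq3; rewrite s1E in s1; lra.
Qed.

(* Dissipation along the flow of [(1 + i k)] times the mode matrix. *)
Lemma mode_form_rotated (k : R) P1 Q1 h1 P2 Q2 h2 : `|k| <= eps ^+ 3 / 24 ->
  mode_form eps T rho P1 Q1 h1 P1 Q1 h1 + mode_form eps T rho P2 Q2 h2 P2 Q2 h2
  + k * (mode_form eps T rho P1 Q1 h1 P2 Q2 h2
         - mode_form eps T rho P2 Q2 h2 P1 Q1 h1)
  <= - (eps ^+ 3 / 4 * (sq3 P1 Q1 h1 + sq3 P2 Q2 h2)).
Proof.
move=> hk; have := mode_form_coercive P1 Q1 h1; have := mode_form_coercive P2 Q2 h2.
have a12 := @mode_form_le 1 P1 Q1 h1 P2 Q2 h2 ltr01.
have a21 := @mode_form_le 1 P2 Q2 h2 P1 Q1 h1 ltr01.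
(* [mode_form_le] is one-sided; reversing the first argument bounds the form from below. *)
have b12 := @mode_form_le 1 (- P1) (- Q1) (- h1) P2 Q2 h2 ltr01.
have b21 := @mode_form_le 1 (- P2) (- Q2) (- h2) P1 Q1 h1 ltr01.
have n12 P Q h P' Q' h' : mode_form eps T rho (- P) (- Q) (- h) P' Q' h' =
  - mode_form eps T rho P Q h P' Q' h' by rewrite /mode_form; ring.
have sN P Q h : sq3 (- P) (- Q) (- h) = sq3 P Q h by rewrite /sq3 !sqrrN.
rewrite !n12 !sN in b12 b21.
rewrite divr1 mul1r in a12 a21 b12 b21.
set B12 := mode_form eps T rho P1 Q1 h1 P2 Q2 h2 in a12 a21 b12 b21 *.
set B21 := mode_form eps T rho P2 Q2 h2 P1 Q1 h1 in a12 a21 b12 b21 *.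
have s1 := sq3_ge0 P1 Q1 h1; have s2 := sq3_ge0 P2 Q2 h2.
set D1 := sq3 P1 Q1 h1 in a12 a21 b12 b21 s1 *.
set D2 := sq3 P2 Q2 h2 in a12 a21 b12 b21 s2 *.
(* Both mixed forms are at most [3 * (D1 + D2)] in modulus, so the rotation consumes exactly half of
   the coercivity constant [eps ^+ 3 / 2]. *)
have : k * (B12 - B21) <= eps ^+ 3 / 24 * (6 * (D1 + D2)).
  apply: le_trans (ler_norm _) _; rewrite normrM ler_pM//.
  by rewrite ler_norml; apply/andP; split; lra.
by move=> *; lra.
Qed.

End SmallParameter.
End EnergyForms.

(** * Decay and smoothing along the flow of one mode *)

Section ModeFlow.
Variable R : realType.
Implicit Types (f p q h : R -> R) (s x y k : R).

Lemma le_of_derive_le0 f (df : R -> R) s :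
  (forall u : R, is_derive u 1 f (df u)) -> (forall u, 0 < u -> df u <= 0) ->
  0 <= s -> f s <= f 0.
Proof.
move=> hf hdf; rewrite le_eqVlt => /predU1P[<-//|s0].
have [|c + hc] := @MVT R f df 0 s s0 (fun u _ => hf u).
  by apply: derivable_within_continuous => u _; case: (hf u).
rewrite in_itv/= => /andP[c0 _].
by rewrite -subr_le0 hc subr0 mulr_le0_ge0//; [exact: hdf|exact: ltW].
Qed.

Lemma is_derive_lyapunov (x y s : R) p q h (dp dq dh : R) :
  is_derive s 1 p dp -> is_derive s 1 q dq -> is_derive s 1 h dh ->
  is_derive s 1 (fun u => lyapunov x y (p u) (q u) (h u) (p u) (q u) (h u))
    (2 * lyapunov x y dp dq dh (p s) (q s) (h s)).
Proof.
move=> hp hq hh.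
have -> : (fun u => lyapunov x y (p u) (q u) (h u) (p u) (q u) (h u)) =
  p * p + q * q + h * h + (2 * x) \*: (p * q) + (2 * y) \*: (q * h).
  apply/funext => u /=; rewrite /lyapunov.
  rewrite -[RHS]/(p u * p u + q u * q u + h u * h u + 2 * x * (p u * q u)
    + 2 * y * (q u * h u)).
  by ring.
apply: is_derive_eq (is_deriveD (is_deriveD (is_deriveD (is_deriveD
  (is_deriveM hp hp) (is_deriveM hq hq)) (is_deriveM hh hh))
  (is_deriveZ (2 * x) (is_deriveM hp hq)))
  (is_deriveZ (2 * y) (is_deriveM hq hh))) _.
by rewrite /lyapunov /GRing.scale/=; ring.
Qed.

(* [(p1 + i p2, q1 + i q2, h1 + i h2)] moves along [(1 + i k)] times the mode
   matrix. *)
Definition mode_flow (t r k : R) p1 q1 h1 p2 q2 h2 := forall s : R,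
  [/\ is_derive s 1 p1 (t * r ^+ 2 * q1 s - k * (t * r ^+ 2 * q2 s)),
      is_derive s 1 p2 (t * r ^+ 2 * q2 s + k * (t * r ^+ 2 * q1 s)),
      is_derive s 1 q1 ((r * h1 s - t * r ^+ 2 * p1 s)
        - k * (r * h2 s - t * r ^+ 2 * p2 s)) &
      is_derive s 1 q2 ((r * h2 s - t * r ^+ 2 * p2 s)
        + k * (r * h1 s - t * r ^+ 2 * p1 s))] /\
  is_derive s 1 h1 ((- (r * q1 s) - h1 s) - k * (- (r * q2 s) - h2 s)) /\
  is_derive s 1 h2 ((- (r * q2 s) - h2 s) + k * (- (r * q1 s) - h1 s)).

(** [M] commutes with [(1 + i k) M], so it maps trajectories to trajectories; the energy estimates
    then apply to [M y] as well. *)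
Lemma mode_flow_image t r k p1 q1 h1 p2 q2 h2 :
  mode_flow t r k p1 q1 h1 p2 q2 h2 ->
  mode_flow t r k (fun s => t * r ^+ 2 * q1 s)
    (fun s => r * h1 s - t * r ^+ 2 * p1 s) (fun s => - (r * q1 s) - h1 s)
    (fun s => t * r ^+ 2 * q2 s)
    (fun s => r * h2 s - t * r ^+ 2 * p2 s) (fun s => - (r * q2 s) - h2 s).
Proof.
move=> hf s; have [[d1 d2 d3 d4] [d5 d6]] := hf s.
have Z (a : R) (f : R -> R) : (fun u => a * f u) = a \*: f by [].
have comb (a b : R) f g (df dg : R) : is_derive s 1 f df -> is_derive s 1 g dg ->
    is_derive s 1 (fun u => a * f u - b * g u) (a * df - b * dg).
  move=> hdf hdg.
  by rewrite (_ : (fun u => _) = a \*: f - b \*: g)//; exact: is_deriveB.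
split; [split|split].
- rewrite (Z _ q1); apply: is_derive_eq; rewrite /GRing.scale/=; ring.
- rewrite (Z _ q2); apply: is_derive_eq; rewrite /GRing.scale/=; ring.
- by apply: is_derive_eq (comb _ _ _ _ _ _ d5 d1) _; ring.
- by apply: is_derive_eq (comb _ _ _ _ _ _ d6 d2) _; ring.
- rewrite (_ : (fun s => _) = (fun s => (- r) * q1 s - 1 * h1 s)).
    by apply: is_derive_eq (comb _ _ _ _ _ _ d3 d5) _; ring.
  by apply/funext => u; ring.
rewrite (_ : (fun s => _) = (fun s => (- r) * q2 s - 1 * h2 s)).
  by apply: is_derive_eq (comb _ _ _ _ _ _ d4 d6) _; ring.
by apply/funext => u; ring.
Qed.

Section Decay.
Variables (eps t r k : R).
Hypotheses (eps_gt0 : 0 < eps) (eps_small : eps <= (16^-1 : R))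
  (t_small : eps * t ^+ 2 <= (16^-1 : R))
  (r_small : eps * r ^+ 2 <= (16^-1 : R))
  (r4_small : eps * (r ^+ 2) ^+ 2 <= (16^-1 : R))
  (k_small : `|k| <= eps ^+ 3 / 24).

(** [V] extended to complex vectors, split into real and imaginary parts. *)
Definition mode_energy (p1 q1 h1 p2 q2 h2 : R) : R :=
  lyapunov (eps ^+ 3 * t) (eps ^+ 2 * r) p1 q1 h1 p1 q1 h1 +
  lyapunov (eps ^+ 3 * t) (eps ^+ 2 * r) p2 q2 h2 p2 q2 h2.

Lemma mode_energy_lower (p1 q1 h1 p2 q2 h2 : R) :
  (sq3 p1 q1 h1 + sq3 p2 q2 h2) / 2 <= mode_energy p1 q1 h1 p2 q2 h2.
Proof.
have [e0 e16] := (eps_gt0, eps_small).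
have e0' := ltW e0.
have t2 : 0 <= eps * t ^+ 2 by exact: mulr_ge0 e0' (sqr_ge0 t).
have r2 : 0 <= eps * r ^+ 2 by exact: mulr_ge0 e0' (sqr_ge0 r).
have x8 : `|eps ^+ 3 * t| <= (8^-1 : R).
  rewrite -(ler_pXn2r (n := 2)) ?nnegrE// real_normK ?num_real//.
  have -> : (eps ^+ 3 * t) ^+ 2 = eps ^+ 5 * (eps * t ^+ 2) by ring.
  have e4 : eps ^+ 4 <= 1 by rewrite exprn_ile1 ?(ltW e0)//; lra.
  have e5 : eps ^+ 5 <= 1 * 16^-1.
    by rewrite exprSr; apply: ler_pM; rewrite ?exprn_ge0 ?(ltW e0).
  apply: le_trans (_ : 1 * 16^-1 * 16^-1 <= _); last by lra.
  by apply: ler_pM => //; exact: exprn_ge0.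
have y8 : `|eps ^+ 2 * r| <= (8^-1 : R).
  rewrite -(ler_pXn2r (n := 2)) ?nnegrE// real_normK ?num_real//.
  have -> : (eps ^+ 2 * r) ^+ 2 = eps ^+ 2 * eps * (eps * r ^+ 2) by ring.
  have e2 : eps ^+ 2 <= 1 by rewrite exprn_ile1 ?(ltW e0)//; lra.
  have e3 : eps ^+ 2 * eps <= 1 * 16^-1.
    by apply: ler_pM => //; exact: sqr_ge0.
  apply: le_trans (_ : 1 * 16^-1 * 16^-1 <= _); last by lra.
  by apply: ler_pM => //; apply: mulr_ge0 => //; exact: sqr_ge0.
rewrite mulrDl; apply: lerD; exact: lyapunov_lower.
Qed.

Lemma mode_energy_ge0 (p1 q1 h1 p2 q2 h2 : R) : 0 <= mode_energy p1 q1 h1 p2 q2 h2.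
Proof.
by apply: le_trans (mode_energy_lower _ _ _ _ _ _); rewrite divr_ge0// addr_ge0 ?sq3_ge0.
Qed.

Section Flow.
Variables p1 q1 h1 p2 q2 h2 : R -> R.
Hypothesis flow : mode_flow t r k p1 q1 h1 p2 q2 h2.

Let energy s := mode_energy (p1 s) (q1 s) (h1 s) (p2 s) (q2 s) (h2 s).
Let dissipation s : R := sq3 (t * r * p1 s) (r * q1 s) (h1 s)
  + sq3 (t * r * p2 s) (r * q2 s) (h2 s).

(** Multiplication by [1 + i k] couples real and imaginary parts only through [k] times the
    antisymmetric part of the form, the quantity that [mode_form_rotated] handles; the factor 2
    comes from differentiating a square. *)
Lemma mode_flow_dissipation : exists dE : R -> R,
  (forall s : R, is_derive s 1 energy (dE s)) /\
  (forall s, dE s <= - (eps ^+ 3 / 2 * dissipation s)).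
Proof.
pose form a1 b1 c1 a2 b2 c2 := mode_form eps (t ^+ 2) (r ^+ 2)
  (t * r * a1) (r * b1) c1 (t * r * a2) (r * b2) c2.
exists (fun s => 2 * (form (p1 s) (q1 s) (h1 s) (p1 s) (q1 s) (h1 s)
  + form (p2 s) (q2 s) (h2 s) (p2 s) (q2 s) (h2 s)
  + k * (form (p1 s) (q1 s) (h1 s) (p2 s) (q2 s) (h2 s)
         - form (p2 s) (q2 s) (h2 s) (p1 s) (q1 s) (h1 s)))).
split=> s.
  have [[d1 d2 d3 d4] [d5 d6]] := flow s.
  apply: is_derive_eq (is_deriveD
    (is_derive_lyapunov (eps ^+ 3 * t) (eps ^+ 2 * r) d1 d3 d5)
    (is_derive_lyapunov (eps ^+ 3 * t) (eps ^+ 2 * r) d2 d4 d6)) _.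
  by rewrite /form -!mode_formE /lyapunov; ring.
have := mode_form_rotated eps_gt0 eps_small (sqr_ge0 t) (sqr_ge0 r) t_small
  r_small r4_small (t * r * p1 s) (r * q1 s) (h1 s) (t * r * p2 s) (r * q2 s)
  (h2 s) k_small.
rewrite /form /dissipation => ?; lra.
Qed.

Lemma mode_flow_decay s : 0 <= s -> energy s <= energy 0.
Proof.
have [dE [hE hdE]] := mode_flow_dissipation.
apply: (le_of_derive_le0 hE) => u _; apply: le_trans (hdE u) _.
rewrite oppr_le0; apply: mulr_ge0; last by rewrite addr_ge0 ?sq3_ge0.
by rewrite divr_ge0// exprn_ge0// ltW.
Qed.

End Flow.

(** With [E] the energy of [y] and [W] that of [M y], [F = K E + u^2 W] does not increase. The term
    [2 u W] is the form [B] between [y] and [M y], hence bounded by the dissipations of both, which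
    [K E'] and [u^2 W'] supply. At time 0 only [K E] is left. *)
Lemma mode_flow_smoothing p1 q1 h1 p2 q2 h2 s :
  mode_flow t r k p1 q1 h1 p2 q2 h2 -> 0 <= s ->
  s ^+ 2 * mode_energy (t * r ^+ 2 * q1 s) (r * h1 s - t * r ^+ 2 * p1 s)
    (- (r * q1 s) - h1 s) (t * r ^+ 2 * q2 s)
    (r * h2 s - t * r ^+ 2 * p2 s) (- (r * q2 s) - h2 s) <=
  36 / (eps ^+ 3 / 2) ^+ 2 *
    mode_energy (p1 0) (q1 0) (h1 0) (p2 0) (q2 0) (h2 0).
Proof.
have scalE (c a : R) : c != 0 -> 36 / c ^+ 2 * - (c * a) = - (36 / c * a).
  by move=> ?; field.
have youngE (c u a1 b1 a2 b2 : R) : c != 0 -> u != 0 ->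
    2 * u * (3 * (6 / (c * u) * a1 + b1 / (6 / (c * u))) +
      3 * (6 / (c * u) * a2 + b2 / (6 / (c * u)))) =
    36 / c * (a1 + a2) + u ^+ 2 * (c * (b1 + b2)).
  by move=> ? ?; field; apply/andP.
move=> flow s0; have [dE [hE hdE]] := mode_flow_dissipation flow.
have [dW [hW hdW]] := mode_flow_dissipation (mode_flow_image flow).
set c := eps ^+ 3 / 2; set K := 36 / c ^+ 2.
have c0 : 0 < c by rewrite divr_gt0// exprn_gt0.
have K0 : 0 <= K by rewrite divr_ge0// sqr_ge0.
set E := (fun s => mode_energy _ _ _ _ _ _) in hE.
set W := (fun s => mode_energy _ _ _ _ _ _) in hW.
pose F : R -> R := K \*: E + (id * id) * W.
have hF (u : R) : is_derive u 1 F (K * dE u + (u ^+ 2 * dW u + 2 * u * W u)).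
  have := hE u; have := hW u => hWu hEu.
  apply: is_derive_eq (is_deriveD (is_deriveZ K hEu) (is_deriveM
    (is_deriveM (is_derive_id u 1) (is_derive_id u 1)) hWu)) _.
  rewrite /GRing.scale/=.
  by rewrite -[(id * id) u]/(u * u); ring.
have FE u : F u = K * E u + u ^+ 2 * W u by rewrite expr2.
have : F s <= F 0.
  apply: (le_of_derive_le0 hF) => // u u0.
  (* This weight splits [2 u W] into [36 / c] times the dissipation of [y] and [c u^2] times that of
     [M y]: exact cancellation for [K = 36 / c ^+ 2]. *)
  have mu0 : 0 < 6 / (c * u) by rewrite divr_gt0// mulr_gt0.
  have W1 := mode_form_le eps_gt0 eps_small (sqr_ge0 t) (sqr_ge0 r) t_small
    r_small (t * r * p1 u) (r * q1 u) (h1 u) (t * r * (t * r ^+ 2 * q1 u))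
    (r * (r * h1 u - t * r ^+ 2 * p1 u)) (- (r * q1 u) - h1 u) mu0.
  have W2 := mode_form_le eps_gt0 eps_small (sqr_ge0 t) (sqr_ge0 r) t_small
    r_small (t * r * p2 u) (r * q2 u) (h2 u) (t * r * (t * r ^+ 2 * q2 u))
    (r * (r * h2 u - t * r ^+ 2 * p2 u)) (- (r * q2 u) - h2 u) mu0.
  rewrite -!mode_formE in W1 W2.
  have hWu := lerD W1 W2.
  rewrite -[leLHS]/(W u) in hWu.
  have := hdE u; have := hdW u; rewrite -/c.
  move: hWu.
  move: (sq3 _ _ _) (sq3 _ _ _) (sq3 _ _ _) (sq3 _ _ _) => b2 a2 b1 a1 hWu hb ha.
  have kE : K * dE u <= - (36 / c * (a1 + a2)).
    apply: le_trans (ler_wpM2l K0 ha) _.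
    by rewrite /K scalE// gt_eqF.
  have kW : u ^+ 2 * dW u <= - (u ^+ 2 * (c * (b1 + b2))).
    by rewrite -mulrN; apply: ler_wpM2l => //; exact: sqr_ge0.
  have u2 : 0 <= 2 * u by rewrite mulr_ge0// ltW.
  have := ler_wpM2l u2 hWu.
  rewrite youngE ?gt_eqF//.
  by move=> ?; lra.
have E0 : 0 <= K * E s by rewrite mulr_ge0// mode_energy_ge0.
rewrite !FE expr0n mul0r addr0; apply: le_trans.
by rewrite lerDr.
Qed.

End Decay.
End ModeFlow.

(** * Uniform bounds for the exponential of the mode matrix *)

Section ModeExponential.
Variable R : realType.
Local Notation C := R[i].

Lemma is_derive_of_quadratic (f : R -> R) (s d K : R) :
  (forall h, `|h| <= 1 -> `|f (s + h) - f s - h * d| <= K * h ^+ 2) ->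
  is_derive s 1 f d.
Proof.
move=> hf.
have K0 : 0 <= K.
  by have := hf 1; rewrite normr1 lexx expr1n mulr1 => /(_ isT); apply: le_trans.
have lim : h^-1 *: ((f \o shift s) (h *: (1 : R)) - f s) @[h --> 0^'] --> d.
  apply/cvgrPdist_le => e e0; near=> h.
  have h0 : h != 0 by near: h; exact: nbhs_dnbhs_neq.
  have h1 : `|h| <= 1.
    by near: h; apply: dnbhs0_le.
  have he : `|h| <= e / (K + 1).
    by near: h; apply: dnbhs0_le; rewrite divr_gt0// ltr_wpDl.
  rewrite /= /GRing.scale/= mulr1 [h + s]addrC.
  have -> : d - h^-1 * (f (s + h) - f s) = - (h^-1 * (f (s + h) - f s - h * d)).
    by field.
  rewrite normrN normrM normfV ler_pdivrMl ?normr_gt0//.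
  apply: le_trans (hf _ h1) _.
  rewrite -[h ^+ 2]real_normK ?num_real// expr2 mulrCA ler_wpM2l//.
  apply: le_trans (_ : (K + 1) * `|h| <= _); first by rewrite ler_wpM2r// lerDl.
  by rewrite mulrC -ler_pdivlMr// ltr_wpDl.
by split; [exact: cvgP lim|exact: cvg_lim lim].
Unshelve. all: by end_near. Qed.

Lemma entry_mulBZ n (B X Y Z : 'M[C]_n.+1) (h : C) i j :
  (B * (X - Y - h *: Z)) i j = (B * X) i j - (B * Y) i j - h * (B * Z) i j.
Proof. by rewrite !mulrBr -scalerAr !mxE. Qed.

(** The prefactor [B] lets one statement give both derivatives along a line: [B = 1] for the first,
    [B] a multiple of [A] for the second. *)
Lemma is_derive_mexp n (B A : 'M[C]_n.+1) (w z : C) i j (s : R) :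
  is_derive s 1 (fun u : R => complex.Re ((B * mexp ((w + u%:C * z) *: A)) i j))
    (complex.Re (z * (B * (A * mexp ((w + s%:C * z) *: A))) i j)) /\
  is_derive s 1 (fun u : R => complex.Im ((B * mexp ((w + u%:C * z) *: A)) i j))
    (complex.Im (z * (B * (A * mexp ((w + s%:C * z) *: A))) i j)).
Proof.
have [a hA] := bounded_mx_exists A; have [b hB] := bounded_mx_exists B.
pose K := b * (expR (rn (w + s%:C * z) * a) * (a ^+ 2 * expR (rn z * a)) *
  rn z ^+ 2).
have key h : `|h| <= 1 -> rn ((B * mexp ((w + (s + h)%:C * z) *: A)) i j
    - (B * mexp ((w + s%:C * z) *: A)) i j
    - h%:C * (z * (B * (A * mexp ((w + s%:C * z) *: A))) i j)) <= K * h ^+ 2.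
  move=> h1; have hz : rn (h%:C * z) <= rn z.
    by rewrite rnM rn_real ler_piMl// rn_ge0.
  have := bounded_mx_entry i j
    (bounded_mxM hB (mexp_increment (w + s%:C * z) hA hz)).
  rewrite rnM rn_real exprMn real_normK ?num_real//.
  have -> : w + s%:C * z + h%:C * z = w + (s + h)%:C * z.
    by rewrite rmorphD mulrDl addrA.
  rewrite entry_mulBZ -mulrA.
  by move/le_trans; apply; rewrite /K le_eqVlt; apply/orP; left; apply/eqP; ring.
split; apply: (@is_derive_of_quadratic _ _ _ K) => h h1.
  apply: le_trans (key h h1); apply: le_trans _ (Re_le_rn _).
  by rewrite !raddfB /=; case: (z * _) => x y /=; rewrite mul0r subr0.
apply: le_trans (key h h1); apply: le_trans _ (Im_le_rn _).
by rewrite !raddfB /=; case: (z * _) => x y /=; rewrite mul0r addr0.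
Qed.

Definition mode_mx (t r : R) : 'M[C]_3 := \matrix_(i, j)
  (nth 0 (nth [::] [:: [:: 0; t * r ^+ 2; 0];
                       [:: - (t * r ^+ 2); 0; r];
                       [:: 0; - r; - 1]] i) j)%:C.

Definition i0 : 'I_3 := ord0.
Definition i1 : 'I_3 := lift ord0 ord0.
Definition i2 : 'I_3 := lift ord0 (lift ord0 ord0).

Lemma ord3P (i : 'I_3) : [\/ i = i0, i = i1 | i = i2].
Proof.
by case: i => [[|[|[|//]]] h]; [apply: Or31|apply: Or32|apply: Or33];
  apply: val_inj.
Qed.

Lemma mode_mxM t r (B : 'M[C]_3) j :
  [/\ (mode_mx t r * B) i0 j = (t * r ^+ 2)%:C * B i1 j,
      (mode_mx t r * B) i1 j = r%:C * B i2 j - (t * r ^+ 2)%:C * B i0 j &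
      (mode_mx t r * B) i2 j = - (r%:C * B i1 j) - B i2 j].
Proof.
split; rewrite !mxE !big_ord_recl big_ord0 !mxE /=.
- by rewrite -/i0 -/i1 -/i2; ring.
- by rewrite -/i0 -/i1 -/i2 rmorphN; ring.
- by rewrite -/i0 -/i1 -/i2 !rmorphN rmorph1; ring.
Qed.

Lemma mode_exp_flow t r k j :
  let G s := mexp ((s%:C * (1 +i* k)) *: mode_mx t r) in
  mode_flow t r k
    (fun s => complex.Re (G s i0 j)) (fun s => complex.Re (G s i1 j))
    (fun s => complex.Re (G s i2 j))
    (fun s => complex.Im (G s i0 j)) (fun s => complex.Im (G s i1 j))
    (fun s => complex.Im (G s i2 j)).
Proof.
move=> G s.
have D i : is_derive s 1 (fun u => complex.Re (G u i j))
      (complex.Re ((1 +i* k) * (mode_mx t r * G s) i j)) /\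
    is_derive s 1 (fun u => complex.Im (G u i j))
      (complex.Im ((1 +i* k) * (mode_mx t r * G s) i j)).
  have GE u : 1 * mexp ((0 + u%:C * (1 +i* k)) *: mode_mx t r) = G u.
    by rewrite mul1r add0r.
  have [re im] := is_derive_mexp 1 (mode_mx t r) 0 (1 +i* k) i j s.
  split.
    rewrite (_ : (fun u => _) = (fun u : R => complex.Re
      ((1 * mexp ((0 + u%:C * (1 +i* k)) *: mode_mx t r)) i j))).
      by apply: is_derive_eq re _; rewrite mul1r -{1}(GE s) mul1r.
    by apply/funext => u; rewrite GE.
  rewrite (_ : (fun u => _) = (fun u : R => complex.Im
    ((1 * mexp ((0 + u%:C * (1 +i* k)) *: mode_mx t r)) i j))).
    by apply: is_derive_eq im _; rewrite mul1r -{1}(GE s) mul1r.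
  by apply/funext => u; rewrite GE.
have [re0 im0] := D i0; have [re1 im1] := D i1; have [re2 im2] := D i2.
have [E0 E1 E2] := mode_mxM t r (G s) j.
rewrite E0 in re0 im0; rewrite E1 in re1 im1; rewrite E2 in re2 im2.
split; [split|split].
- apply: is_derive_eq re0 _; case: (G s i1 j) => x y /=; ring.
- apply: is_derive_eq im0 _; case: (G s i1 j) => x y /=; ring.
- apply: is_derive_eq re1 _; case: (G s i0 j) (G s i2 j) => x y [x' y'] /=; ring.
- apply: is_derive_eq im1 _; case: (G s i0 j) (G s i2 j) => x y [x' y'] /=; ring.
- apply: is_derive_eq re2 _; case: (G s i1 j) (G s i2 j) => x y [x' y'] /=; ring.
apply: is_derive_eq im2 _; case: (G s i1 j) (G s i2 j) => x y [x' y'] /=; ring.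
Qed.

Section Bounds.
Variables (eps t r k : R).
Hypotheses (eps_gt0 : 0 < eps) (eps_small : eps <= (16^-1 : R))
  (t_small : eps * t ^+ 2 <= (16^-1 : R))
  (r_small : eps * r ^+ 2 <= (16^-1 : R))
  (r4_small : eps * (r ^+ 2) ^+ 2 <= (16^-1 : R))
  (k_small : `|k| <= eps ^+ 3 / 24).

Let G (s : R) := mexp ((s%:C * (1 +i* k)) *: mode_mx t r).

(** A column of the identity has a single nonzero entry, so both cross terms vanish and the energy
    is free of [eps], [t] and [r]. *)
Let initial_energy j : mode_energy eps t r
  (complex.Re (G 0 i0 j)) (complex.Re (G 0 i1 j)) (complex.Re (G 0 i2 j))
  (complex.Im (G 0 i0 j)) (complex.Im (G 0 i1 j)) (complex.Im (G 0 i2 j)) = 1.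
Proof.
rewrite /G mul0r scale0r mexp0 !mxE /mode_energy /lyapunov.
by case: (ord3P j) => ->; rewrite !eqE /= ; ring.
Qed.

Let rn_sqr_le (B : 'M[C]_3) i j :
  rn (B i j) ^+ 2 <= 2 * mode_energy eps t r
  (complex.Re (B i0 j)) (complex.Re (B i1 j)) (complex.Re (B i2 j))
  (complex.Im (B i0 j)) (complex.Im (B i1 j)) (complex.Im (B i2 j)).
Proof.
rewrite mulrC -ler_pdivrMr//.
apply: le_trans (mode_energy_lower eps_gt0 eps_small t_small r_small _ _ _ _ _ _).
rewrite ler_wpM2r ?invr_ge0// rn_sqr /sq3.
have sq := (sqr_ge0 (complex.Re (B i0 j)), sqr_ge0 (complex.Re (B i1 j)),
  sqr_ge0 (complex.Re (B i2 j)), sqr_ge0 (complex.Im (B i0 j)),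
  sqr_ge0 (complex.Im (B i1 j)), sqr_ge0 (complex.Im (B i2 j))).
case: sq => [[[[[s0 s1] s2] s3] s4] s5].
by case: (ord3P i) => ->; lra.
Qed.

Lemma mode_exp_ray_bound s i j : 0 <= s -> rn (G s i j) ^+ 2 <= 2.
Proof.
move=> s0; apply: le_trans (rn_sqr_le _ _ _) _.
rewrite -[leRHS]mulr1 ler_wpM2l// -(initial_energy j).
exact: (mode_flow_decay eps_gt0 eps_small t_small r_small r4_small k_small
  (mode_exp_flow t r k j) s0).
Qed.

Lemma mode_exp_ray_smoothing s i j : 0 <= s ->
  s ^+ 2 * rn ((mode_mx t r * G s) i j) ^+ 2 <= 72 / (eps ^+ 3 / 2) ^+ 2.
Proof.
move=> s0.
apply: le_trans (ler_wpM2l (sqr_ge0 s) (rn_sqr_le _ _ _)) _.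
have [-> -> ->] := mode_mxM t r (G s) j.
have := mode_flow_smoothing eps_gt0 eps_small t_small r_small r4_small k_small
  (mode_exp_flow t r k j) s0.
rewrite initial_energy mulr1 -/(G s) => h.
rewrite mulrCA (_ : 72 / _ = 2 * (36 / (eps ^+ 3 / 2) ^+ 2)); last first.
  by rewrite mulrA -natrM.
rewrite ler_wpM2l//; apply: le_trans h.
rewrite le_eqVlt; apply/orP; left; apply/eqP; congr (_ * _).
by case: (G s i0 j) (G s i1 j) (G s i2 j) => [a b] [a' b'] [a'' b''] /=;
  congr mode_energy; ring.
Qed.

End Bounds.

(** A point of the cone is [s (1 + i k)] with [|k| <= kappa], so the estimates along rays apply
    column by column; [kappa] and [K] depend on [L] alone. *)
Lemma mode_exp_bounds (L : R) : 0 <= L -> exists kappa K : R,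
  [/\ 0 < kappa, 0 <= K & forall t r (z : C), t ^+ 2 <= L -> r ^+ 2 <= L ->
   0 <= complex.Re z -> `|complex.Im z| <= kappa * complex.Re z -> forall i j,
   let M := mode_mx t r in let G := mexp (z *: M) in
   [/\ rn (G i j) <= K, rn z * rn ((M * G) i j) <= K &
       rn z ^+ 2 * rn ((M * (M * G)) i j) <= K]].
Proof.
(* The square is there because [eps] must be small against [(r ^+ 2) ^+ 2], which may be as large as
   [L ^+ 2]. *)
move=> L0; pose eps : R := (16 * (1 + L) ^+ 2)^-1.
have L1 : 1 <= (1 + L) ^+ 2 by rewrite exprn_ege1// lerDl.
have D0 : 0 < 16 * (1 + L) ^+ 2 by rewrite mulr_gt0// exprn_gt0// ltr_wpDr.
have e0 : 0 < eps by rewrite invr_gt0.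
have esmall x : x <= (1 + L) ^+ 2 -> eps * x <= (16^-1 : R).
  move=> xL; rewrite mulrC ler_pdivrMr// mulrA mulVf ?mul1r//.
have LL : L <= (1 + L) ^+ 2 by rewrite sqrrD; have := sqr_ge0 L => ?; lra.
have LL2 : L ^+ 2 <= (1 + L) ^+ 2 by rewrite sqrrD => //; lra.
pose kappa := eps ^+ 3 / 24.
have kappa0 : 0 < kappa by rewrite divr_gt0// exprn_gt0.
pose K2 := 72 / (eps ^+ 3 / 2) ^+ 2.
have K20 : 0 <= K2 by rewrite divr_ge0// sqr_ge0.
(* [1 + kappa] compares [rn z] with its real part; [1 + K2] replaces the square root of [K2]. *)
pose K1 := (1 + kappa) * (1 + K2).
have K10 : 0 <= K1 by rewrite mulr_ge0// addr_ge0// ltW.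
have cone (z : C) : 0 <= complex.Re z -> `|complex.Im z| <= kappa * complex.Re z ->
    exists s k : R, [/\ 0 <= s, `|k| <= kappa, z = s%:C * (1 +i* k)
      & rn z <= (1 + kappa) * s].
  (* If [x = 0] the cone forces [y = 0], and the slope takes the default value 0. *)
  case: z => x y /= x0 hy; exists x, (y / x).
  have x0y : x = 0 -> y = 0.
    by move=> xE; move: hy; rewrite xE mulr0 normr_le0 => /eqP.
  split=> //.
  - have [xE|xN] := eqVneq x 0; first by rewrite xE invr0 mulr0 normr0 ltW.
    by rewrite normrM normfV [`|x|]ger0_norm// ler_pdivrMr// lt_def xN.
  - have [xE|xN] := eqVneq x 0; first by rewrite (x0y xE) xE mul0r.
    by apply/eqP; rewrite eq_complex /= !mulr1 !mul0r subr0 addr0 mulrCA divff// mulr1 !eqxx.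
  apply: le_trans (rn_le_ReIm _) _ => /=.
  by rewrite ger0_norm// mulrDl mul1r lerD2l.
pose K := 2 + K1 + 12 * K1 ^+ 2.
have K1s : 0 <= K1 ^+ 2 := sqr_ge0 _.
exists kappa, K; split => // [|t r z tL rL z0 zk i j M G].
  by rewrite /K; lra.
have te := esmall _ (le_trans tL LL); have re := esmall _ (le_trans rL LL).
have re4 : eps * (r ^+ 2) ^+ 2 <= (16^-1 : R).
  apply: esmall; apply: le_trans LL2.
  by rewrite lerXn2r ?nnegrE ?sqr_ge0.
have e1 : eps <= (16^-1 : R) by rewrite -[eps]mulr1 esmall.
have smoothing (w : C) l m : 0 <= complex.Re w ->
    `|complex.Im w| <= kappa * complex.Re w ->
    rn w * rn ((M * mexp (w *: M)) l m) <= K1.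
  move=> w0 /(cone _ w0)[s [k [s0 hk wE hw]]].
  have := mode_exp_ray_smoothing e0 e1 te re re4 hk l m s0.
  rewrite -/K2 -wE -/M -exprMn; set y := rn ((M * _) l m) => h.
  have sy : s * y <= 1 + K2.
    have sy0 : 0 <= s * y by rewrite mulr_ge0// rn_ge0.
    have K21 : 0 <= 1 + K2 by rewrite addr_ge0.
    rewrite -(ler_pXn2r (n := 2)) ?nnegrE//.
    by apply: le_trans h _; rewrite sqrrD; have := sqr_ge0 K2 => ?; lra.
  apply: (@le_trans _ _ ((1 + kappa) * s * y)); first by rewrite ler_wpM2r ?rn_ge0.
  by rewrite -mulrA ler_wpM2l// addr_ge0// ltW.
split.
- have [s [k [s0 hk zE hz]]] := cone _ z0 zk.
  have := mode_exp_ray_bound e0 e1 te re re4 hk i j s0.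
  rewrite -zE -/M -/G => h; apply: le_trans (_ : 2 <= _); last by rewrite /K; lra.
  rewrite -(ler_pXn2r (n := 2)) ?nnegrE ?rn_ge0//; apply: le_trans h _.
  by rewrite expr2; lra.
- by apply: le_trans (smoothing _ _ _ z0 zk) _; rewrite /K; lra.
(* Halving the time factors [M ^ 2 exp (z M)] as [(M exp (w M)) ^ 2], so the second-order bound
   follows from the first-order one: four from [z = 2 w], three from the matrix product, whence
   [12 * K1 ^+ 2]. *)
pose w := (2^-1 : R)%:C * z.
have zw : z = w + w.
  by rewrite /w -mulrDl -rmorphD /= -div1r -splitr mul1r.
have half : M * (M * G) = (M * mexp (w *: M)) * (M * mexp (w *: M)).
  have GE : G = mexp (w *: M) * mexp (w *: M) by rewrite -mexp_scaleD -zw.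
  have cM : GRing.comm (mexp (w *: M)) M.
    by apply: mexp_comm; have := comm_scale w 1 M; rewrite scale1r.
  by rewrite GE -mulrA [mexp _ * (M * _)]mulrA cM !mulrA.
have p : 0 <= (2^-1 : R) by rewrite invr_ge0.
have hw : rn z = 2 * rn w.
  have -> : rn w = 2^-1 * rn z by rewrite rnM rn_real ger0_norm.
  by rewrite mulrA divff ?mul1r// pnatr_eq0.
have w0 : 0 <= complex.Re w.
  by rewrite /w; case: (z) z0 => x y /= x0; rewrite mul0r subr0 mulr_ge0.
have wk : `|complex.Im w| <= kappa * complex.Re w.
  rewrite /w; case: (z) zk => x y /= hy; rewrite !mul0r subr0 addr0.
  by rewrite normrM (ger0_norm p) mulrCA; apply: ler_wpM2l.
rewrite half hw mxE; set X := M * _.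
have hX l m : rn w * rn (X l m) <= K1 by exact: smoothing.
apply: le_trans (_ : \sum_(l < 3) 4 * K1 ^+ 2 <= _); last first.
  by rewrite sumr_const card_ord -mulr_natr /K; lra.
apply: le_trans (ler_wpM2l (sqr_ge0 _) (rn_sum _ _ _)) _.
rewrite mulr_sumr; apply: ler_sum => l _; rewrite rnM.
rewrite [leLHS](_ : _ = 4 * ((rn w * rn (X i l)) * (rn w * rn (X l j)))); last by ring.
have pos l' m : 0 <= rn w * rn (X l' m) by rewrite mulr_ge0 ?rn_ge0.
apply: ler_wpM2l; first exact: ler0n.
by rewrite expr2; apply: ler_pM; [exact: pos|exact: pos|exact: hX|exact: hX].
Qed.

End ModeExponential.

(** * Modal families and the semigroup on coordinates *)

Section ModalFamily.
Variable R : realType.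
Local Notation C := R[i].

Definition cone (kappa : R) : set C :=
  [set z | 0 < complex.Re z /\ `|complex.Im z| <= kappa * complex.Re z].

Lemma taylor1 (f df ddf : R -> R) (B : R) :
  (forall s : R, is_derive s 1 f (df s)) ->
  (forall s : R, is_derive s 1 df (ddf s)) ->
  (forall s, 0 <= s -> s <= 1 -> `|ddf s| <= B) -> `|f 1 - f 0 - df 0| <= B.
Proof.
move=> hf hdf hB.
have cont (g dg : R -> R) (a b : R) : (forall s : R, is_derive s 1 g (dg s)) ->
    {within `[a, b], continuous g}.
  by move=> hg; apply: derivable_within_continuous => u _; case: (hg u).
have [s] := @MVT R f df 0 1 ltr01 (fun u _ => hf u) (cont _ _ _ _ hf).
rewrite in_itv/= => /andP[s0 s1] ->; rewrite subr0 mulr1.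
have [u] := @MVT R df ddf 0 s s0 (fun u _ => hdf u) (cont _ _ _ _ hdf).
rewrite in_itv/= => /andP[u0 us] ->; rewrite subr0 normrM (gtr0_norm s0).
have u1 : u <= 1 by rewrite ltW// (lt_trans us).
have := hB u (ltW u0) u1; have := normr_ge0 (ddf u) => b0 bB.
by apply: le_trans bB; rewrite ler_piMr// ltW.
Qed.

Lemma entryB m n (A B : 'M[C]_(m, n)) i j : (A - B) i j = A i j - B i j.
Proof. by rewrite !mxE. Qed.

Lemma entryZ m n (z : C) (A : 'M[C]_(m, n)) i j : (z *: A) i j = z * A i j.
Proof. by rewrite mxE. Qed.

(** Unlike that of [mexp_increment], the constant does not involve the size of [A]: only the second
    derivative along the segment counts, which analyticity bounds uniformly over the modes. The 2
    adds real and imaginary parts. *)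
Lemma mexp_taylor2 n (A : 'M[C]_n.+1) (z h : C) i j (B : R) :
  (forall s : R, 0 <= s -> s <= 1 ->
    rn (h ^+ 2 * (A * (A * mexp ((z + s%:C * h) *: A))) i j) <= B) ->
  rn (mexp ((z + h) *: A) i j - mexp (z *: A) i j
      - h * (A * mexp (z *: A)) i j) <= 2 * B.
Proof.
move=> hB.
pose g (s : R) := mexp ((z + s%:C * h) *: A) i j.
pose dg (s : R) := ((h *: A) * mexp ((z + s%:C * h) *: A)) i j.
pose ddg (s : R) := h * ((h *: A) * (A * mexp ((z + s%:C * h) *: A))) i j.
have ddgE s : ddg s = h ^+ 2 * (A * (A * mexp ((z + s%:C * h) *: A))) i j.
  by rewrite /ddg -scalerAl entryZ mulrA expr2.
have d1 (s : R) : is_derive s 1 (fun u => complex.Re (g u)) (complex.Re (dg s)) /\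
    is_derive s 1 (fun u => complex.Im (g u)) (complex.Im (dg s)).
  have [re im] := is_derive_mexp 1 A z h i j s.
  have gE : g = (fun u : R => (1 * mexp ((z + u%:C * h) *: A)) i j).
    by apply/funext => u; rewrite mul1r.
  have dgE : dg s = h * (1 * (A * mexp ((z + s%:C * h) *: A))) i j.
    by rewrite mul1r /dg -scalerAl entryZ.
  by rewrite gE dgE.
have d2 (s : R) : is_derive s 1 (fun u => complex.Re (dg u)) (complex.Re (ddg s)) /\
    is_derive s 1 (fun u => complex.Im (dg u)) (complex.Im (ddg s)).
  exact: is_derive_mexp.
have re : `|complex.Re (g 1) - complex.Re (g 0) - complex.Re (dg 0)| <= B.
  apply: (taylor1 (fun s => (d1 s).1) (fun s => (d2 s).1)) => s s0 s1.
  by apply: le_trans (Re_le_rn _) _; rewrite ddgE hB.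
have im : `|complex.Im (g 1) - complex.Im (g 0) - complex.Im (dg 0)| <= B.
  apply: (taylor1 (fun s => (d1 s).2) (fun s => (d2 s).2)) => s s0 s1.
  by apply: le_trans (Im_le_rn _) _; rewrite ddgE hB.
have c1 : z + (1 : R)%:C * h = z + h by rewrite mul1r.
have c0 : z + (0 : R)%:C * h = z by rewrite mul0r addr0.
have g1 : g 1 = mexp ((z + h) *: A) i j.
  exact: (congr1 (fun w => mexp (w *: A) i j) c1).
have g0 : g 0 = mexp (z *: A) i j.
  exact: (congr1 (fun w => mexp (w *: A) i j) c0).
have dg0 : dg 0 = h * (A * mexp (z *: A)) i j.
  rewrite -entryZ scalerAl.
  exact: (congr1 (fun w => ((h *: A) * mexp (w *: A)) i j) c0).
suff : rn (g 1 - g 0 - dg 0) <= 2 * B by rewrite g1 g0 dg0.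
clearbody g dg; apply: le_trans (rn_le_ReIm _) _.
by rewrite !raddfB /= mulrDl mul1r lerD.
Qed.

Section Family.
Variables (lambda t r : nat -> R) (kappa K : R).
Hypothesis lambda_gt0 : forall k, 0 < lambda k.
Hypothesis kappa_gt0 : 0 < kappa.
Hypothesis K_ge0 : 0 <= K.
Hypothesis mode_bounds : forall k (z : C), 0 <= complex.Re z ->
  `|complex.Im z| <= kappa * complex.Re z -> forall i j,
   let M := mode_mx (t k) (r k) in let G := mexp (z *: M) in
   [/\ rn (G i j) <= K, rn z * rn ((M * G) i j) <= K &
       rn z ^+ 2 * rn ((M * (M * G)) i j) <= K].

Definition modal_mx k : 'M[C]_3 := (lambda k)%:C *: mode_mx (t k) (r k).

Definition modal_exp k z : 'M[C]_3 := mexp (z *: modal_mx k).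

Lemma modal_expE k z :
  modal_exp k z = mexp (((lambda k)%:C * z) *: mode_mx (t k) (r k)).
Proof. by rewrite /modal_exp /modal_mx scalerA mulrC. Qed.

(** The cone is stable under positive dilations; thus bounds on [mode_mx] over it become bounds on
    [modal_mx], however large the eigenvalue. *)
Lemma cone_scale k z : cone kappa z ->
  0 <= complex.Re ((lambda k)%:C * z) /\
  `|complex.Im ((lambda k)%:C * z)| <= kappa * complex.Re ((lambda k)%:C * z).
Proof.
have l0 := lambda_gt0 k.
case: z => x y [/= x0 yx]; rewrite !mul0r subr0 addr0; split.
  by rewrite mulr_ge0// ltW.
by rewrite normrM (gtr0_norm l0) mulrCA; apply: ler_wpM2l => //; exact: ltW.
Qed.

Lemma modal_exp_bound k z i j : cone kappa z -> rn (modal_exp k z i j) <= K.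
Proof.
move=> /(cone_scale k)[a b]; rewrite modal_expE.
by have [] := @mode_bounds k _ a b i j.
Qed.

Lemma rn_lambda k : rn ((lambda k)%:C : C) = lambda k.
Proof. by rewrite rn_real gtr0_norm. Qed.

Lemma modal_exp_derive_bound k z i j : cone kappa z ->
  rn z * rn ((modal_mx k * modal_exp k z) i j) <= K.
Proof.
move=> /(cone_scale k)[a b]; have [_ h _] := @mode_bounds k _ a b i j.
rewrite modal_expE /modal_mx -scalerAl entryZ.
rewrite rnM rn_lambda in h.
by rewrite rnM rn_lambda mulrA [rn z * _]mulrC.
Qed.

Lemma modal_exp_derive2_bound k z i j : cone kappa z ->
  rn z ^+ 2 * rn ((modal_mx k * (modal_mx k * modal_exp k z)) i j) <= K.
Proof.
move=> /(cone_scale k)[a b]; have [_ _ h] := @mode_bounds k _ a b i j.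
rewrite modal_expE; move: h; set X := mexp _; move: X => X.
have -> : modal_mx k * (modal_mx k * X) = ((lambda k)%:C ^+ 2) *:
    (mode_mx (t k) (r k) * (mode_mx (t k) (r k) * X)).
  by rewrite /modal_mx -!scalerAl -scalerAr scalerA expr2.
rewrite entryZ !rnM !rn_lambda; apply: le_trans.
by rewrite le_eqVlt; apply/orP; left; apply/eqP; ring.
Qed.

Lemma modal_expD k z w : modal_exp k (z + w) = modal_exp k z * modal_exp k w.
Proof. exact: mexp_scaleD. Qed.

Lemma modal_exp0 k : modal_exp k 0 = 1.
Proof. by rewrite /modal_exp scale0r mexp0. Qed.

(** The difference between the slopes [kappa / 2] and [kappa] leaves room for a ball. *)
Lemma cone_ball z : cone (kappa / 2) z -> exists2 rho : R, 0 < rho &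
  forall h, rn h <= rho -> cone kappa (z + h) /\ complex.Re z / 2 <= rn (z + h).
Proof.
case: z => x y [/= x0 yx].
have k0 := kappa_gt0.
(* Solves [kappa * x / 2 + rho = kappa * (x - rho)], the worst case of the slope condition. *)
pose rho := kappa * x / (2 * (1 + kappa)).
have rho0 : 0 < rho by rewrite divr_gt0 ?mulr_gt0//; lra.
have rhoE : rho * (1 + kappa) = kappa * x / 2 by rewrite /rho; field; lra.
have kr : 0 < kappa * rho by rewrite mulr_gt0.
exists rho => // h hrho.
have := Re_le_rn h; have := Im_le_rn h => hi hr.
have := Re_le_rn ((x +i* y) + h).
case: h hrho hi hr => u v /= hrho hi hr hR.
have x2 : x / 2 <= x + u.
  move: hr; rewrite ler_norml => /andP[? ?].
  suff : rho <= x / 2 by move=> ?; lra.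
  rewrite -(ler_pM2r (x := 1 + kappa)) ?rhoE; last by lra.
  by have := mulr_gt0 k0 x0 => ?; lra.
split; last by apply: le_trans (le_trans (ler_norm _) hR).
split=> /=; first by lra.
apply: le_trans (ler_normD _ _) _.
have : kappa * rho + rho <= kappa * x / 2 by rewrite -rhoE; lra.
have : kappa * (x - rho) <= kappa * (x + u).
  rewrite ler_pM2l//; move: hr; rewrite ler_norml => /andP[? ?]; lra.
by move=> *; lra.
Qed.

(** On the ball the modulus stays above half the real part of [z], so dividing the cone bounds by
    its powers gives constants independent of the mode. *)
Lemma modal_exp_taylor z : cone (kappa / 2) z -> exists rho B : R,
  [/\ 0 < rho, 0 <= B & forall k i j,
    rn ((modal_mx k * modal_exp k z) i j) <= B /\
    forall h, rn h <= rho ->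
    rn (modal_exp k (z + h) i j - modal_exp k z i j
        - h * (modal_mx k * modal_exp k z) i j) <= B * rn h ^+ 2].
Proof.
move=> zc; have [rho rho0 hrho] := cone_ball zc.
pose x := complex.Re z; have x0 : 0 < x by case: zc.
have x20 : 0 < (x / 2) ^+ 2 by rewrite exprn_gt0// divr_gt0.
pose B1 := K / (x / 2); pose B2 := 2 * (K / (x / 2) ^+ 2).
have B10 : 0 <= B1 by rewrite divr_ge0// ltW// divr_gt0.
have B20 : 0 <= B2 by rewrite mulr_ge0// divr_ge0// ltW.
exists rho, (B1 + B2); split=> // [|k i j]; first exact: addr_ge0.
split.
  have [zk zx] := hrho 0 (ltac:(by rewrite rn0 ltW)).
  rewrite addr0 in zk zx.
  apply: le_trans (_ : B1 <= _); last by rewrite lerDl.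
  rewrite ler_pdivlMr ?divr_gt0// mulrC.
  apply: le_trans (modal_exp_derive_bound k i j zk).
  by apply: ler_wpM2r => //; exact: rn_ge0.
move=> h hh; have h20 : 0 <= rn h ^+ 2 := sqr_ge0 _.
apply: le_trans (_ : 2 * (K / (x / 2) ^+ 2 * rn h ^+ 2) <= _); last first.
  by rewrite [leLHS]mulrA [leRHS]mulrDl lerDr mulr_ge0.
apply: mexp_taylor2 => s s0 s1.
have hs : rn (s%:C * h) <= rho.
  apply: le_trans hh; rewrite rnM rn_real ger0_norm//.
  by rewrite ler_piMl// rn_ge0.
have [wk wx] := hrho _ hs.
rewrite rnM rnX mulrC; apply: ler_wpM2r => //.
rewrite ler_pdivlMr// mulrC.
apply: le_trans (modal_exp_derive2_bound k i j wk).
apply: ler_wpM2r; first exact: rn_ge0.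
by rewrite lerXn2r ?nnegrE ?rn_ge0// ltW// divr_gt0.
Qed.

(** Here [B] grows with the eigenvalue; the lemma is applied to finitely many modes at a time. *)
Lemma modal_exp_near0 k : exists2 B : R, 0 <= B & forall h i j, rn h <= 1 ->
  rn (modal_exp k h i j - (1 : 'M[C]_3) i j) <= B * rn h.
Proof.
have [a hA] := bounded_mx_exists (modal_mx k); have a0 := bounded_mx_ge0 hA.
have e0 := expR_ge0 (1 * a); have e0' := expR_ge0 (rn (0 : C) * a).
exists (a + expR (rn (0 : C) * a) * (a ^+ 2 * expR (1 * a))).
  by rewrite addr_ge0// mulr_ge0// mulr_ge0// sqr_ge0.
move=> h i j h1.
have hI := bounded_mx_entry i j (mexp_increment 0 hA h1).
have hM := bounded_mx_entry i j (bounded_mxZ h hA).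
move: hI; rewrite add0r scale0r mexp0 mulr1 -/(modal_exp k h) !entryB => hI.
rewrite -[X in rn X](subrK ((h *: modal_mx k) i j)).
apply: le_trans (rnD _ _) _; apply: le_trans (lerD hI hM) _.
rewrite [leRHS]mulrDl [leRHS]addrC; apply: lerD; last by rewrite mulrC.
apply: ler_wpM2l; first by rewrite mulr_ge0// mulr_ge0// sqr_ge0.
by rewrite expr2 ler_piMl// rn_ge0.
Qed.

End Family.

End ModalFamily.

(** * Triples of vectors and mode-wise matrix operators *)

Section Triples.
Variables (R : realType) (H : completeNormedModType R[i]).
Local Notation C := R[i].
Implicit Types (F G : H * H * H) (i j : 'I_3).

Definition cpt F i : H := nth 0 [:: F.1.1; F.1.2; F.2] i.

Definition triple (f : 'I_3 -> H) : H * H * H := (f i0, f i1, f i2).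

Lemma cpt_triple f i : cpt (triple f) i = f i.
Proof. by case: (ord3P i) => ->. Qed.

Lemma cpt_ext F G : (forall i, cpt F i = cpt G i) -> F = G.
Proof.
move=> h; have := h i0; have := h i1; have := h i2.
by case: F G {h} => [[? ?] ?] [[? ?] ?]; rewrite /cpt /= => -> -> ->.
Qed.

Lemma cpt_linear (a : C) F G i :
  cpt (a *: F + G) i = a *: cpt F i + cpt G i.
Proof. by case: (ord3P i) => ->. Qed.

Lemma cptB F G i : cpt (F - G) i = cpt F i - cpt G i.
Proof. by case: (ord3P i) => ->. Qed.

Lemma cptD F G i : cpt (F + G) i = cpt F i + cpt G i.
Proof. by case: (ord3P i) => ->. Qed.

Lemma cptZ (a : C) F i : cpt (a *: F) i = a *: cpt F i.
Proof. by case: (ord3P i) => ->. Qed.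

Definition norm3 F : R := \sum_i rn (cpt F i).

Lemma norm3_ge0 F : 0 <= norm3 F.
Proof. by apply: sumr_ge0 => i _; exact: rn_ge0. Qed.

Lemma norm3D F G : norm3 (F + G) <= norm3 F + norm3 G.
Proof.
by rewrite /norm3 -big_split /=; apply: ler_sum => i _; rewrite cptD rnD.
Qed.

Lemma norm3Z (a : C) F : norm3 (a *: F) = rn a * norm3 F.
Proof.
by rewrite /norm3 mulr_sumr; apply: eq_bigr => i _; rewrite cptZ rnZ.
Qed.

Lemma norm3N F : norm3 (- F) = norm3 F.
Proof. by rewrite -scaleN1r norm3Z rnN rn1 mul1r. Qed.

Lemma norm3BC F G : norm3 (F - G) = norm3 (G - F).
Proof. by rewrite -norm3N opprB. Qed.

Lemma norm30 : norm3 0 = 0.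
Proof. by rewrite -(scale0r (0 : H * H * H)) norm3Z rn0 mul0r. Qed.

Lemma rn_cpt_le F i : rn (cpt F i) <= norm3 F.
Proof.
rewrite /norm3 (bigD1 i)//= lerDl; apply: sumr_ge0 => j _; exact: rn_ge0.
Qed.

Lemma norm3_eq0 F : norm3 F = 0 -> F = 0.
Proof.
move=> F0; apply: cpt_ext => i.
have : rn (cpt F i) = 0.
  by apply/eqP; rewrite eq_le rn_ge0 andbT -F0 rn_cpt_le.
by move/rn0_eq0 => ->; case: (ord3P i) => ->.
Qed.

End Triples.

Section ModalOperators.
Variables (R : realType) (H : completeNormedModType R[i]).
Variable ip : {dot H for Num.conj}.
Hypothesis ip_norm : hilbert_norm ip.
Variable e : nat -> H.
Hypothesis e_orthonormal : forall j k, ip (e j) (e k) = (j == k)%:R.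
Hypothesis e_total : forall x : H, (forall k, ip x (e k) = 0) -> x = 0.
Local Notation C := R[i].
Local Notation fcoef := (fcoef ip e).
Local Notation diag := (diag ip e).
Implicit Types (F G : H * H * H) (i j : 'I_3) (E : nat -> 'M[C]_3) (B : R).

Definition modal_op E F : H * H * H :=
  triple (fun i => \sum_j diag (fun k => E k i j) (cpt F j)).

Definition modal_bounded E B := forall k i j, rn (E k i j) <= B.

Lemma fcoef_modal_op E B F i k : modal_bounded E B ->
  fcoef (cpt (modal_op E F) i) k = \sum_j E k i j * fcoef (cpt F j) k.
Proof.
move=> hE; rewrite cpt_triple fcoef_sum; apply: eq_bigr => j _.
by rewrite (fcoef_diag ip_norm e_orthonormal (B := B)).
Qed.

Lemma fcoef_cpt_ext F G :
  (forall i k, fcoef (cpt F i) k = fcoef (cpt G i) k) -> F = G.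
Proof. by move=> h; apply: cpt_ext => i; exact/(fcoef_ext e_total). Qed.

Lemma norm3_modal_op E B F : modal_bounded E B ->
  norm3 (modal_op E F) <= 3 * B * norm3 F.
Proof.
move=> hE; apply: le_trans (_ : \sum_(i < 3) B * norm3 F <= _).
  apply: ler_sum => i _; rewrite cpt_triple /norm3 mulr_sumr.
  apply: le_trans (rn_sum _ _ _) _; apply: ler_sum => j _.
  by apply: (rn_diag ip_norm e_orthonormal e_total) => k; exact: hE.
by rewrite sumr_const card_ord -[leLHS]mulr_natl mulrA.
Qed.

Lemma modal_op_linear E B (a : C) F G : modal_bounded E B ->
  modal_op E (a *: F + G) = a *: modal_op E F + modal_op E G.
Proof.
move=> hE; apply: fcoef_cpt_ext => i k.
rewrite cpt_linear fcoefD fcoefZ !(fcoef_modal_op _ _ _ hE) mulr_sumr -big_split.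
by apply: eq_bigr => j _ /=; rewrite cpt_linear fcoefD fcoefZ; ring.
Qed.

Lemma modal_op_comp E E' B B' F : modal_bounded E B -> modal_bounded E' B' ->
  modal_bounded (fun k => E k * E' k) (3 * (B * B')) /\
  modal_op (fun k => E k * E' k) F = modal_op E (modal_op E' F).
Proof.
move=> hE hE'.
have hEE' : modal_bounded (fun k => E k * E' k) (3 * (B * B')).
  move=> k i j; rewrite mxE; apply: le_trans (rn_sum _ _ _) _.
  apply: le_trans (_ : \sum_(l < 3) B * B' <= _).
    by apply: ler_sum => l _; rewrite rnM; apply: ler_pM; rewrite ?rn_ge0.
  by rewrite sumr_const card_ord -[leLHS]mulr_natl.
split=> //; apply: fcoef_cpt_ext => i k.
rewrite (fcoef_modal_op _ _ _ hEE') (fcoef_modal_op _ _ _ hE).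
under [RHS]eq_bigr do rewrite (fcoef_modal_op _ _ _ hE') mulr_sumr.
rewrite exchange_big /=; apply: eq_bigr => j _.
by rewrite mxE mulr_suml; apply: eq_bigr => l _; rewrite mulrA.
Qed.

Lemma modal_op1 E F : (forall k, E k = 1) -> modal_op E F = F.
Proof.
move=> E1; have hE : modal_bounded E 1.
  move=> k i j; rewrite E1 mxE; case: (i == j); first by rewrite rn1.
  by rewrite rn0.
apply: fcoef_cpt_ext => i k; rewrite (fcoef_modal_op _ _ _ hE) E1.
rewrite (bigD1 i)//= mxE eqxx mul1r big1 ?addr0// => j ji.
by rewrite mxE eq_sym (negbTE ji) mul0r.
Qed.

Lemma modal_op_affine E E' E'' B B' B'' (a b : C) F : modal_bounded E B ->
  modal_bounded E' B' -> modal_bounded E'' B'' ->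
  (forall k i j, E'' k i j = a * E k i j + b * E' k i j) ->
  modal_op E'' F = a *: modal_op E F + b *: modal_op E' F.
Proof.
move=> hE hE' hE'' EE; apply: fcoef_cpt_ext => i k.
rewrite cptD !cptZ fcoefD !fcoefZ (fcoef_modal_op _ _ _ hE).
rewrite (fcoef_modal_op _ _ _ hE') (fcoef_modal_op _ _ _ hE'') !mulr_sumr -big_split.
by apply: eq_bigr => j _ /=; rewrite EE; ring.
Qed.

Lemma modal_op_tail F (eps : R) : 0 < eps -> exists n, forall E B,
  modal_bounded E B -> norm3 (modal_op E F) <=
  (\sum_(0 <= k < n) \sum_i \sum_j rn (E k i j)) * norm3 F + 9 * B * eps.
Proof.
move=> eps0.
have [N hN] : exists N : 'I_3 -> nat, forall j (m : nat -> C) B,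
    (forall k, rn (m k) <= B) -> rn (diag m (cpt F j)) <=
    (\sum_(0 <= k < N j) rn (m k)) * rn (cpt F j) + B * eps.
  have h j := diag_tail ip_norm e_orthonormal e_total (cpt F j) eps0.
  by exists (fun j => projT1 (cid (h j))) => j; exact: (projT2 (cid (h j))).
exists (\max_j N j) => E B hE.
have B0 : 0 <= B := le_trans (rn_ge0 _) (hE 0%N i0 i0).
pose S i j := \sum_(0 <= k < \max_j N j) rn (E k i j).
apply: le_trans (_ : \sum_i \sum_j (S i j * norm3 F + B * eps) <= _).
  apply: ler_sum => i _; rewrite cpt_triple.
  apply: le_trans (rn_sum _ _ _) _; apply: ler_sum => j _.
  apply: le_trans (hN j _ B (fun k => hE k i j)) _.
  rewrite lerD2r; apply: ler_pM; rewrite ?rn_ge0 ?rn_cpt_le//.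
    by apply: sumr_ge0 => k _; exact: rn_ge0.
  rewrite /S [leRHS](big_cat_nat (n := N j))//=; last exact: (leq_bigmax (F := N)).
  by rewrite lerDl; apply: sumr_ge0 => k _; exact: rn_ge0.
rewrite (eq_bigr (fun i => \sum_j (S i j * norm3 F) + (B * eps) *+ 3)); last first.
  by move=> i _; rewrite big_split /= sumr_const card_ord.
rewrite big_split /= sumr_const card_ord -mulrnA -[_ *+ _]mulr_natl mulrA.
rewrite lerD2r le_eqVlt; apply/orP; left; apply/eqP.
rewrite [in RHS]exchange_big mulr_suml; apply: eq_bigr => i _.
by rewrite [in RHS]exchange_big mulr_suml.
Qed.

End ModalOperators.

(** * The modal semigroup on a sector *)

Section Sectors.
Variable R : realType.
Local Notation C := R[i].

(** Near 0 the sine is below [kappa / 2] and the cosine above [1 / 2], so the tangent stays below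
    [kappa]. *)
Lemma sector_cone (kappa : R) : 0 < kappa -> exists delta : R,
  0 < delta <= pi / 2 /\ forall z : C, sector delta z -> cone kappa z.
Proof.
move=> k0.
have [d1 d10 h1] : exists2 d, 0 < d & forall a : R, `|a| < d -> `|sin a| < kappa / 2.
  have k20 : 0 < kappa / 2 by rewrite divr_gt0.
  have /cvgrPdist_lt/(_ _ k20)/nbhs_ballP[d d0 hd] := @continuous_sin R 0.
  exists d => // a ad; have := hd a; rewrite sin0 sub0r normrN; apply.
  by rewrite -ball_normE /ball_ /= sub0r normrN.
have [d2 d20 h2] : exists2 d, 0 < d & forall a : R, `|a| < d -> 2^-1 < cos a.
  have k20 : 0 < (2^-1 : R) by rewrite invr_gt0.
  have /cvgrPdist_lt/(_ _ k20)/nbhs_ballP[d d0 hd] := @continuous_cos R 0.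
  exists d => // a ad; have : `|cos 0 - cos a| < 2^-1.
    by apply: hd; rewrite -ball_normE /ball_ /= sub0r normrN.
  by rewrite cos0 => /(le_lt_trans (ler_norm _)) => ?; lra.
exists (Num.min (Num.min d1 d2) (pi / 2)); split.
  by rewrite !lt_min d10 d20 divr_gt0 ?pi_gt0//= ge_min lexx orbT.
move=> _ [r [a [r0 ha ->]]].
move: ha; rewrite !lt_min => /andP[/andP[ha1 ha2] _].
have c2 := h2 _ ha2; have s2 := h1 _ ha1.
have c0 : 0 < cos a by apply: lt_trans c2; rewrite invr_gt0.
split => /=; first by rewrite mulr_gt0.
rewrite normrM (gtr0_norm r0) mulrCA ler_pM2l//.
apply: le_trans (ltW s2) _; rewrite ler_pM2l//; exact: ltW.
Qed.

Lemma near_punctured (P : C -> Prop) (rho : R) : 0 < rho ->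
  (forall h : C, h != 0 -> rn h <= rho -> P h) ->
  \forall h \near (0 : R[i]^o)^', P h.
Proof.
move=> rho0 hP; have rho0' : 0 < rho%:C :> C by rewrite ltcR.
have := nbhs0_le (V := R[i]^o) rho0'; rewrite /prop_near1.
apply: filterS => h hh h0; apply: hP => //.
by rewrite -lecR -rnE.
Qed.

Lemma cvg_within0 (D : set C) (f : C -> R) : (forall z, 0 <= f z) ->
  (forall eps : R, 0 < eps -> exists2 rho : R, 0 < rho &
     forall z, D z -> rn z <= rho -> f z <= eps) ->
  f z @[z --> within D (nbhs (0 : R[i]^o))] --> (0 : R).
Proof.
move=> f0 hf; apply/cvgrPdist_le => eps eps0.
have [rho rho0 h] := hf _ eps0.
have rho0' : 0 < rho%:C :> C by rewrite ltcR.
have := nbhs0_le (V := R[i]^o) rho0'; rewrite /prop_near1.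
apply: filterS => z hz Dz; rewrite sub0r normrN ger0_norm//; apply: h => //.
by rewrite -lecR -rnE.
Qed.

End Sectors.

Section ModalSemigroup.
Variables (R : realType) (H : completeNormedModType R[i]).
Variable ip : {dot H for Num.conj}.
Hypothesis ip_norm : hilbert_norm ip.
Variable e : nat -> H.
Hypothesis e_orthonormal : forall j k, ip (e j) (e k) = (j == k)%:R.
Hypothesis e_total : forall x : H, (forall k, ip x (e k) = 0) -> x = 0.
Local Notation C := R[i].
Implicit Types (F G : H * H * H).

Variables (lambda t r : nat -> R) (kappa K : R).
Hypothesis lambda_gt0 : forall k, 0 < lambda k.
Hypothesis kappa_gt0 : 0 < kappa.
Hypothesis K_ge0 : 0 <= K.
Hypothesis mode_bounds : forall k (z : C), 0 <= complex.Re z ->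
  `|complex.Im z| <= kappa * complex.Re z -> forall i j,
   let M := mode_mx (t k) (r k) in let G := mexp (z *: M) in
   [/\ rn (G i j) <= K, rn z * rn ((M * G) i j) <= K &
       rn z ^+ 2 * rn ((M * (M * G)) i j) <= K].

Local Notation evol := (modal_exp lambda t r).
Local Notation gen := (modal_mx lambda t r).

Definition modal_semigroup z F := modal_op ip e (fun k => evol k z) F.

Lemma evol_bounded z : cone kappa z -> modal_bounded (fun k => evol k z) K.
Proof. by move=> zk k i j; apply: (modal_exp_bound lambda_gt0 mode_bounds). Qed.

Lemma modal_semigroup_bounded z : cone kappa z ->
  bounded_operator setT (@norm3 R H) (modal_semigroup z).
Proof.
move=> /evol_bounded hz; split=> // [a F G _ _|].
  exact: (modal_op_linear ip_norm e_orthonormal e_total _ _ _ hz).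
by exists (3 * K) => F _; exact: (norm3_modal_op ip_norm e_orthonormal e_total _ hz).
Qed.

Lemma modal_semigroupD z w F : cone kappa z -> cone kappa w ->
  modal_semigroup (z + w) F = modal_semigroup z (modal_semigroup w F).
Proof.
move=> /evol_bounded hz /evol_bounded hw.
have [_ E] := modal_op_comp ip_norm e_orthonormal e_total F hz hw.
apply: etrans E; congr (modal_op _ _ _ F); apply/funext => k.
exact: modal_expD.
Qed.

Lemma modal_semigroup0 F : modal_semigroup 0 F = F.
Proof.
apply: (modal_op1 ip_norm e_orthonormal e_total) => k; exact: modal_exp0.
Qed.

Lemma cone_half z : cone (kappa / 2) z -> cone kappa z.
Proof.
move=> [z0 zk]; split=> //; apply: le_trans zk _.
by rewrite ler_wpM2r ?(ltW z0)//; have := kappa_gt0 => ?; lra.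
Qed.

(** The Taylor remainder is quadratic in [h] with one constant for all modes, so the difference
    quotients converge in operator norm and not just mode by mode. *)
Lemma modal_semigroup_holomorphic (D : set C) :
  (forall z, D z -> cone (kappa / 2) z) ->
  norm_holomorphic setT (@norm3 R H) D modal_semigroup.
Proof.
move=> hD z /hD zc.
have [rho [B [rho0 B0 hB]]] := modal_exp_taylor lambda_gt0 kappa_gt0 K_ge0
  mode_bounds zc.
have hL : modal_bounded (fun k => gen k * evol k z) B.
  by move=> k i j; have [] := hB k i j.
exists (modal_op ip e (fun k => gen k * evol k z)).
  split=> // [a F G _ _|].
    exact: (modal_op_linear ip_norm e_orthonormal e_total _ _ _ hL).
  by exists (3 * B) => F _; exact: (norm3_modal_op ip_norm e_orthonormal e_total _ hL).
move=> eps eps0; have [sigma sigma0 hs] := cone_ball kappa_gt0 zc.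
have e30 : 0 < eps / (3 * B + 1).
  by rewrite divr_gt0// ltr_wpDl// mulr_ge0.
apply: (@near_punctured _ _ (Num.min (Num.min rho sigma) (eps / (3 * B + 1)))).
  by rewrite !lt_min rho0 sigma0.
move=> h h0; rewrite !le_min => /andP[/andP[h1 h2] h3] F _.
have [zh _] := hs _ h2.
have b1 := evol_bounded zh; have b2 := evol_bounded (cone_half zc).
pose E1 k := evol k (z + h) - evol k z.
have bE1 : modal_bounded E1 (K + K).
  by move=> k i j; rewrite entryB; apply: le_trans (rnB _ _) _; apply: lerD.
pose E2 k := h^-1 *: E1 k - gen k * evol k z.
have bE2 : modal_bounded E2 (B * rn h).
  move=> k i j; have [_ /(_ h h1) hk] := hB k i j.
  rewrite !entryB entryZ.
  have -> : h^-1 * E1 k i j - (gen k * evol k z) i j =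
      h^-1 * (evol k (z + h) i j - evol k z i j - h * (gen k * evol k z) i j).
    by rewrite /E1 entryB [RHS]mulrBr (mulrA h^-1 h) mulVf ?mul1r.
  have hn : rn h != 0 by apply: contraNneq h0 => /rn0_eq0 ->.
  rewrite rnM rnV ler_pdivrMl ?lt_def ?hn ?rn_ge0//.
  by rewrite mulrCA -expr2.
have -> : h^-1 *: (modal_semigroup (z + h) F - modal_semigroup z F)
    - modal_op ip e (fun k => gen k * evol k z) F = modal_op ip e E2 F.
  rewrite (modal_op_affine (E := E1) (E' := fun k => gen k * evol k z)
    (a := h^-1) (b := -1) ip_norm e_orthonormal e_total F bE1 hL bE2); last first.
    by move=> k i j; rewrite /E2 entryB entryZ mulN1r.
  rewrite (modal_op_affine (E := fun k => evol k (z + h)) (E' := fun k => evol k z)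
    (a := 1) (b := -1) ip_norm e_orthonormal e_total F b1 b2 bE1); last first.
    by move=> k i j; rewrite /E1 entryB mulN1r mul1r.
  by rewrite scale1r !scaleN1r.
apply: le_trans (norm3_modal_op ip_norm e_orthonormal e_total F bE2) _.
apply: ler_wpM2r; first exact: norm3_ge0.
rewrite mulrA; apply: le_trans (_ : (3 * B + 1) * rn h <= _).
  by rewrite ler_wpM2r ?rn_ge0// lerDl.
by rewrite mulrC -ler_pdivlMr// ltr_wpDl// mulr_ge0.
Qed.

(** Each mode tends to the identity at its own rate, so only strong convergence is claimed: finitely
    many modes are small by [modal_exp_near0], and the tail of [F] is multiplied by at most
    [K + 1]. *)
Lemma modal_semigroup_cvg0 (D : set C) F : (forall z, D z -> cone kappa z) ->
  norm3 (modal_semigroup z F - F) @[z --> within D (nbhs (0 : R[i]^o))]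
    --> (0 : R).
Proof.
move=> hD; apply: cvg_within0 => [z|eps eps0]; first exact: norm3_ge0.
pose eps1 := eps / (18 * (K + 1)).
have K10 : 0 < 18 * (K + 1) by rewrite mulr_gt0// ltr_wpDl.
have eps10 : 0 < eps1 by rewrite divr_gt0.
have [n hn] := modal_op_tail ip_norm e_orthonormal e_total F eps10.
have [B hB] : exists B : nat -> R, forall k, 0 <= B k /\
    forall (h : C) i j, rn h <= 1 ->
    rn (evol k h i j - (1 : 'M[C]_3) i j) <= B k * rn h.
  have near0 k := modal_exp_near0 lambda t r k.
  exists (fun k => projT1 (cid2 (near0 k))) => k.
  by case: (cid2 (near0 k)) => b b0 hb.
pose BS := \sum_(0 <= k < n) 9 * B k.
have BS0 : 0 <= BS by apply: sumr_ge0 => k _; rewrite mulr_ge0//; case: (hB k).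
have F0 := norm3_ge0 F.
have D0 : 0 < BS * norm3 F + 1 by rewrite ltr_wpDl// mulr_ge0.
exists (Num.min 1 (eps / 2 / (BS * norm3 F + 1))).
  by rewrite lt_min ltr01/= !divr_gt0.
move=> z /hD zc; rewrite le_min => /andP[z1 z2].
have bz := evol_bounded zc.
have b1 : modal_bounded (fun _ : nat => (1 : 'M[C]_3)) 1.
  move=> k i j; rewrite mxE; case: (i == j); first by rewrite rn1.
  by rewrite rn0.
pose E k := evol k z - 1.
have bE : modal_bounded E (K + 1).
  move=> k i j; rewrite entryB; apply: le_trans (rnB _ _) _.
  by apply: lerD; [exact: bz|exact: b1].
have -> : modal_semigroup z F - F = modal_op ip e E F.
  rewrite (modal_op_affine (E := fun k => evol k z) (E' := fun => 1)
    (a := 1) (b := -1) ip_norm e_orthonormal e_total F bz b1 bE); last first.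
    by move=> k i j; rewrite /E entryB mulN1r mul1r.
  by rewrite scale1r scaleN1r (modal_op1 (E := fun=> 1) ip_norm
    e_orthonormal e_total).
apply: le_trans (hn _ _ bE) _.
have -> : 9 * (K + 1) * eps1 = eps / 2.
  by rewrite /eps1; field; rewrite gt_eqF// ltr_wpDl.
have sumE : \sum_(0 <= k < n) \sum_i \sum_j rn (E k i j) <= BS * rn z.
  rewrite /BS mulr_suml; apply: ler_sum => k _.
  apply: le_trans (_ : \sum_(i < 3) \sum_(j < 3) B k * rn z <= _).
    apply: ler_sum => i _; apply: ler_sum => j _; rewrite /E entryB.
    by have [_] := hB k; apply.
  by rewrite !sumr_const !card_ord -mulrnA -[leLHS]mulr_natl mulrA.
have : (\sum_(0 <= k < n) \sum_i \sum_j rn (E k i j)) * norm3 F <= eps / 2.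
  apply: le_trans (ler_wpM2r F0 sumE) _.
  move: z2; rewrite ler_pdivlMr// => z2; apply: le_trans z2.
  by rewrite mulrAC mulrC ler_wpM2l ?rn_ge0// lerDl.
by move=> ?; lra.
Qed.

End ModalSemigroup.

(** * Identification of the given semigroup *)

Section GlidingHump.
Variables (R : realType) (H : completeNormedModType R[i]).
Local Notation C := R[i].
Local Notation Y := (H * H * H)%type.
Implicit Types F G : Y.

(** Since the radii at least halve, all steps beyond [n] sum to at most [2 * r n]. The limit thus
    lies in each of the doubled balls, the ones that [hump_step] controls. *)
Lemma norm3_cauchy_limit (u : nat -> Y) (r : nat -> R) :
  (forall n, 0 < r n) -> (forall n, r n.+1 <= r n / 2) ->
  (forall n, norm3 (u n.+1 - u n) <= r n) ->
  exists F, forall n, norm3 (F - u n) <= 2 * r n.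
Proof.
move=> r0 rS uS.
have r2 n : r n <= r 0%N * 2 ^- n.
  elim: n => [|n IH]; first by rewrite expr0 invr1 mulr1.
  apply: le_trans (rS n) _; rewrite exprSr invfM mulrA ler_wpM2r// invr_ge0.
have dist n k : norm3 (u (n + k)%N - u n) <= 2 * r n - 2 * r (n + k)%N.
  elim: k => [|k IH]; first by rewrite addn0 !subrr norm30.
  rewrite addnS -(subrK (u (n + k)%N) (u _.+1)) -addrA.
  apply: le_trans (norm3D _ _) _.
  by have := uS (n + k)%N; have := rS (n + k)%N => ? ?; lra.
have distE n m : (n <= m)%N -> norm3 (u m - u n) <= 2 * r n.
  move=> nm; have := dist n (m - n)%N; rewrite subnKC// => h.
  by have := r0 m => ?; lra.
have cpt_cvg i : cvgn (fun n => cpt (u n) i).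
  apply: rn_cauchy_cvg => eps eps0.
  set n0 := Num.bound (4 * r 0%N / eps).
  have hn0 : 4 * r 0%N / eps < 2 ^+ n0.
    apply: lt_le_trans (archi_boundP _) _.
      by rewrite divr_ge0 ?mulr_ge0// ltW.
    by rewrite -natrX ler_nat ltnW// ltn_expl.
  have small : 4 * r n0 < eps.
    apply: (@le_lt_trans _ _ (4 * (r 0%N * 2 ^- n0))).
      by rewrite ler_pM2l.
    by rewrite mulrA ltr_pdivrMr ?exprn_gt0// [eps * _]mulrC -ltr_pdivrMr//.
  exists n0 => m n hm hn; rewrite -cptB.
  apply: le_lt_trans (rn_cpt_le _ _) _; apply: le_lt_trans small.
  rewrite -(subrK (u n0) (u m)) -addrA; apply: le_trans (norm3D _ _) _.
  by have := distE _ _ hm; have := distE _ _ hn; rewrite norm3BC => ? ?; lra.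
pose F : Y := triple (fun i => limn (fun n => cpt (u n) i)).
exists F => n.
have lim i : (fun m => rn (cpt (F - u m) i)) @ \oo --> (0 : R).
  have /cvg_rnP := cpt_cvg i; apply: cvg_trans; apply: near_eq_cvg.
  by near=> m; rewrite cptB cpt_triple.
have lim3 : (fun m => norm3 (F - u m)) @ \oo --> (0 : R).
  rewrite [X in X @ _ --> _](_ : _ = (fun m => rn (cpt (F - u m) i0)
    + (rn (cpt (F - u m) i1) + rn (cpt (F - u m) i2)))).
    rewrite -[X in _ --> X](addr0 0) -[X in _ --> _ + X](addr0 0).
    by apply: cvgD; [exact: lim|apply: cvgD; exact: lim].
  by apply/funext => m; rewrite /norm3 !big_ord_recl big_ord0 addr0.
rewrite -subr_le0 -(cvg_lim _ lim3)//; apply: limr_ge; first exact: cvgP lim3.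
exists n => // m /= nm.
have : norm3 (F - u n) <= norm3 (F - u m) + norm3 (u m - u n).
  by rewrite -{1}(subrK (u m) F) -addrA norm3D.
by have := distE _ _ nm => ? ?; lra.
Unshelve. all: by end_near. Qed.

Variable S : R -> Y -> Y.
Hypothesis S_C0 : C0_semigroup setT (@norm3 R H) S.

Lemma C0_linear (s : R) (a : C) F G : 0 <= s -> S s (a *: F + G) = a *: S s F + S s G.
Proof. by move=> s0; have [/(_ s s0)[_ h _] _ _ _] := S_C0; exact: h. Qed.

Lemma C0_0 s : 0 <= s -> S s 0 = 0.
Proof.
move=> s0; have := C0_linear 1 0 0 s0; rewrite !scale1r addr0 => h.
by apply: (addrI (S s 0)); rewrite addr0 -h.
Qed.

Lemma C0_Z s a F : 0 <= s -> S s (a *: F) = a *: S s F.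
Proof. by move=> s0; rewrite -[a *: F]addr0 C0_linear// C0_0// addr0. Qed.

Lemma C0_D s F G : 0 <= s -> S s (F + G) = S s F + S s G.
Proof. by move=> s0; have := C0_linear 1 F G s0; rewrite !scale1r. Qed.

Lemma C0_B s F G : 0 <= s -> S s (F - G) = S s F - S s G.
Proof. by move=> s0; rewrite C0_D// -scaleN1r C0_Z// scaleN1r. Qed.

Lemma C0_sum s (I : Type) (l : seq I) (P : pred I) (f : I -> Y) : 0 <= s ->
  S s (\sum_(i <- l | P i) f i) = \sum_(i <- l | P i) S s (f i).
Proof.
move=> s0; elim/big_rec2: _ => [|i x y _ <-]; first exact: C0_0.
exact: C0_D.
Qed.

Lemma C0_bounded s : 0 <= s ->
  exists2 M : R, 0 <= M & forall F, norm3 (S s F) <= M * norm3 F.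
Proof.
move=> s0; have [/(_ s s0)[_ _ [M hM]] _ _ _] := S_C0.
exists `|M| => // F; apply: le_trans (hM F I) _.
by rewrite ler_wpM2r ?norm3_ge0// ler_norm.
Qed.

(** If some [y] of norm [r] has an image of norm at least [n], then so has [x + y] or [x - y],
    because [2 y] is their difference. Continuity of the single operator [S s] then keeps images
    above [n - 1] on a small ball around the chosen point. *)
Lemma hump_step (n : nat) :
  ~ (exists d M : R, 0 < d /\ forall s F, 0 <= s <= d ->
       norm3 (S s F) <= M * norm3 F) ->
  forall (x : Y) (r : R), 0 < r -> exists x' r' s,
  [/\ norm3 (x' - x) <= r, 0 < r', r' <= r / 2, 0 <= s <= n.+1%:R^-1 &
    forall z, norm3 (z - x') <= 2 * r' -> n%:R - 1 <= norm3 (S s z)].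
Proof.
move=> unb x r r0.
have [s [G [sn big]]] : exists s G, 0 <= s <= n.+1%:R^-1 /\
    n%:R / r * norm3 G < norm3 (S s G).
  apply: contrapT => h; apply: unb; exists n.+1%:R^-1, (n%:R / r).
  split; first by rewrite invr_gt0.
  move=> s F hs; rewrite leNgt; apply/negP => hF; apply: h.
  by exists s, F.
have s0 : 0 <= s by case/andP: sn.
have G0 : 0 < norm3 G.
  rewrite lt_def norm3_ge0 andbT; apply/negP => /eqP/norm3_eq0 GE.
  by move: big; rewrite GE C0_0// norm30 mulr0 ltxx.
pose y := (r / norm3 G)%:C *: G.
have rG : 0 <= r / norm3 G by rewrite divr_ge0// ltW.
have ny : norm3 y = r by rewrite norm3Z rn_real ger0_norm// divfK// gt_eqF.
have Sy : n%:R <= norm3 (S s y).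
  rewrite C0_Z// norm3Z rn_real ger0_norm// mulrAC ler_pdivlMr//.
  by move: (ltW big); rewrite mulrAC ler_pdivrMr// [norm3 _ * r]mulrC.
have [x' [xx' Sx']] : exists x', norm3 (x' - x) <= r /\ n%:R <= norm3 (S s x').
  have : norm3 (S s y) *+ 2 <= norm3 (S s (x + y)) + norm3 (S s (x - y)).
    rewrite -mulr_natl -[X in X * _]gtr0_norm// -rn_real -norm3Z -C0_Z//.
    rewrite (_ : _ *: y = (x + y) - (x - y)); last first.
      by rewrite opprB addrC subrKA rmorph_nat scaler_nat mulr2n.
    by rewrite C0_B//; apply: le_trans (norm3D _ _) _; rewrite norm3N.
  have [h|h] := leP n%:R (norm3 (S s (x + y))).
    by move=> _; exists (x + y); rewrite addrAC subrr add0r ny.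
  move=> h2; exists (x - y); rewrite addrAC subrr add0r norm3N ny; split=> //.
  by move: h2; rewrite mulr2n => ?; lra.
have [M M0 hM] := C0_bounded s0.
have M1 : 0 < 2 * (M + 1) by rewrite mulr_gt0// ltr_wpDl.
(* The second radius keeps [S s] from moving by more than 1 on the ball of radius [2 * r']. *)
exists x', (Num.min (r / 2) (2 * (M + 1))^-1), s; split=> //.
- by rewrite lt_min divr_gt0//= invr_gt0.
- by rewrite ge_min lexx.
move=> z hz.
have hz' : norm3 (z - x') <= (M + 1)^-1.
  apply: le_trans hz _.
  apply: le_trans (_ : 2 * (2 * (M + 1))^-1 <= _).
    by rewrite ler_pM2l// ge_min lexx orbT.
  by rewrite invfM mulrA divff// mul1r.
have : norm3 (S s (z - x')) <= 1.
  apply: le_trans (hM _) _; apply: le_trans (_ : M * (M + 1)^-1 <= _).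
    by rewrite ler_wpM2l.
  by rewrite ler_pdivrMr ?ltr_wpDl// mul1r lerDl.
have : norm3 (S s x') <= norm3 (S s z) + norm3 (S s (z - x')).
  rewrite -(norm3N (S s (z - x'))) C0_B//.
  by apply: le_trans (norm3D _ _); rewrite opprB addrC subrK.
by move=> ? ?; lra.
Qed.

(** Otherwise the humps accumulate at one [F] with [S s F] arbitrarily large at times tending to 0,
    against continuity of that orbit at 0. *)
Lemma C0_bounded_near0 : exists d M : R, 0 < d /\ forall s F, 0 <= s <= d ->
  norm3 (S s F) <= M * norm3 F.
Proof.
apply: contrapT => unb.
have step n (x : {p : Y * R | 0 < p.2}) : {y : {p : Y * R | 0 < p.2} * R |
    [/\ norm3 ((sval y.1).1 - (sval x).1) <= (sval x).2,
        (sval y.1).2 <= (sval x).2 / 2, 0 <= y.2 <= n.+1%:R^-1 &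
    forall z, norm3 (z - (sval y.1).1) <= 2 * (sval y.1).2 ->
      n%:R - 1 <= norm3 (S y.2 z)]}.
  apply: cid; case: x => -[x r] /= r0.
  have [x' [r' [s [h1 h2 h3 h4 h5]]]] := @hump_step n unb x r r0.
  by exists (exist (fun p : Y * R => 0 < p.2) (x', r') h2, s).
(* The positive radius travels with its proof, since [hump_step] requires it at every stage. *)
pose u := fix u n := match n with
  | 0%N => exist (fun p : Y * R => 0 < p.2) (0, 1) (ltr01 : 0 < (0 : Y, 1 : R).2)
  | m.+1 => (sval (step m (u m))).1 end.
have uP n := svalP (step n (u n)).
have [F hF] := @norm3_cauchy_limit (fun n => (sval (u n)).1)
  (fun n => (sval (u n)).2) (fun n => svalP (u n))
  (fun n => let: And4 _ h _ _ := uP n in h)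
  (fun n => let: And4 h _ _ _ := uP n in h).
have large n : exists s, 0 <= s <= n.+1%:R^-1 /\ n%:R - 1 <= norm3 (S s F).
  exists (sval (step n (u n))).2; have [_ _ h1 h2] := uP n.
  by split=> //; apply: h2; exact: hF n.+1.
have [_ S0 _ cont] := S_C0.
have /cvgrPdist_lt/(_ _ ltr01) := cont F I.
rewrite /prop_near1 /at_right /within /= => /nbhs_ballP[d d0 hd].
set N := (Num.bound (d^-1) + Num.bound (norm3 F + 2)).+1.
have hN1 : d^-1 < N%:R.
  apply: lt_le_trans (archi_boundP _) _; first by rewrite invr_ge0 ltW.
  by rewrite ler_nat /N; apply: leqW; exact: leq_addr.
have hN2 : norm3 F + 2 < N%:R.
  apply: lt_le_trans (archi_boundP _) _; first by rewrite addr_ge0// norm3_ge0.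
  by rewrite ler_nat /N; apply: leqW; exact: leq_addl.
have [s [/andP[s0 sN] Sbig]] := large N.
(* Convergence from the right says nothing at time 0 itself, where [S] is the identity and [N]
   exceeds [norm3 F + 2]. *)
have [sE|sN0] := eqVneq s 0.
  by move: Sbig; rewrite sE S0// => ?; lra.
have sd : s < d.
  apply: le_lt_trans sN _; rewrite -[d]invrK ltf_pV2 ?posrE ?invr_gt0//.
  by apply: lt_le_trans hN1 _; rewrite ler_nat.
have s0' : 0 < s by rewrite lt_def sN0.
have := hd s; rewrite -ball_normE /ball_ /= sub0r normrN ger0_norm// => /(_ sd s0').
rewrite sub0r normrN ger0_norm ?norm3_ge0// => hS.
have : norm3 (S s F) <= norm3 (S s F - F) + norm3 F.
  by rewrite -{1}(subrK F (S s F)) norm3D.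
by move=> ?; lra.
Qed.

Lemma C0_bounded_interval (b : R) : exists2 M : R, 0 <= M &
  forall s F, 0 <= s <= b -> norm3 (S s F) <= M * norm3 F.
Proof.
have [d [M [d0 hM]]] := C0_bounded_near0; have [_ S0 SD _] := S_C0.
have iter_bound m s F : 0 <= s <= d ->
    norm3 (S (m%:R * s) F) <= (`|M| + 1) ^+ m * norm3 F.
  move=> sd; have s0 : 0 <= s by case/andP: sd.
  elim: m => [|m IH]; first by rewrite mul0r S0// expr0 mul1r.
  rewrite -natr1 mulrDl mul1r addrC SD// ?mulr_ge0//.
  apply: le_trans (hM _ _ sd) _.
  apply: le_trans (_ : (`|M| + 1) * norm3 (S (m%:R * s) F) <= _).
    by rewrite ler_wpM2r ?norm3_ge0// (le_trans (ler_norm _))// lerDl.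
  by rewrite exprS -mulrA ler_wpM2l// addr_ge0.
set m := (Num.bound (`|b| / d)).+1.
have m0 : 0 < m%:R :> R by rewrite ltr0n.
exists ((`|M| + 1) ^+ m); first by rewrite exprn_ge0// addr_ge0.
move=> s F /andP[s0 sb]; have := iter_bound m (s / m%:R) F.
rewrite mulrCA divff ?mulr1 ?gt_eqF//; apply.
rewrite divr_ge0 ?(ltW m0)//= ler_pdivrMr//.
rewrite mulrC -ler_pdivrMr//; apply: le_trans (_ : `|b| / d <= _).
  by rewrite ler_wpM2r ?invr_ge0 ?(ltW d0)// (le_trans sb)// ler_norm.
apply: le_trans (ltW (archi_boundP _)) _; first by rewrite divr_ge0// ltW.
by rewrite ler_nat /m leqnSn.
Qed.

End GlidingHump.

(** * Agreement of the given semigroup with the modal one *)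

Section Identification.
Variables (R : realType) (H : completeNormedModType R[i]).
Variable ip : {dot H for Num.conj}.
Hypothesis ip_norm : hilbert_norm ip.
Variable e : nat -> H.
Hypothesis e_orthonormal : forall j k, ip (e j) (e k) = (j == k)%:R.
Hypothesis e_total : forall x : H, (forall k, ip x (e k) = 0) -> x = 0.
Local Notation C := R[i].
Local Notation Y := (H * H * H)%type.
Implicit Types (F G : Y).

Variables (lambda t r : nat -> R) (kappa K : R).
Hypothesis lambda_gt0 : forall k, 0 < lambda k.
Hypothesis kappa_gt0 : 0 < kappa.
Hypothesis K_ge0 : 0 <= K.
Hypothesis mode_bounds : forall k (z : C), 0 <= complex.Re z ->
  `|complex.Im z| <= kappa * complex.Re z -> forall i j,
   let M := mode_mx (t k) (r k) in let G := mexp (z *: M) in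
   [/\ rn (G i j) <= K, rn z * rn ((M * G) i j) <= K &
       rn z ^+ 2 * rn ((M * (M * G)) i j) <= K].

Local Notation evol := (modal_exp lambda t r).
Local Notation gen := (modal_mx lambda t r).
Local Notation T := (modal_semigroup ip e lambda t r).

Definition mode k (l : 'I_3) : Y := triple (fun i => (i == l)%:R *: e k).

Definition gen_mode k (l : 'I_3) : Y := triple (fun i => gen k i l *: e k).

Lemma rn_basis k : rn (e k) = 1.
Proof.
apply/eqP; rewrite -(@eqrXn2 _ 2) ?rn_ge0// expr1n; apply/eqP/complexI.
by rewrite -(ip_rn ip_norm) e_orthonormal eqxx.
Qed.

Lemma norm3_basis k (c : 'I_3 -> C) :
  norm3 (triple (fun i => c i *: e k)) = \sum_i rn (c i).
Proof.
by apply: eq_bigr => i _; rewrite cpt_triple rnZ rn_basis mulr1.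
Qed.

Lemma modal_op_mode E B k l : modal_bounded E B ->
  modal_op ip e E (mode k l) = triple (fun i => E k i l *: e k).
Proof.
move=> hE; apply: (fcoef_cpt_ext e_total) => i m.
rewrite (fcoef_modal_op ip_norm e_orthonormal _ _ _ hE) (bigD1 l)//= big1.
  rewrite addr0 !cpt_triple eqxx scale1r fcoefZ (fcoef_basis e_orthonormal).
  by case: (eqVneq k m) => [->//|_]; rewrite !mulr0.
by move=> j jl; rewrite cpt_triple (negbTE jl) scale0r fcoef0 mulr0.
Qed.

Lemma triple_mode k (c : 'I_3 -> C) :
  triple (fun i => c i *: e k) = \sum_l c l *: mode k l.
Proof.
rewrite !big_ord_recl big_ord0 addr0; apply: cpt_ext => i.
rewrite !cptD !cptZ !cpt_triple.
case: (ord3P i) => ->; rewrite /i0 /i1 /i2 /=.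
- by rewrite scale1r !scale0r !scaler0 !addr0.
- by rewrite scale1r !scale0r !scaler0 addr0 add0r.
by rewrite scale1r !scale0r !scaler0 !add0r.
Qed.

(** Time 0 lies outside the open cone and contributes the identity, whence [K + 1]. *)
Lemma evol_real_bounded (s : R) : 0 <= s ->
  modal_bounded (fun k => evol k s%:C) (K + 1).
Proof.
have K0 := K_ge0.
rewrite le_eqVlt => /predU1P[<-|s0] k i j.
  rewrite modal_exp0 mxE; apply: le_trans (_ : 1 <= _); last by lra.
  by case: (i == j); [rewrite rn1|rewrite rn0].
apply: le_trans (_ : K <= _); last by lra.
apply: (modal_exp_bound lambda_gt0 mode_bounds); split => //=.
by rewrite normr0 mulr_ge0// ltW.
Qed.

Lemma T_real_D (s u : R) F : 0 <= s -> 0 <= u ->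
  T (s + u)%:C F = T s%:C (T u%:C F).
Proof.
move=> /evol_real_bounded hs /evol_real_bounded hu.
have [_ E] := modal_op_comp ip_norm e_orthonormal e_total F hs hu.
apply: etrans E; congr (modal_op _ _ _ F); apply/funext => k.
by rewrite -modal_expD -rmorphD.
Qed.

Lemma T_mode (s : R) k l : 0 <= s ->
  T s%:C (mode k l) = \sum_i evol k s%:C i l *: mode k i.
Proof.
by move=> /evol_real_bounded hs; rewrite -triple_mode -(modal_op_mode _ _ hs).
Qed.

Lemma T_generator k : exists B : R, 0 <= B /\ forall (h : R) l, 0 <= h <= 1 ->
  norm3 (T h%:C (mode k l) - mode k l - h%:C *: gen_mode k l) <= B * h ^+ 2.
Proof.
have [a hA] := bounded_mx_exists (gen k).
exists (3 * (expR (rn (0 : C) * a) * (a ^+ 2 * expR (1 * a)))); split.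
  have e1 := expR_ge0 (rn (0 : C) * a); have e2 := expR_ge0 (1 * a).
  by do 3!apply: mulr_ge0 => //; exact: sqr_ge0.
move=> h l /andP[h0 h1].
have hr : rn (h%:C : C) = h by rewrite rn_real ger0_norm.
have h1' : rn (h%:C : C) <= 1 by rewrite hr.
rewrite /modal_semigroup (modal_op_mode _ _ (evol_real_bounded h0)).
rewrite (_ : _ - _ - _ = triple (fun i => (evol k h%:C i l - (1 : 'M[C]_3) i l
   - h%:C * gen k i l) *: e k)); last first.
  apply: cpt_ext => i; rewrite !cptB cptZ !cpt_triple !scalerBl scalerA.
  have -> : (1 : 'M[C]_3) i l = (i == l)%:R by rewrite mxE.
  by [].
rewrite norm3_basis.
apply: le_trans (_ : \sum_(i < 3) expR (rn (0 : C) * a) *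
   (a ^+ 2 * expR (1 * a)) * h ^+ 2 <= _).
  apply: ler_sum => i _.
  have := bounded_mx_entry i l (mexp_increment 0 hA h1').
  by rewrite add0r scale0r mexp0 mulr1 hr !entryB entryZ.
by rewrite sumr_const card_ord -[leLHS]mulr_natl !mulrA.
Qed.

Variable S : R -> Y -> Y.
Hypothesis S_C0 : C0_semigroup setT (@norm3 R H) S.
Hypothesis S_gen : forall k l,
  norm3 ((h^-1)%:C *: (S h (mode k l) - mode k l) - gen_mode k l)
    @[h --> 0^'+] --> (0 : R).

Lemma S_T_infinitesimal k (eps : R) : 0 < eps -> exists2 eta : R, 0 < eta &
  forall h l, 0 < h -> h < eta ->
    norm3 (S h (mode k l) - T h%:C (mode k l)) <= h * eps.
Proof.
move=> eps0; have [B [B0 hB]] := T_generator k.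
have eps20 : 0 < eps / 2 by rewrite divr_gt0.
have [d hd] : exists d : 'I_3 -> R, forall l, 0 < d l /\ forall h, 0 < h -> h < d l ->
    norm3 ((h^-1)%:C *: (S h (mode k l) - mode k l) - gen_mode k l) <= eps / 2.
  have near l : exists d : R, 0 < d /\ forall h, 0 < h -> h < d ->
    norm3 ((h^-1)%:C *: (S h (mode k l) - mode k l) - gen_mode k l) <= eps / 2.
    have /cvgrPdist_le/(_ _ eps20) := S_gen k l.
    rewrite /prop_near1 /at_right /within /= => /nbhs_ballP[d d0 hd].
    exists d; split=> // h h0 hd'; have := hd h.
    rewrite -ball_normE /ball_ /= sub0r normrN gtr0_norm// => /(_ hd' h0).
    by rewrite sub0r normrN ger0_norm// norm3_ge0.
  by exists (fun l => projT1 (cid (near l))) => l; exact: (projT2 (cid (near l))).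
pose eta := Num.min (Num.min (Num.min (d i0) (d i1)) (d i2))
  (Num.min 1 (eps / 2 / (B + 1))).
have B10 : 0 < B + 1 by rewrite ltr_wpDl.
exists eta.
  rewrite /eta !lt_min ltr01 divr_gt0//.
  by have [-> _] := hd i0; have [-> _] := hd i1; have [-> _] := hd i2.
move=> h l h0; rewrite /eta !lt_min => /andP[/andP[/andP[h00 h11] h22] /andP[h1 he]].
have hdl : h < d l by case: (ord3P l) => ->.
have [_ /(_ h h0 hdl) hS] := hd l.
have hT := hB h l; rewrite (ltW h0) (ltW h1) in hT.
have -> : S h (mode k l) - T h%:C (mode k l) =
    h%:C *: ((h^-1)%:C *: (S h (mode k l) - mode k l) - gen_mode k l)
    - (T h%:C (mode k l) - mode k l - h%:C *: gen_mode k l).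
  rewrite scalerBr scalerA -rmorphM /= divff ?gt_eqF// scale1r.
  set x := S h _; set y := modal_semigroup _ _ _ _ _ _ _; set g := h%:C *: _.
  set m := mode k l.
  by rewrite opprB addrA subrK opprB addrA subrK.
apply: le_trans (norm3D _ _) _; rewrite norm3N norm3Z rn_real gtr0_norm//.
have : h * norm3 ((h^-1)%:C *: (S h (mode k l) - mode k l) - gen_mode k l)
    <= h * (eps / 2) by rewrite ler_pM2l.
have : B * h ^+ 2 <= h * (eps / 2).
  rewrite expr2 mulrCA ler_pM2l//; apply: le_trans (_ : (B + 1) * h <= _).
    by rewrite ler_pM2r// lerDl.
  by rewrite mulrC -ler_pdivlMr// ltW.
by have := hT isT => ? ? ?; lra.
Qed.

(** Stability and consistency: over [N] steps of length [h = s / N] the local errors are of size [h]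
    times an arbitrarily small number, and [S], bounded on [[0, s]], transports them. Their sum is
    of size [s] times that number. *)
Lemma S_eq_T_mode k l (s : R) : 0 <= s -> S s (mode k l) = T s%:C (mode k l).
Proof.
rewrite le_eqVlt => /predU1P[<-|s0].
  have [_ -> // _ _] := S_C0; rewrite modal_semigroup0//.
apply/eqP; rewrite -subr_eq0; apply/eqP/norm3_eq0/eqP.
rewrite eq_le norm3_ge0 andbT.
have [M M0 hM] := C0_bounded_interval S_C0 s.
have K0 := K_ge0; have K10 : 0 <= K + 1 by lra.
pose c := s * (M * (3 * (K + 1))).
have c0 : 0 <= c by rewrite mulr_ge0 ?(ltW s0)// mulr_ge0// mulr_ge0.
apply/ler_addgt0Pl => eps eps0; rewrite addr0.
have e10 : 0 < eps / (c + 1) by rewrite divr_gt0// ltr_wpDl.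
have [eta eta0 hS] := S_T_infinitesimal k e10.
set N := (Num.bound (s / eta)).+1; pose h := s / N%:R.
have N0 : 0 < N%:R :> R by rewrite ltr0n.
have h0 : 0 < h by rewrite divr_gt0.
have heta : h < eta.
  rewrite ltr_pdivrMr// mulrC -ltr_pdivrMr//.
  apply: lt_le_trans (archi_boundP _) _; first by rewrite divr_ge0 ?ltW.
  by rewrite ler_nat leqnSn.
have [_ S0 SD _] := S_C0.
(* [T] keeps the three modes of index [k] among themselves, with coefficients at most [K + 1]; so
   the first-order comparison at time 0 applies at every step. *)
have step (j : nat) :
    norm3 (S h (T (j%:R * h)%:C (mode k l)) - T (j.+1%:R * h)%:C (mode k l))
    <= 3 * (K + 1) * (h * (eps / (c + 1))).
  have jh : 0 <= j%:R * h by rewrite mulr_ge0// ltW.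
  have -> : j.+1%:R * h = h + j%:R * h by rewrite -natr1 mulrDl mul1r addrC.
  rewrite T_real_D ?(ltW h0)// T_mode//.
  rewrite (C0_sum S_C0) ?(ltW h0)//.
  have TS (c' : 'I_3 -> C) : T h%:C (\sum_i c' i *: mode k i) =
      \sum_i c' i *: T h%:C (mode k i).
    have lin a F1 F2 : T h%:C (a *: F1 + F2) = a *: T h%:C F1 + T h%:C F2.
      exact: (modal_op_linear ip_norm e_orthonormal e_total a F1 F2
        (evol_real_bounded (ltW h0))).
    have T0 : T h%:C 0 = 0.
      by have := lin (-1) 0 0; rewrite scaler0 addr0 scaleN1r addNr.
    have TD F1 F2 : T h%:C (F1 + F2) = T h%:C F1 + T h%:C F2.
      by have := lin 1 F1 F2; rewrite !scale1r.
    rewrite (big_morph (T h%:C) TD T0); apply: eq_bigr => i _.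
    by have := lin (c' i) (mode k i) 0; rewrite !addr0 T0 addr0 => ->.
  rewrite TS -sumrB.
  apply: le_trans (_ : \sum_(i < 3) (K + 1) * (h * (eps / (c + 1))) <= _).
    rewrite !big_ord_recl !big_ord0 !addr0.
    have term i : norm3 (S h (evol k (j%:R * h)%:C i l *: mode k i) -
        evol k (j%:R * h)%:C i l *: T h%:C (mode k i)) <=
        (K + 1) * (h * (eps / (c + 1))).
      rewrite (C0_Z S_C0) ?(ltW h0)// -scalerBr norm3Z; apply: ler_pM; rewrite ?rn_ge0 ?norm3_ge0//.
        exact: evol_real_bounded.
      exact: hS.
    apply: le_trans (norm3D _ _) _; apply: lerD; first exact: term.
    by apply: le_trans (norm3D _ _) _; apply: lerD; exact: term.
  by rewrite sumr_const card_ord -[leLHS]mulr_natl mulrA.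
(* [j] is generalized because each induction step trades one application of [S h] for an increment
   of the time of [T]. *)
have telescope n : (n <= N)%N -> forall j : nat,
    norm3 (S (n%:R * h) (T (j%:R * h)%:C (mode k l))
           - T ((j + n)%:R * h)%:C (mode k l))
    <= n%:R * (M * (3 * (K + 1) * (h * (eps / (c + 1))))).
  elim: n => [_ j|n IH nN j].
    by rewrite !mul0r addn0 S0// subrr norm30.
  have nh : 0 <= n%:R * h by rewrite mulr_ge0// ltW.
  have nhs : 0 <= n%:R * h <= s.
    rewrite nh /= /h mulrA ler_pdivrMr// mulrC ler_pM2l//.
    by rewrite ler_nat ltnW.
  have -> : n.+1%:R * h = n%:R * h + h by rewrite -natr1 mulrDl mul1r.
  rewrite SD// ?(ltW h0)//.
  set X := S h _; set Z := modal_semigroup _ _ _ _ _ _ _.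
  have stepj := step j; rewrite -/X in stepj.
  set W := modal_semigroup _ _ _ _ _ (j.+1%:R * h)%:C _ in stepj.
  have -> : S (n%:R * h) X - Z = S (n%:R * h) (X - W) + (S (n%:R * h) W - Z).
    by rewrite (C0_B S_C0)// addrA subrK.
  apply: le_trans (norm3D _ _) _.
  rewrite -[n.+1%:R]natr1 mulrDl mul1r [leRHS]addrC; apply: lerD.
    by apply: le_trans (hM _ _ nhs) _; rewrite ler_wpM2l.
  by have := IH (ltnW nN) j.+1; rewrite addSnnS.
have := telescope N (leqnn N) 0%N.
rewrite mul0r modal_semigroup0// add0n.
have -> : N%:R * h = s by rewrite /h mulrCA divff ?mulr1// gt_eqF.
move/le_trans; apply.
have -> : N%:R * (M * (3 * (K + 1) * (h * (eps / (c + 1))))) =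
    c * (eps / (c + 1)).
  by rewrite /c /h; field; rewrite !gt_eqF// ltr_wpDl.
by rewrite mulrCA ger_pMr// ler_pdivrMr ?ltr_wpDl// mul1r lerDl.
Qed.

(** Density: both operators are bounded at the fixed time [s] and agree on the truncated Fourier
    sums of [F]. *)
Lemma S_eq_T (s : R) F : 0 <= s -> S s F = T s%:C F.
Proof.
move=> s0; apply/eqP; rewrite -subr_eq0; apply/eqP/norm3_eq0/eqP.
rewrite eq_le norm3_ge0 andbT.
have [M M0 hM] := C0_bounded S_C0 s0.
have hE := evol_real_bounded s0.
have K0 := K_ge0; have K10 : 0 <= 3 * (K + 1) by lra.
apply/ler_addgt0Pl => eps eps0; rewrite addr0.
pose c := M + 3 * (K + 1).
have c0 : 0 <= c by rewrite addr_ge0.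
have e10 : 0 < eps / (3 * (c + 1)) by rewrite divr_gt0// mulr_gt0// ltr_wpDl.
have [n hn] : exists n, forall i, rn (cpt F i -
    series (fun k => fcoef ip e (cpt F i) k *: e k) n) <= eps / (3 * (c + 1)).
  have near i := @expand_cvg R H ip ip_norm e e_orthonormal e_total (cpt F i).
  have nearn i : exists n0, forall n, (n0 <= n)%N -> rn (cpt F i -
    series (fun k => fcoef ip e (cpt F i) k *: e k) n) <= eps / (3 * (c + 1)).
    have /cvg_rnP/cvgrPdist_le/(_ _ e10)[n0 _ hn0] := near i.
    exists n0 => n n0n; have := hn0 n n0n.
    by rewrite sub0r normrN ger0_norm// rn_ge0.
  exists (\max_i projT1 (cid (nearn i))) => i.
  apply: (projT2 (cid (nearn i))).
  exact: (leq_bigmax (F := fun i => projT1 (cid (nearn i)))).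
pose G : Y := \sum_(0 <= k < n) \sum_l fcoef ip e (cpt F l) k *: mode k l.
have cptG i : cpt G i = series (fun k => fcoef ip e (cpt F i) k *: e k) n.
  have cpt_sum (u : nat -> Y) m : cpt (\sum_(0 <= k < m) u k) i =
      \sum_(0 <= k < m) cpt (u k) i.
    elim: m => [|m IH]; first by rewrite !big_nil; case: (ord3P i) => ->.
    by rewrite !big_nat_recr//= cptD IH.
  rewrite /G cpt_sum /series /=; apply: eq_bigr => k _.
  by rewrite -triple_mode cpt_triple.
have ST : S s G = T s%:C G.
  have lin a F1 F2 : T s%:C (a *: F1 + F2) = a *: T s%:C F1 + T s%:C F2.
    exact: (modal_op_linear ip_norm e_orthonormal e_total a F1 F2 hE).
  have T0 : T s%:C 0 = 0 by have := lin (-1) 0 0; rewrite scaler0 addr0 scaleN1r addNr.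
  have TD F1 F2 : T s%:C (F1 + F2) = T s%:C F1 + T s%:C F2.
    by have := lin 1 F1 F2; rewrite !scale1r.
  rewrite /G (C0_sum S_C0)// (big_morph (T s%:C) TD T0).
  apply: eq_bigr => k _; rewrite (C0_sum S_C0)// (big_morph (T s%:C) TD T0).
  apply: eq_bigr => l _; rewrite (C0_Z S_C0)// S_eq_T_mode//.
  by have := lin (fcoef ip e (cpt F l) k) (mode k l) 0; rewrite !addr0 T0 addr0 => ->.
have FG : norm3 (F - G) <= eps / (c + 1).
  apply: le_trans (_ : \sum_(i < 3) eps / (3 * (c + 1)) <= _).
    by apply: ler_sum => i _; rewrite cptB cptG; exact: hn.
  rewrite sumr_const card_ord -[leLHS]mulr_natl le_eqVlt; apply/orP; left.
  by apply/eqP; field; rewrite gt_eqF// ltr_wpDl.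
have -> : S s F - T s%:C F = S s (F - G) - T s%:C (F - G).
  have lin a F1 F2 : T s%:C (a *: F1 + F2) = a *: T s%:C F1 + T s%:C F2.
    exact: (modal_op_linear ip_norm e_orthonormal e_total a F1 F2 hE).
  have -> : T s%:C (F - G) = T s%:C F - T s%:C G.
    by rewrite [F - G]addrC -[- G]scaleN1r lin scaleN1r addrC.
  by rewrite (C0_B S_C0)// ST opprB addrA subrK.
apply: le_trans (norm3D _ _) _; rewrite norm3N.
have hS := hM (F - G).
have hT := norm3_modal_op ip_norm e_orthonormal e_total (F - G) hE.
apply: le_trans (lerD hS hT) _; rewrite -mulrDl -/c.
apply: le_trans (ler_wpM2l c0 FG) _.
by rewrite mulrCA ger_pMr// ler_pdivrMr ?ltr_wpDl// mul1r lerDl.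
Qed.

End Identification.

(** * Coordinates on the phase space *)

Section Transfer.
Variables (R : realType) (E Y : lmodType R[i]).
Local Notation C := R[i].
Variables (X : set E) (N : E -> R) (nY : Y -> R) (J : Y -> E) (P : E -> Y).
Hypothesis J_linear : forall (a : C) F G, J (a *: F + G) = a *: J F + J G.
Hypothesis JX : forall F, X (J F).
Hypothesis JK : forall F, P (J F) = F.
Hypothesis PK : forall x, X x -> J (P x) = x.
Hypothesis N_le : forall F, N (J F) <= nY F.
Hypothesis N_ge : forall F, nY F <= 2 * N (J F).
Hypothesis nY_ge0 : forall F, 0 <= nY F.

Lemma N_ge0 F : 0 <= N (J F).
Proof. by have := N_ge F; have := nY_ge0 F => ? ?; lra. Qed.

Lemma cvg0_near_le (T : Type) (F : set_system T) (FF : Filter F) (c : R) (f g : T -> R) :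
  (\forall x \near F, 0 <= g x <= c * f x) -> f @ F --> (0 : R) ->
  g @ F --> (0 : R).
Proof.
move=> gf f0; apply: (squeeze_cvgr gf); first exact: cvg_cst.
by rewrite -(mulr0 c); apply: cvgMl_tmp.
Qed.

Lemma P_linear (a : C) x y : X x -> X y -> P (a *: x + y) = a *: P x + P y.
Proof. by move=> Xx Xy; rewrite -{1}(PK Xx) -{1}(PK Xy) -J_linear JK. Qed.

Lemma J0 : J 0 = 0.
Proof.
by have := J_linear (-1) 0 0; rewrite scaler0 addr0 scaleN1r addNr.
Qed.

Lemma JZ a F : J (a *: F) = a *: J F.
Proof. by have := J_linear a F 0; rewrite !addr0 J0 addr0. Qed.

Lemma JB F G : J (F - G) = J F - J G.
Proof. by rewrite addrC -scaleN1r J_linear scaleN1r addrC. Qed.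

Variable S : R -> E -> E.

(** [X] is only a subset of [E], off which operators are arbitrary; conjugating to the module [Y]
    removes that side condition. *)
Definition conj_semigroup t F := P (S t (J F)).

Lemma J_conj t F : X (S t (J F)) -> J (conj_semigroup t F) = S t (J F).
Proof. exact: PK. Qed.

Lemma C0_transfer : C0_semigroup X N S -> C0_semigroup setT nY conj_semigroup.
Proof.
case=> Sb S0 SD Sc.
have SX t F : 0 <= t -> X (S t (J F)) by move=> /Sb[h _ _]; exact: h.
split.
- move=> t t0; have [_ lin [M hM]] := Sb t t0; split=> //.
    move=> a F G _ _; rewrite /conj_semigroup J_linear lin ?P_linear//;
      exact: SX.
  exists (2 * `|M|) => F _; apply: le_trans (N_ge _) _.
  rewrite J_conj; last exact: SX.
  rewrite -mulrA ler_pM2l//; apply: le_trans (hM _ (JX F)) _.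
  apply: le_trans (_ : `|M| * N (J F) <= _); last by rewrite ler_wpM2l.
  by rewrite ler_wpM2r ?N_ge0// ler_norm.
- by move=> F _; rewrite /conj_semigroup S0.
- move=> s t F s0 t0 _; rewrite /conj_semigroup SD// PK//; exact: SX.
move=> F _; apply: (@cvg0_near_le _ _ _ 2 _ _ _ (Sc (J F) (JX F))).
near=> t; rewrite nY_ge0/=.
have t0 : 0 <= t by near: t; exact: nbhs_right_ge.
by rewrite -(PK (SX t F t0)) -JB; exact: N_ge.
Unshelve. all: by end_near. Qed.

Lemma generator_transfer F G : (forall t, 0 <= t -> X (S t (J F))) ->
  N ((h^-1)%:C *: (S h (J F) - J F) - J G) @[h --> 0^'+] --> (0 : R) ->
  nY ((h^-1)%:C *: (conj_semigroup h F - F) - G) @[h --> 0^'+] --> (0 : R).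
Proof.
move=> SX; apply: (@cvg0_near_le _ _ _ 2).
near=> h; rewrite nY_ge0/=.
have h0 : 0 <= h by near: h; exact: nbhs_right_ge.
by rewrite -(PK (SX h h0)) -JB -JZ -JB; exact: N_ge.
Unshelve. all: by end_near. Qed.

Lemma bounded_transfer (T : Y -> Y) : bounded_operator setT nY T ->
  bounded_operator X N (fun x => J (T (P x))).
Proof.
case=> _ lin [M hM]; split=> [x Xx|a x y Xx Xy|]; first exact: JX.
  by rewrite P_linear// lin// J_linear.
exists (2 * `|M|) => x Xx; apply: le_trans (N_le _) _.
apply: le_trans (hM (P x) I) _; apply: le_trans (_ : `|M| * nY (P x) <= _).
  by rewrite ler_wpM2r// ler_norm.
rewrite [2 * _]mulrC -mulrA ler_wpM2l//; have := N_ge (P x); by rewrite PK.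
Qed.

Lemma analytic_transfer : (forall t x, 0 <= t -> X x -> X (S t x)) ->
  analytic_semigroup setT nY conj_semigroup -> analytic_semigroup X N S.
Proof.
move=> SX [delta [T [hd [Tb TS TD Th Tc]]]].
exists delta, (fun z x => J (T z (P x))); split=> //; split.
- by move=> z zd; apply: bounded_transfer; exact: Tb.
- by move=> t x t0 Xx; rewrite TS// /conj_semigroup !PK//; exact: SX.
- by move=> z1 z2 x h1 h2 Xx; rewrite TD// JK.
- move=> z zd; have [L hL hT] := Th z zd.
  exists (fun x => J (L (P x))); first exact: bounded_transfer.
  move=> eps eps0; have e20 : 0 < eps / 2 by rewrite divr_gt0.
  have := hT _ e20; rewrite /prop_near1; apply: filterS => h hh x Xx.
  rewrite -JB -JZ -JB; apply: le_trans (N_le _) _.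
  apply: le_trans (hh (P x) I) _; have := N_ge (P x); rewrite PK// => hN.
  by rewrite -mulrA ler_pM2l//; lra.
move=> delta' x hd' Xx.
apply: (@cvg0_near_le _ _ _ 1 _ _ _ (Tc delta' (P x) hd' I)).
apply: nearW => z; rewrite mul1r.
by rewrite -{2 4}(PK Xx) -JB N_ge0 N_le.
Qed.

End Transfer.

(** * Powers of the operator and the coordinate isomorphism *)

Section Powers.
Variables (R : realType) (H : completeNormedModType R[i]).
Variable ip : {dot H for Num.conj}.
Hypothesis ip_norm : hilbert_norm ip.
Variable A : operator H.
Local Notation C := R[i].
Let e := (spectral_basis ip A).1.
Let lambda := (spectral_basis ip A).2.
Hypothesis e_orthonormal : forall j k, ip (e j) (e k) = (j == k)%:R.
Hypothesis e_total : forall x : H, (forall k, ip x (e k) = 0) -> x = 0.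
Local Notation fcoef := (fcoef ip e).
Local Notation diag := (diag ip e).

Lemma fcoef_power s x k : dom_power ip A s x ->
  fcoef (power ip A s x) k = ((lambda k `^ s)%:C) * fcoef x k.
Proof. exact: (fcoef_expand ip_norm e_orthonormal). Qed.

Lemma dom_power_diag s (m : nat -> C) (B : R) x :
  (forall k, rn ((lambda k `^ s)%:C * m k) <= B) -> (forall k, rn (m k) <= B) ->
  dom_power ip A s (diag m x).
Proof.
move=> hB hm; rewrite /dom_power /=.
rewrite (_ : power_terms _ _ _ _ =
  (fun k => (((lambda k `^ s)%:C * m k) * fcoef x k) *: e k)).
  exact: (diag_series_cvg ip_norm e_orthonormal hB).
apply/funext => k; rewrite /power_terms -/e -/lambda -/(fcoef (diag m x) k).
by rewrite (fcoef_diag ip_norm e_orthonormal hm) mulrA.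
Qed.

Lemma power_basis s (c : C) k : dom_power ip A s (c *: e k) /\
  power ip A s (c *: e k) = ((lambda k `^ s)%:C * c) *: e k.
Proof.
(* Writing [c *: e k] as its own image under a coordinate projection reduces membership in the
   domain to bounded multipliers. *)
pose m j : C := if j == k then 1 else 0.
have ce : c *: e k = diag m (c *: e k).
  apply: (fcoef_ext e_total) => j.
  rewrite (fcoef_diag ip_norm e_orthonormal (B := 1)).
    rewrite /m fcoefZ (fcoef_basis e_orthonormal) eq_sym.
    by case: eqP; rewrite ?mul1r ?mulr0.
  by move=> i; rewrite /m; case: eqP => _; rewrite ?rn1 ?rn0.
have dom : dom_power ip A s (c *: e k).
  rewrite ce; apply: (@dom_power_diag _ _ (rn ((lambda k `^ s)%:C : C) + 1)).
    move=> j; rewrite /m; case: eqP => [->|_].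
      by rewrite mulr1 lerDl.
    by rewrite mulr0 rn0 addr_ge0 ?rn_ge0.
  move=> j; rewrite /m; case: eqP => _; first by rewrite rn1 lerDr rn_ge0.
  by rewrite rn0 addr_ge0 ?rn_ge0.
split=> //; apply: (fcoef_ext e_total) => j.
rewrite (fcoef_power _ dom) !fcoefZ (fcoef_basis e_orthonormal).
by case: (eqVneq k j) => [->|_]; rewrite ?mulr0// !mulr1.
Qed.

Section Coordinates.
Variables (omega lambda0 : R).
Hypothesis omega_gt0 : 0 < omega.
Hypothesis lambda0_gt0 : 0 < lambda0.
Hypothesis lambda_ge : forall k, lambda0 <= lambda k.

Let lambda_gt0 k : 0 < lambda k.
Proof. exact: lt_le_trans (lambda_ge k). Qed.

(** The symbol of [(I + omega A)^{1/2}], which turns the weighted norm of [H^1] into that of [H]. *)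
Definition mass_root k : R := Num.sqrt (1 + omega * lambda k).

Let D_gt0 k : 0 < 1 + omega * lambda k.
Proof. by rewrite addr_gt0// mulr_gt0. Qed.

Lemma mass_root_sqr k : mass_root k ^+ 2 = 1 + omega * lambda k.
Proof. by rewrite sqr_sqrtr// ltW. Qed.

Lemma mass_root_gt0 k : 0 < mass_root k.
Proof. by rewrite sqrtr_gt0. Qed.

Lemma mass_root_ge1 k : 1 <= mass_root k.
Proof.
rewrite -(ler_pXn2r (n := 2)) ?nnegrE ?sqrtr_ge0// mass_root_sqr expr1n.
by rewrite lerDl mulr_ge0// ltW.
Qed.

Lemma mass_root_inv_le k : (mass_root k)^-1 <= 1.
Proof. by rewrite invf_le1 ?mass_root_gt0// mass_root_ge1. Qed.

Lemma half_sqr k : (lambda k `^ (1 / 2)) ^+ 2 = lambda k.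
Proof. by rewrite div1r powR12_sqrt ?sqr_sqrtr// ltW. Qed.

Definition of_coords (F : H * H * H) : H * H * H :=
  (diag (fun k => ((lambda k)^-1)%:C) F.1.1,
   diag (fun k => ((mass_root k)^-1)%:C) F.1.2, F.2).

(** [mass_root] need not be bounded as a multiplier. For [v] in [H^1] it is applied as [A^{1/2}],
    whose series converges, followed by the bounded multiplier [mass_root / lambda^{1/2}]. *)
Definition to_coords (U : H * H * H) : H * H * H :=
  (power ip A 1 U.1.1,
   diag (fun k => (mass_root k / lambda k `^ (1 / 2))%:C) (power ip A (1 / 2) U.1.2),
   U.2).

Lemma inv_lambda_bound k : rn (((lambda k)^-1)%:C : C) <= lambda0^-1.
Proof.
by rewrite rn_real gtr0_norm ?invr_gt0// lef_pV2 ?posrE//.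
Qed.

Lemma inv_root_bound k : rn (((mass_root k)^-1)%:C : C) <= 1.
Proof. by rewrite rn_real gtr0_norm ?invr_gt0 ?mass_root_gt0// mass_root_inv_le. Qed.

Lemma half_gt0 k : 0 < lambda k `^ (1 / 2).
Proof. exact: powR_gt0. Qed.

Lemma mass_root_half_bound k : rn ((mass_root k / lambda k `^ (1 / 2))%:C : C) <=
  Num.sqrt (lambda0^-1 + omega).
Proof.
rewrite rn_real gtr0_norm ?divr_gt0 ?mass_root_gt0 ?half_gt0//.
have s0 : 0 <= lambda0^-1 + omega by rewrite addr_ge0 ?invr_ge0// ltW.
rewrite -(ler_pXn2r (n := 2)) ?nnegrE ?sqrtr_ge0 ?divr_ge0 ?sqrtr_ge0 ?powR_ge0//.
rewrite sqr_sqrtr// exprMn exprVn half_sqr mass_root_sqr mulrDl mul1r.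
by rewrite mulfK ?gt_eqF// lerD2r lef_pV2 ?posrE//.
Qed.

Lemma half_root_bound k : rn ((lambda k `^ (1 / 2))%:C * ((mass_root k)^-1)%:C : C) <=
  Num.sqrt omega^-1.
Proof.
rewrite -rmorphM /= rn_real gtr0_norm ?divr_gt0 ?mass_root_gt0 ?half_gt0//.
have s0 : 0 <= omega^-1 by rewrite invr_ge0 ltW.
rewrite -(ler_pXn2r (n := 2)) ?nnegrE ?sqrtr_ge0 ?divr_ge0 ?sqrtr_ge0 ?powR_ge0//.
rewrite sqr_sqrtr// exprMn exprVn half_sqr mass_root_sqr ler_pdivrMr//.
by rewrite mulrDr mulr1 mulrA mulVf ?gt_eqF// mul1r lerDr.
Qed.

Lemma Hs2E : Hs ip A 2 = dom_power ip A 1.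
Proof. by rewrite /Hs divff. Qed.

Lemma dom_power_coord1 f : dom_power ip A 1 (diag (fun k => ((lambda k)^-1)%:C) f).
Proof.
apply: (@dom_power_diag _ _ (lambda0^-1 + 1)) => k.
  rewrite -rmorphM /= powRr1 ?(ltW (lambda_gt0 k))// divff ?gt_eqF// rn1 lerDr invr_ge0.
  exact: ltW.
by apply: le_trans (inv_lambda_bound k) _; rewrite lerDl.
Qed.

Lemma dom_power_coord2 g :
  dom_power ip A (1 / 2) (diag (fun k => ((mass_root k)^-1)%:C) g).
Proof.
apply: (@dom_power_diag _ _ (Num.sqrt omega^-1 + 1)) => k.
  by apply: le_trans (half_root_bound k) _; rewrite lerDl.
by apply: le_trans (inv_root_bound k) _; rewrite lerDr sqrtr_ge0.
Qed.

Lemma of_coords_phase F : phase_space ip A (of_coords F).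
Proof.
rewrite /phase_space /= Hs2E; split; first exact: dom_power_coord1.
exact: dom_power_coord2.
Qed.

Lemma of_coords_linear (a : C) F G :
  of_coords (a *: F + G) = a *: of_coords F + of_coords G.
Proof.
rewrite /of_coords /=.
rewrite (diag_linear ip_norm e_orthonormal e_total inv_lambda_bound).
by rewrite (diag_linear ip_norm e_orthonormal e_total inv_root_bound).
Qed.

Lemma power_coord1 f : power ip A 1 (diag (fun k => ((lambda k)^-1)%:C) f) = f.
Proof.
apply: (fcoef_ext e_total) => k; rewrite (fcoef_power _ (@dom_power_coord1 f)).
rewrite (fcoef_diag ip_norm e_orthonormal inv_lambda_bound) mulrA -rmorphM /=.
by rewrite powRr1 ?(ltW (lambda_gt0 k))// divff ?gt_eqF// mul1r.
Qed.

Lemma of_coordsK F : to_coords (of_coords F) = F.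
Proof.
case: F => [[f g] h]; rewrite /to_coords /of_coords /= power_coord1.
congr (_, _, _); apply: (fcoef_ext e_total) => k.
rewrite (fcoef_diag ip_norm e_orthonormal mass_root_half_bound).
rewrite (fcoef_power _ (@dom_power_coord2 g)).
rewrite (fcoef_diag ip_norm e_orthonormal inv_root_bound) !mulrA -!rmorphM /=.
rewrite (_ : _ / _ * _ * _ = 1) ?mul1r//.
by field; rewrite !gt_eqF ?mass_root_gt0 ?powR_gt0.
Qed.

Lemma to_coordsK U : phase_space ip A U -> of_coords (to_coords U) = U.
Proof.
case: U => [[u v] theta]; rewrite /phase_space /= Hs2E => -[hu hv].
rewrite /to_coords /of_coords /=; congr (_, _, _);
  apply: (fcoef_ext e_total) => k.
  rewrite (fcoef_diag ip_norm e_orthonormal inv_lambda_bound).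
  rewrite (fcoef_power _ hu) mulrA -rmorphM /= powRr1 ?(ltW (lambda_gt0 k))// mulVf ?gt_eqF//.
  by rewrite mul1r.
rewrite (fcoef_diag ip_norm e_orthonormal inv_root_bound).
rewrite (fcoef_diag ip_norm e_orthonormal mass_root_half_bound).
rewrite (fcoef_power _ hv) !mulrA -!rmorphM /=.
rewrite (_ : _ * _ * _ = 1) ?mul1r//.
by field; rewrite !gt_eqF ?mass_root_gt0 ?powR_gt0.
Qed.

Lemma coord2_norm g :
  let v := diag (fun k => ((mass_root k)^-1)%:C) g in
  rn v ^+ 2 + omega * rn (power ip A (1 / 2) v) ^+ 2 = rn g ^+ 2.
Proof.
move=> v; set w := power _ _ _ _.
have pv := @parseval _ _ _ ip_norm _ e_orthonormal e_total v.
have pw := @parseval _ _ _ ip_norm _ e_orthonormal e_total w.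
have pg := @parseval _ _ _ ip_norm _ e_orthonormal e_total g.
have pvw : (fun n => \sum_(0 <= k < n) rn (fcoef v k) ^+ 2 +
    omega * \sum_(0 <= k < n) rn (fcoef w k) ^+ 2) @ \oo -->
    rn v ^+ 2 + omega * rn w ^+ 2.
  by apply: cvgD => //; apply: cvgM => //; exact: cvg_cst.
rewrite -(cvg_lim _ pvw)// -(cvg_lim _ pg)//; congr (limn _).
apply/funext => n.
rewrite mulr_sumr -big_split /=; apply: eq_bigr => k _.
rewrite /w (fcoef_power _ (@dom_power_coord2 g)).
rewrite (fcoef_diag ip_norm e_orthonormal inv_root_bound) !rnM !rn_real.
rewrite !ger0_norm ?invr_ge0 ?powR_ge0 ?sqrtr_ge0// !exprMn half_sqr.
by rewrite exprVn mass_root_sqr; field; exact: lt0r_neq0.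
Qed.

Lemma phase_norm_of_coords (F : H * H * H) : phase_norm ip A omega (of_coords F) =
  Num.sqrt (rn F.1.1 ^+ 2 + rn F.1.2 ^+ 2 + rn F.2 ^+ 2).
Proof.
rewrite /phase_norm /of_coords /Hs_norm divff// power_coord1.
by rewrite -(coord2_norm F.1.2).
Qed.

Lemma norm3E (F : H * H * H) : norm3 F = rn F.1.1 + rn F.1.2 + rn F.2.
Proof. by rewrite /norm3 !big_ord_recl big_ord0 addr0 addrA. Qed.

Lemma phase_norm_le (F : H * H * H) : phase_norm ip A omega (of_coords F) <= norm3 F.
Proof.
rewrite phase_norm_of_coords norm3E.
have a0 := rn_ge0 F.1.1; have b0 := rn_ge0 F.1.2; have c0 := rn_ge0 F.2.
set a := rn F.1.1 in a0 *; set b := rn F.1.2 in b0 *; set c := rn F.2 in c0 *.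
have s0 : 0 <= a + b + c by rewrite !addr_ge0.
rewrite -[leRHS]ger0_norm// -sqrtr_sqr; apply: ler_wsqrtr.
have := (mulr_ge0 a0 b0, mulr_ge0 a0 c0, mulr_ge0 b0 c0) => -[[ab ac] bc].
by rewrite -subr_ge0 (_ : _ - _ = 2 * (a * b + a * c + b * c));
  [rewrite mulr_ge0// !addr_ge0|ring].
Qed.

Lemma phase_norm_ge (F : H * H * H) : norm3 F <= 2 * phase_norm ip A omega (of_coords F).
Proof.
rewrite phase_norm_of_coords norm3E.
have a0 := rn_ge0 F.1.1; have b0 := rn_ge0 F.1.2; have c0 := rn_ge0 F.2.
set a := rn F.1.1 in a0 *; set b := rn F.1.2 in b0 *; set c := rn F.2 in c0 *.
have s0 : 0 <= a + b + c by rewrite !addr_ge0.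
have q0 : 0 <= a ^+ 2 + b ^+ 2 + c ^+ 2 by rewrite !addr_ge0 ?sqr_ge0.
rewrite -(ler_pXn2r (n := 2)) ?nnegrE ?mulr_ge0 ?sqrtr_ge0//.
rewrite exprMn sqr_sqrtr//.
have := (sqr_ge0 (a - b), sqr_ge0 (a - c), sqr_ge0 (b - c)) => -[[ab ac] bc].
have := (sqr_ge0 a, sqr_ge0 b, sqr_ge0 c) => -[[aa bb] cc].
rewrite -subr_ge0 (_ : _ - _ = (a - b) ^+ 2 + (a - c) ^+ 2 + (b - c) ^+ 2
  + (a ^+ 2 + b ^+ 2 + c ^+ 2)); last by ring.
by rewrite !addr_ge0.
Qed.

End Coordinates.
End Powers.

(** * Mode parameters and eigenvalues *)

Section ModeParameters.
Variable R : realType.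
Implicit Types (x a : R).

Lemma powR_le_1D x a : 0 < x -> 0 <= a -> a <= 1 -> x `^ a <= 1 + x.
Proof.
move=> x0 a0 a1; have [x1|x1] := leP 1 x.
  apply: le_trans (ler_powR x1 a1) _.
  by rewrite powRr1 ?(ltW x0)// lerDr.
apply: le_trans (_ : 1 `^ a <= _); last by rewrite powR1 lerDl ltW.
by apply: ge0_ler_powR => //; rewrite ?nnegrE ?ler01// ltW.
Qed.

Lemma powR_sqr x a : (x `^ a) ^+ 2 = x `^ (a * 2).
Proof. by rewrite powRrM -powR_mulrn ?powR_ge0. Qed.

Lemma powR_addN x a : 0 < x -> x `^ a * x `^ (- a) = 1.
Proof.
by move=> x0; rewrite -powRD ?subrr ?powRr0//; rewrite (gt_eqF x0) implybT.
Qed.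

Variables (omega sigma lambda0 lambda : R).
Hypotheses (omega_gt0 : 0 < omega) (lambda0_gt0 : 0 < lambda0)
  (lambda_ge : lambda0 <= lambda) (sigma_ge : 5 / 4 <= sigma)
  (sigma_le : sigma <= 3 / 2).

Let s : R := Num.sqrt (1 + omega * lambda).

Definition mode_r : R := lambda `^ (sigma - 1) / s.
Definition mode_t : R := s * lambda `^ (2 - 2 * sigma).

Let lambda_gt0 : 0 < lambda.
Proof. exact: lt_le_trans lambda_ge. Qed.

Let D_gt0 : 0 < 1 + omega * lambda.
Proof. by rewrite addr_gt0// mulr_gt0. Qed.

Let s_sqr : s ^+ 2 = 1 + omega * lambda.
Proof. by rewrite sqr_sqrtr// ltW. Qed.

Let s_gt0 : 0 < s.
Proof. by rewrite sqrtr_gt0. Qed.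

(** The coupling between [p] and [q], divided by [lambda], is [1 / s]; [mode_t] is defined so that
    this coupling factors as [t r^2]. *)
Lemma mode_tr : mode_t * mode_r ^+ 2 = s^-1.
Proof.
rewrite /mode_t /mode_r exprMn powR_sqr exprVn.
have := powR_addN (2 - 2 * sigma) lambda_gt0.
have -> : - (2 - 2 * sigma) = (sigma - 1) * 2 by ring.
set a := _ `^ _; set b := _ `^ _ => ab.
have -> : s * a * (b / s ^+ 2) = (a * b) / s by field; exact: lt0r_neq0.
by rewrite ab mul1r.
Qed.

(** The numerator is [lambda^(2 sigma - 2)], and [sigma <= 3/2] keeps its growth at most linear,
    like that of the denominator. *)
Lemma mode_r_sqr_le : mode_r ^+ 2 <= 1 + omega^-1.
Proof.
have [w0 l0 s1 s2] := And4 omega_gt0 lambda_gt0 sigma_ge sigma_le.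
rewrite /mode_r exprMn powR_sqr exprVn s_sqr ler_pdivrMr//.
apply: le_trans (_ : 1 + lambda <= _).
  by apply: powR_le_1D => //; lra.
have v0 : 0 < omega^-1 by rewrite invr_gt0.
have -> : (1 + omega^-1) * (1 + omega * lambda) =
    1 + lambda + (omega^-1 + omega * lambda) by field; exact: lt0r_neq0.
by rewrite lerDl addr_ge0 ?(ltW v0)// mulr_ge0 ?(ltW w0) ?(ltW l0).
Qed.

(** The square equals [(1 / lambda + omega) * lambda^(5 - 4 sigma)]. For [5/4 <= sigma] the last
    exponent is not positive, so a lower bound on [lambda] suffices. *)
Lemma mode_t_sqr_le :
  mode_t ^+ 2 <= (lambda0^-1 + omega) * (1 + lambda0^-1).
Proof.
have [w0 l0 s1 s2] := And4 omega_gt0 lambda_gt0 sigma_ge sigma_le.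
have li0 : 0 < lambda^-1 by rewrite invr_gt0.
have lile : lambda^-1 <= lambda0^-1 by rewrite lef_pV2 ?posrE.
rewrite /mode_t exprMn powR_sqr s_sqr.
have -> : (2 - 2 * sigma) * 2 = - 1 + (- (4 * sigma - 5)) by ring.
rewrite powRD; last by rewrite (gt_eqF l0) implybT.
rewrite powR_inv1 ?(ltW l0)// mulrA.
have -> : (1 + omega * lambda) * lambda^-1 = lambda^-1 + omega.
  by field; exact: lt0r_neq0.
apply: ler_pM; [by rewrite addr_ge0// ltW|exact: powR_ge0|by rewrite lerD2r|].
have -> : lambda `^ (- (4 * sigma - 5)) = lambda^-1 `^ (4 * sigma - 5).
  by rewrite -powR_inv1 ?(ltW l0)// -powRrM mulN1r.
apply: le_trans (_ : 1 + lambda^-1 <= _); last by rewrite lerD2l.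
by apply: powR_le_1D => //; lra.
Qed.

End ModeParameters.

(** * Existence of the eigenbasis and positivity of the spectrum *)

Section SpectralBasis.
Variables (R : realType) (H : completeNormedModType R[i]).
Variable ip : {dot H for Num.conj}.
Hypothesis ip_norm : hilbert_norm ip.
Variable A : operator H.
Hypothesis A_linear : linear_operator A.
Local Notation C := R[i].

Lemma operator0 : A 0 = 0.
Proof.
have [A0 lin] := A_linear; have [_] := lin 1 0 0 A0 A0.
by rewrite !scale1r addr0 => h; apply: (addrI (A 0)); rewrite addr0 -h.
Qed.

Lemma operatorZ (a : C) x : opdom A x -> opdom A (a *: x) /\ A (a *: x) = a *: A x.
Proof.
have [A0 lin] := A_linear; move=> Ax; have := lin a x 0 Ax A0.
by rewrite !addr0 operator0 addr0.
Qed.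

(** Otherwise every vector is a multiple of [p], and a linear operator on a space of dimension at
    most one is bounded. *)
Lemma unbounded_orthogonal (p : H) : unbounded_operator A ->
  exists2 x : H, x != 0 & ip x p = 0.
Proof.
move=> unb; apply: contrapT => h.
have zero x : ip x p = 0 -> x = 0.
  move=> xp; apply/eqP; apply: contrapT => x0; apply: h; exists x => //.
  exact/negP.
have line x : x = (ip x p / ip p p) *: p.
  apply/eqP; rewrite -subr_eq0; apply/eqP/zero; rewrite ipBl.
  rewrite -[ip (_ *: _) p]/(fcoef ip (fun=> p) (_ *: p) 0%N) fcoefZ /fcoef.
  have [p0|pN0] := eqVneq (ip p p) 0.
    have -> : p = 0.
      apply: rn0_eq0; move: p0; rewrite (ip_rn ip_norm) => /complexI/eqP.
      by rewrite sqrf_eq0 => /eqP.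
    have ip0r y : ip y 0 = 0 by exact: linear0r.
    by rewrite !ip0r mulr0 subrr.
  by rewrite divfK// subrr.
apply: unb.
have [[x0 [Ax0 x0N]]|nox] := pselect (exists x0, opdom A x0 /\ x0 != 0); last first.
  exists 0 => x Ax; have -> : x = 0.
    by apply/eqP; apply: contrapT => xN; apply: nox; exists x; split=> //; exact/negP.
  by rewrite operator0 /rnorm normr0 mul0r.
exists (rn (A x0) / rn x0) => x Ax.
have rx0 : rn x0 != 0 by apply: contra x0N => /eqP/rn0_eq0 ->.
set b := ip x0 p / ip p p; set c := ip x p / ip p p.
have x0E : x0 = b *: p := line x0.
have xE : x = (c / b) *: x0.
  have b0 : b != 0 by apply: contra x0N => /eqP b0; rewrite x0E b0 scale0r.
  by rewrite {1}(line x) x0E scalerA divfK.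
clearbody c; have nx : rn x = rn (c / b) * rn x0 by rewrite xE rnZ.
have AxE : A x = (c / b) *: A x0 by rewrite xE; exact: (operatorZ _ Ax0).2.
rewrite -[rnorm (A x)]/(rn (A x)) -[rnorm x]/(rn x) AxE nx rnZ mulrCA.
by rewrite divfK.
Qed.

(* Were there no eigenbasis, [spectral_basis] would be a pair of constant
   sequences. All powers of [A] then vanish on the vectors orthogonal to the
   constant, so that [phase_norm] does not see the first component of such a
   vector, and the generator of a semigroup would not be the graph of a
   function. *)
Lemma generated_eigenbasis (omega sigma : R) (S : R -> H * H * H -> H * H * H) :
  unbounded_operator A ->
  C0_semigroup (phase_space ip A) (phase_norm ip A omega) S ->
  generated_by (phase_space ip A) (phase_norm ip A omega) S
    (graph_Aomega ip A omega sigma) ->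
  eigenbasis ip A (spectral_basis ip A).
Proof.
move=> unb [Sb _ _ _] gen.
have [[b hb]|nob] := pselect (exists b, eigenbasis ip A b).
  by apply: xgetPex; exists b.
have sbE : spectral_basis ip A = (fun=> point, fun=> point).
  by rewrite /spectral_basis xgetPN// => b hb; apply: nob; exists b.
have [x x0 xp] := unbounded_orthogonal (point : H) unb.
have terms s y : ip y point = 0 -> power_terms ip A s y = (fun=> 0).
  by move=> yp; apply/funext => k; rewrite /power_terms sbE /= yp mulr0 scale0r.
have zero_series : series (fun=> 0 : H) = (fun=> 0).
  by apply/funext => n; rewrite /series /= big1.
have dom s y : ip y point = 0 -> dom_power ip A s y.
  move=> yp; rewrite /dom_power /= terms// zero_series; exact: is_cvg_cst.
have pow s y : ip y point = 0 -> power ip A s y = 0.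
  by move=> yp; rewrite /power terms// zero_series; exact: lim_cst.
have ip0 : ip 0 (point : H) = 0 := fcoef0 ip (fun=> point) 0%N.
have ipNx : ip (- x) (point : H) = 0.
  by have := fcoefN ip (fun=> point) x 0%N; rewrite /fcoef xp oppr0.
have X0 : phase_space ip A 0 by split; exact: dom.
have Xx : phase_space ip A (x, 0, 0) by split; exact: dom.
(* The graph forces the first component of an image to be the velocity, here 0, whereas [x] is not
   0. *)
suff : graph_Aomega ip A omega sigma 0 (x, 0, 0).
  by case=> _ [xE _ _ _]; rewrite xE eqxx in x0.
apply/gen; split=> //.
have S0 h : 0 <= h -> S h 0 = 0.
  move=> /Sb[_ lin _]; have := lin 1 0 0 X0 X0.
  by rewrite !scale1r addr0 => e; apply: (addrI (S h 0)); rewrite addr0 -e.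
have N0 : phase_norm ip A omega (- (x, 0, 0)) = 0.
  rewrite -[- (x, 0, 0)]/(- x, - 0, - 0) !oppr0 /phase_norm /Hs_norm !pow//.
  by rewrite /rnorm normr0 /= expr0n mulr0 !addr0 sqrtr0.
apply/cvgrPdist_le => eps eps0; near=> h.
have h0 : 0 <= h by near: h; exact: nbhs_right_ge.
by rewrite S0// subrr scaler0 (sub0r ((x, 0, 0) : H * H * H)) N0 subrr normr0 ltW.
Unshelve. all: by end_near. Qed.

End SpectralBasis.

Section Eigenvalues.
Variables (R : realType) (H : completeNormedModType R[i]).
Variable ip : {dot H for Num.conj}.
Hypothesis ip_norm : hilbert_norm ip.
Variable A : operator H.
Hypothesis A_linear : linear_operator A.
Hypothesis A_positive : positive_definite ip A.
Variables (e : nat -> H) (lambda : nat -> R).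
Hypothesis basis : eigenbasis ip A (e, lambda).
Local Notation C := R[i].

Let e_orthonormal : forall j k, ip (e j) (e k) = (j == k)%:R.
Proof. by case: basis. Qed.

Let e_eigen k : opdom A (e k) /\ A (e k) = (lambda k)%:C *: e k.
Proof. by case: basis. Qed.

Lemma eigenvector_neq0 k : e k != 0.
Proof.
apply/negP => /eqP ek; have := e_orthonormal k k; rewrite eqxx ek.
rewrite -[ip 0 0]/(fcoef ip (fun=> 0) 0 0%N) fcoef0 => /eqP.
by rewrite eq_sym oner_eq0.
Qed.

Lemma eigenvalue_gt0 k : 0 < lambda k.
Proof.
have [Ak AkE] := e_eigen k; have := A_positive Ak (eigenvector_neq0 k).
rewrite AkE -[ip _ _]/(fcoef ip e ((lambda k)%:C *: e k) k) fcoefZ.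
by rewrite (fcoef_basis e_orthonormal) eqxx mulr1 ltcR.
Qed.

Lemma resolvent_eigenvector z K k : is_resolvent A z K ->
  z != (lambda k)%:C /\ K (e k) = (z - (lambda k)%:C)^-1 *: e k.
Proof.
move=> [_ KA [M hM]]; have [Ak AkE] := e_eigen k.
have zl : z != (lambda k)%:C.
  apply/negP => /eqP zE; have := KA _ Ak; rewrite AkE zE subrr => K0.
  have := hM 0; rewrite K0 -!/(rn _) => h.
  have : rn (e k) <= 0 by have := h; rewrite -[rnorm 0]/(rn 0) rn0 mulr0.
  move=> ek0; have /rn0_eq0 : rn (e k) = 0 by apply/eqP; rewrite eq_le ek0 rn_ge0.
  by move=> ek; have := eigenvector_neq0 k; rewrite ek eqxx.
split=> //.
have [Ac AcE] := operatorZ A_linear (z - (lambda k)%:C)^-1 Ak.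
rewrite -[RHS](KA _ Ac); congr K.
rewrite AcE AkE !scalerA -scalerBl [z * _]mulrC -mulrBr mulVf ?scale1r//.
by rewrite subr_eq0.
Qed.

(** Without a positive lower bound, infinitely many eigenvalues lie below 1. The resolvent maps the
    corresponding orthonormal vectors to points at mutual distance at least [1 / (rn z + 1)], which
    compactness forbids. *)
Lemma eigenvalue_lower_bound : compact_resolvent A ->
  exists2 lambda0 : R, 0 < lambda0 & forall k, lambda0 <= lambda k.
Proof.
move=> [z [K [KA Kcpt]]]; apply: contrapT => unb.
have prefix n : exists2 m : R, 0 < m & forall j, (j < n)%N -> m <= lambda j.
  elim: n => [|n [m m0 hm]]; first by exists 1.
  exists (Num.min m (lambda n)); first by rewrite lt_min m0 eigenvalue_gt0.
  move=> j; rewrite ltnS leq_eqVlt => /predU1P[->|jn].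
    by rewrite ge_min lexx orbT.
  by rewrite ge_min hm.
(* The first [n] eigenvalues have a positive minimum, so they cannot account for the missing
   bound. *)
have small n : exists k, (n <= k)%N /\ lambda k < 1.
  apply: contrapT => h; apply: unb; have [m m0 hm] := prefix n.
  exists (Num.min m 1); first by rewrite lt_min m0 ltr01.
  move=> k; have [kn|nk] := ltnP k n; first by rewrite ge_min hm.
  rewrite ge_min; apply/orP; right; rewrite leNgt; apply/negP => lk.
  by apply: h; exists k.
pose idx n := projT1 (cid (small n)).
have idx_ge n : (n <= idx n)%N by case: (projT2 (cid (small n))).
have idx_lt n : lambda (idx n) < 1 by case: (projT2 (cid (small n))).
pose u n := K (e (idx n)).
pose c := (rn z + 1)^-1.
have c0 : 0 < c by rewrite invr_gt0 ltr_wpDl// rn_ge0.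
have separated m n : idx m != idx n -> c <= rn (u m - u n).
  move=> mn; apply: le_trans (rn_fcoef_le ip_norm e_orthonormal _ (idx m)).
  have [zl um] := resolvent_eigenvector (idx m) KA.
  have [_ un] := resolvent_eigenvector (idx n) KA.
  rewrite /u um un fcoefB !fcoefZ !(fcoef_basis e_orthonormal) eqxx.
  rewrite eq_sym (negbTE mn) mulr1 mulr0 subr0 rnV lef_pV2 ?posrE.
  - apply: le_trans (rnB _ _) _; rewrite lerD2l rn_real gtr0_norm ?eigenvalue_gt0//.
    exact: ltW.
  - by rewrite ltr_wpDl// rn_ge0.
  - by rewrite lt_def rn_ge0 andbT; apply: contra zl => /eqP/rn0_eq0/eqP;
      rewrite subr_eq0.
have [y [_ hy]] : closure (K @` [set x : H | `|x| <= 1]) `&` cluster (u @ \oo) !=set0.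
  move: Kcpt; rewrite /compact_operator precompactE; apply.
  exists 0%N => // n _ /=; apply: subset_closure; exists (e (idx n)) => //=.
  have -> : `|e (idx n)| = 1.
    by rewrite rnE (rn_basis ip_norm e_orthonormal).
  by [].
have c20 : 0 < (c / 2)%:C :> C by rewrite ltcR divr_gt0.
have visit n : exists2 m, (n <= m)%N & rn (y - u m) < c / 2.
  have A1 : (u @ \oo) (u @` [set m | (n <= m)%N]) by exists n => // m /= nm; exists m.
  have [_ [[m /= nm <-]]] := hy _ _ A1 (nbhsx_ballx y _ c20).
  by rewrite -ball_normE /ball_ /= rnE ltcR; exists m.
(* [idx] need not be injective; starting the second visit beyond [idx m] makes the two indices
   differ, since [n <= idx n]. *)
have [m _ hm] := visit 0%N; have [n nm hn] := visit (idx m).+1.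
have mn : idx m != idx n.
  by rewrite neq_ltn (leq_trans nm (idx_ge n)).
have := separated _ _ mn; apply/negP; rewrite -ltNge.
rewrite -(subrK y (u m)) -addrA; apply: le_lt_trans (rnD _ _) _.
by rewrite (rnBC (u m)) [c]splitr ltrD.
Qed.

End Eigenvalues.

(** * The generator on the modes *)

Section ModeGraph.
Variables (R : realType) (H : completeNormedModType R[i]).
Variable ip : {dot H for Num.conj}.
Hypothesis ip_norm : hilbert_norm ip.
Variable A : operator H.
Hypothesis A_linear : linear_operator A.
Local Notation C := R[i].
Local Notation e := (spectral_basis ip A).1.
Local Notation lambda := (spectral_basis ip A).2.
Hypothesis basis : eigenbasis ip A (spectral_basis ip A).
Variables (omega sigma lambda0 : R).
Hypotheses (omega_gt0 : 0 < omega) (lambda0_gt0 : 0 < lambda0)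
  (lambda_ge : forall k, lambda0 <= lambda k).

Let e_orthonormal : forall j k, ip (e j) (e k) = (j == k)%:R.
Proof. by case: basis. Qed.

Let e_total : forall x : H, (forall k, ip x (e k) = 0) -> x = 0.
Proof. by case: basis. Qed.

Let e_eigen k : opdom A (e k) /\ A (e k) = (lambda k)%:C *: e k.
Proof. by case: basis. Qed.

Let lambda_gt0 k : 0 < lambda k.
Proof. exact: lt_le_trans (lambda_ge k). Qed.

Local Notation mass_root := (mass_root ip A omega).
Local Notation J := (of_coords ip A omega).

Lemma diag_basis (m : nat -> C) (B : R) (c : C) k : (forall j, rn (m j) <= B) ->
  diag ip e m (c *: e k) = (m k * c) *: e k.
Proof.
move=> hm; apply: (fcoef_ext e_total) => j.
rewrite (fcoef_diag ip_norm e_orthonormal hm) !fcoefZ (fcoef_basis e_orthonormal).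
by case: (eqVneq k j) => [->|_]; rewrite ?mulr0// !mulr1.
Qed.

Lemma of_coords_basis k (c : 'I_3 -> C) :
  J (triple (fun i => c i *: e k)) =
  ((((lambda k)^-1)%:C * c i0) *: e k, (((mass_root k)^-1)%:C * c i1) *: e k,
   c i2 *: e k).
Proof.
rewrite /of_coords /=.
rewrite (diag_basis _ _ (inv_lambda_bound lambda0_gt0 lambda_ge)).
by rewrite (diag_basis _ _ (inv_root_bound omega_gt0 lambda0_gt0 lambda_ge)).
Qed.

Lemma ip_basisl (a : C) k phi : ip (a *: e k) phi = a * Num.conj (fcoef ip e phi k).
Proof.
rewrite -[ip _ phi]/(fcoef ip (fun=> phi) (a *: e k) 0%N) fcoefZ /fcoef.
by rewrite (ipC ip (e k)).
Qed.

(** The hypothesis is the coefficient at [e k] of [(I + omega A) w = A^sigma theta - A^2 u]; testing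
    it against [phi] brings in the single coefficient of [phi] at [e k]. *)
Lemma graph_basis k (u v theta w : C) :
  (1 + omega * lambda k)%:C * w =
    ((lambda k `^ sigma)%:C * theta - ((lambda k) ^+ 2)%:C * u) ->
  graph_Aomega ip A omega sigma (u *: e k, v *: e k, theta *: e k)
   (v *: e k, w *: e k,
    - ((lambda k)%:C * theta + (lambda k `^ sigma)%:C * v) *: e k).
Proof.
move=> hw; have l0 := lambda_gt0 k.
have pw s (c : C) := power_basis ip_norm e_orthonormal e_total s c k.
have powD (a b : R) : lambda k `^ (a + b) = lambda k `^ a * lambda k `^ b.
  by rewrite powRD// (gt_eqF l0) implybT.
have E3 : - (u *: e k) + power ip A (sigma - 2) (theta *: e k) =
    ((lambda k `^ (sigma - 2))%:C * theta - u) *: e k.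
  by rewrite (pw _ _).2 addrC -scalerBl.
have E2 : - (theta *: e k) - power ip A (sigma - 1) (v *: e k) =
    (- (theta + (lambda k `^ (sigma - 1))%:C * v)) *: e k.
  by rewrite (pw _ _).2 -scaleNr -scalerBl opprD.
split.
  split; [by split; exact: (pw _ _).1|exact: (pw _ _).1| |].
    by rewrite E3; exact: (pw _ _).1.
  by rewrite E2; exact: (pw _ _).1.
split=> //; [exact: (pw _ _).1| |].
  move=> phi hphi; rewrite /I_plus_omega_A /dual_power E3 !(pw _ _).2 !ip_basisl.
  (* The dual pairing shares [A^2] as [A^{3/2}] on the vector and [A^{1/2}] on the test function. *)
  have -> : (2 : R) - 3 / 2 = 2^-1 by lra.
  have hphi' : dom_power ip A 2^-1 phi by move: hphi; rewrite /Hs div1r.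
  rewrite (fcoef_power ip_norm e_orthonormal k hphi').
  have conjM (a : R) (b : C) : Num.conj (a%:C * b) = a%:C * Num.conj b.
    by rewrite rmorphM /=; congr (_ * _); exact: conj_real.
  rewrite !conjM.
  set f := Num.conj (fcoef ip e phi k).
  have half2 : lambda k `^ 2^-1 * lambda k `^ 2^-1 = lambda k.
    rewrite -powD (_ : 2^-1 + 2^-1 = 1) ?powRr1 ?ltW//; lra.
  have h32 : lambda k `^ (3 / 2) * lambda k `^ 2^-1 = lambda k ^+ 2.
    by rewrite -powD -powR_mulrn ?ltW//; congr (_ `^ _); lra.
  have hs : lambda k ^+ 2 * lambda k `^ (sigma - 2) = lambda k `^ sigma.
    rewrite -powR_mulrn ?ltW// -powD; congr (_ `^ _); by rewrite addrC subrK.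
  transitivity ((1 + omega * lambda k)%:C * w * f).
    rewrite rmorphD rmorphM /= -[in RHS]half2 rmorphM /=.
    by rewrite rmorph1; ring.
  rewrite hw -hs -h32 !rmorphM /=; ring.
have [Ak AkE] := e_eigen k.
rewrite E2; have [_ ->] := operatorZ A_linear (- (theta +
  (lambda k `^ (sigma - 1))%:C * v)) Ak.
rewrite AkE scalerA; congr (_ *: _).
have hs : lambda k * lambda k `^ (sigma - 1) = lambda k `^ sigma.
  by rewrite -{1}[lambda k]powRr1 ?ltW// -powD; congr (_ `^ _); rewrite addrC subrK.
by rewrite -hs rmorphM /=; ring.
Qed.

Let t k := mode_t omega sigma (lambda k).
Let r k := mode_r omega sigma (lambda k).

(** Links the matrix to the system: [w1], [w2] and [w3] are the three rows of [modal_mx] read back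
    in the variables [u], [v] and [theta]. *)
Lemma graph_mode k l :
  graph_Aomega ip A omega sigma (J (mode e k l)) (J (gen_mode e lambda t r k l)).
Proof.
have l0 := lambda_gt0 k.
rewrite /mode /gen_mode !of_coords_basis.
have rho0 : 0 < mass_root k := mass_root_gt0 omega_gt0 lambda0_gt0 lambda_ge k.
pose L : C := (lambda k)%:C; pose Li : C := ((lambda k)^-1)%:C.
pose Ri : C := ((mass_root k)^-1)%:C; pose Ls : C := (lambda k `^ sigma)%:C.
pose D : C := (1 + omega * lambda k)%:C.
have LLi : L * Li = 1 by rewrite -rmorphM /= divff ?gt_eqF// rmorph1.
have DRi : D * Ri * Ri = 1.
  rewrite -!rmorphM -[RHS](rmorph1 (real_complex R)) /=; congr _%:C.
  rewrite -(mass_root_sqr omega_gt0 lambda0_gt0 lambda_ge k).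
  by field; exact: lt0r_neq0.
have tr : (t k * r k ^+ 2)%:C = Ri by rewrite /t /r (mode_tr sigma omega_gt0 lambda0_gt0 (lambda_ge k)).
have Lr : L * (r k)%:C = Ls * Ri.
  rewrite -!rmorphM /= /r /mode_r; congr _%:C; rewrite mulrA; congr (_ / _).
  rewrite -{1}[lambda k]powRr1 ?ltW// -powRD; last by rewrite (gt_eqF l0) implybT.
  by rewrite addrC subrK.
have w1 : Li * modal_mx lambda t r k i0 l = Ri * (i1 == l)%:R.
  rewrite /modal_mx !mxE -/L mulrA [Li * L]mulrC LLi mul1r.
  by case: (ord3P l) => -> /=; rewrite ?tr ?mulr1 ?mulr0.
have w2 : D * (Ri * modal_mx lambda t r k i1 l) =
    Ls * (i2 == l)%:R - (lambda k ^+ 2)%:C * (Li * (i0 == l)%:R).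
  rewrite /modal_mx !mxE -/L rmorphXn /= -/L.
  case: (ord3P l) => -> /=.
  - rewrite rmorphN /= tr !mulr1 mulr0 sub0r expr2 -mulrA LLi mulr1.
    by rewrite -[RHS]mulr1 -DRi; ring.
  - by rewrite !mulr0 subr0.
  rewrite Lr !mulr0 subr0 mulr1 -[RHS]mulr1 -DRi; ring.
have w3 : modal_mx lambda t r k i2 l =
    - (L * (i2 == l)%:R + Ls * (Ri * (i1 == l)%:R)).
  rewrite /modal_mx !mxE -/L; case: (ord3P l) => -> /=.
  - by rewrite !mulr0 addr0 oppr0.
  - by rewrite rmorphN /= mulrN Lr !mulr1 mulr0 add0r.
  by rewrite rmorphN rmorph1 !mulr0 addr0 mulr1 mulrN1.
rewrite w1 w3; apply: graph_basis; exact: w2.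
Qed.

End ModeGraph.

Theorem theorem13 (R : realType) (H : completeNormedModType R[i])
    (ip : {dot H for Num.conj}) (H_hilbert : hilbert_norm ip)
    (A : operator H)
    (A_linear : linear_operator A)
    (A_unbounded : unbounded_operator A)
    (A_self_adjoint : self_adjoint ip A)
    (A_positive : positive_definite ip A)
    (A_compact_resolvent : compact_resolvent A)
    (omega sigma : R) (omega_gt0 : 0 < omega)
    (sigma_bounds : 5 / 4 <= sigma <= 3 / 2)
    (S : R -> H * H * H -> H * H * H)
    (S_C0 : C0_semigroup (phase_space ip A) (phase_norm ip A omega) S)
    (S_gen : generated_by (phase_space ip A) (phase_norm ip A omega) S
               (graph_Aomega ip A omega sigma)) :
  analytic_semigroup (phase_space ip A) (phase_norm ip A omega) S.
Proof.
have basis := generated_eigenbasis H_hilbert A_linear A_unbounded S_C0 S_gen.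
have [orth total _] := basis.
pose e := (spectral_basis ip A).1; pose lambda := (spectral_basis ip A).2.
have basis' : eigenbasis ip A (e, lambda) := basis.
have [lambda0 lambda00 lambda_ge] :=
  eigenvalue_lower_bound H_hilbert A_linear A_positive basis' A_compact_resolvent.
have lambda_gt0 k : 0 < lambda k := lt_le_trans lambda00 (lambda_ge k).
have [sigma_ge sigma_le] := andP sigma_bounds.
pose t k := mode_t omega sigma (lambda k).
pose r k := mode_r omega sigma (lambda k).
pose Lr := 1 + omega^-1; pose Lt := (lambda0^-1 + omega) * (1 + lambda0^-1).
have Lr0 : 0 <= Lr by rewrite addr_ge0// invr_ge0 ltW.
have Lt0 : 0 <= Lt.
  by rewrite mulr_ge0// addr_ge0 ?invr_ge0// ltW.
(* The sum of the two bounds serves for both [r ^+ 2] and [t ^+ 2]. *)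
have [kappa [K [kappa0 K0 bounds]]] := mode_exp_bounds (addr_ge0 Lr0 Lt0).
have mode_bounds k (z : R[i]) : 0 <= complex.Re z ->
  `|complex.Im z| <= kappa * complex.Re z -> forall i j,
   let M := mode_mx (t k) (r k) in let G := mexp (z *: M) in
   [/\ rn (G i j) <= K, rn z * rn ((M * G) i j) <= K &
       rn z ^+ 2 * rn ((M * (M * G)) i j) <= K].
  apply: bounds.
    apply: le_trans (mode_t_sqr_le omega_gt0 lambda00 (lambda_ge k) sigma_ge sigma_le) _.
    by rewrite lerDr.
  apply: le_trans (mode_r_sqr_le omega_gt0 lambda00 (lambda_ge k) sigma_ge sigma_le) _.
  by rewrite lerDl.
have Jlin := of_coords_linear H_hilbert orth total omega_gt0 lambda00 lambda_ge.
have JX := of_coords_phase H_hilbert orth omega_gt0 lambda00 lambda_ge.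
have JK := of_coordsK H_hilbert orth total omega_gt0 lambda00 lambda_ge.
have PK := to_coordsK H_hilbert orth total omega_gt0 lambda00 lambda_ge.
have Nle := phase_norm_le H_hilbert orth total omega_gt0 lambda00 lambda_ge.
have Nge := phase_norm_ge H_hilbert orth total omega_gt0 lambda00 lambda_ge.
have n0 := @norm3_ge0 R H.
have SX s x : 0 <= s -> phase_space ip A x -> phase_space ip A (S s x).
  by case: S_C0 => Sb _ _ _ /Sb[h _ _]; exact: h.
have C0' := C0_transfer Jlin JX JK PK Nle Nge n0 S_C0.
have gen' k l := generator_transfer Jlin PK Nge n0
  (fun s s0 => SX s _ s0 (JX (mode e k l)))
  (let: And3 _ _ h := (S_gen _ _).1 (graph_mode H_hilbert A_linear basis
     sigma omega_gt0 lambda00 lambda_ge k l) in h).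
have ST := S_eq_T H_hilbert orth total lambda_gt0 kappa0 K0 mode_bounds C0' gen'.
(* Holomorphy at a point needs a ball around it inside the cone where the bounds hold, so the sector
   is fitted to half the slope. *)
have kappa20 : 0 < kappa / 2 by rewrite divr_gt0.
have [delta [hdelta hcone]] := sector_cone kappa20.
have hcone' z : sector delta z -> cone kappa z.
  by move=> /hcone; exact: cone_half.
apply: (analytic_transfer Jlin JX JK PK Nle Nge n0 SX).
exists delta, (modal_semigroup ip e lambda t r); split=> //; split.
- move=> z /hcone' zc.
  exact: (modal_semigroup_bounded H_hilbert orth total lambda_gt0 mode_bounds zc).
- by move=> s F s0 _; rewrite -ST.
- move=> z w F /hcone' zc /hcone' wc _.
  exact: (modal_semigroupD H_hilbert orth total lambda_gt0 mode_bounds F zc wc).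
- exact: (modal_semigroup_holomorphic H_hilbert orth total lambda_gt0 kappa0 K0
    mode_bounds).
(* The smaller sector lies in the larger one, on all of which continuity at 0 already holds. *)
move=> delta' F /andP[_ dd'] _.
apply: (modal_semigroup_cvg0 H_hilbert orth total lambda_gt0 K0 mode_bounds).
move=> z [r' [a [r'0 ha zE]]]; apply: hcone'; exists r', a; split=> //.
exact: lt_trans dd'.
Qed.
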